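(* Let $E$ be a compact metric space and let $\{T_t\}_{t\ge0}$ be a Feller semigroup on $E$ whose transition kernels are of the form $p_{t,x}(dy)=p_t(x,y)\,\mathbf{m}(dy)$ for $t>0$, $x\in E$, for some finite positive measure $\mathbf{m}$ on $E$ and some density function $p_t(x,y)$ which is bounded and symmetric on $E\times E$ for each $t>0$. Let $\{T^{(2)}_t\}$ be the extension of $\{T_t\}$ to a strongly continuous semigroup on $L^2(E,\mathbf{m})$, with generator $\mathcal{G}^{(2)}$. Let $0\le\lambda_1\le\lambda_2\le\lambda_3\le\dots$ be the eigenvalues of $-\mathcal{G}^{(2)}$ and let $\{\varphi_j\}_{j\in\mathbb{N}}\subset L^2(E,\mathbf{m})$ be an orthogonal set of functions such that $$T_t^{(2)}\varphi_j=e^{-\lambda_jt}\varphi_j,\qquad \varphi_1=\mathbf{1},\qquad \sup_j\|\varphi_j\|_2<\infty,$$ where $\|\cdot\|_2$ denotes the norm of the space $L^2(E,\mathbf{m})$. Then $\varphi_j\in\mathrm{C}(E)$ for all $j\in\mathbb{N}$, and the series $\sum_{j=1}^\infty\frac{1}{\|\varphi_j\|_2^2}e^{-\lambda_jt}\varphi_j(x)\,\varphi_j(y)\,\varphi_j(\xi)$ is absolutely convergent for all $t>0$ and $x,y,\xi\in E$. Moreover, the following assertions are equivalent: (i) We have $$q_t(x,y,\xi):=\sum_{j=1}^\infty\frac{1}{\|\varphi_j\|_2^2}e^{-\lambda_jt}\varphi_j(x)\,\varphi_j(y)\,\varphi_j(\xi)\ge0\qquad\text{for all }t>0\text{ and }x,y,\xi\in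 E.$$ (ii) For each $x,y\in E$ there exists a measure $\boldsymbol{\nu}_{x,y}\in\mathcal{P}(E)$ such that the product $\varphi_j(x)\,\varphi_j(y)$ admits the integral representation $$\varphi_j(x)\,\varphi_j(y)=\int_E\varphi_j(\xi)\,\boldsymbol{\nu}_{x,y}(d\xi),\qquad x,y\in E,\ j\in\mathbb{N}.$$ If these equivalent conditions hold and, in addition, there exists $a\in E$ such that $\varphi_j(a)=1$ for all $j\in\mathbb{N}$, then the bilinear operator $\diamond$ on $\mathcal{M}_{\mathbb{C}}(E)$ defined as $$(\mu\diamond\nu)(d\xi)=\int_E\int_E\boldsymbol{\nu}_{x,y}(d\xi)\,\mu(dx)\,\nu(dy)$$ is a Feller-Lévy trivializable convolution (FLTC) for $\{T_t\}$ with trivializing family $\Theta=\{\varphi_j\}_{j\in\mathbb{N}}$.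
   Context: The statement $\varphi_j\in\mathrm{C}(E)$ means that $\varphi_j$ is continuous after possible modification on an $\mathbf{m}$-null set; pointwise values of $\varphi_j$ refer to this continuous representative. $\mathbf{1}$ is the constant function equal to one. $L^2(E,\mathbf{m})$ is the Lebesgue space of complex-valued functions. $\mathcal{M}_{\mathbb{C}}(E)$ and $\mathcal{P}(E)$ denote the finite complex Borel measures and the Borel probability measures on $E$; $\delta_x$ is the Dirac measure at $x$; the weak topology is the one induced by integration against bounded continuous functions; $\mu(\vartheta):=\int_E\vartheta\,d\mu$. $\mathrm{B}_{\mathrm{b}}(E)$, $\mathrm{C}_{\mathrm{b}}(E)$, $\mathrm{C}_0(E)$, $\mathrm{C}(E)$ are the spaces of bounded measurable, bounded continuous, continuous vanishing at infinity, and continuous complex-valued functions on $E$ (the last three coincide for $E$ compact). A Feller semigroup on $E$ is a strongly continuous semigroup $\{T_t\}_{t\ge0}$ of positive linear contractions on $\mathrm{C}_0(E)$. Its transition kernel $\{p_{t,x}\}$ is the family of (sub-)probability measures with $(T_tf)(x)=\int_Ef\,dp_{t,x}$, and $T_t$ is extended to $\mathrm{B}_{\mathrm{b}}(E)$ by this formula. It is strong Feller if $T_t(\mathrm{B}_{\mathrm{b}}(E))\subset\mathrm{C}_{\mathrm{b}}(E)$ for all $t>0$. Under the density assumption in the claim, $\{T_t\}$ is strong Feller and extends to a strongly continuous semigroup $\{T_t^{(2)}\}$ of symmetric operators on $L^2(E,\mathbf{m})$; the numbers $\lambda_j$ are the eigenvalues of $-\mathcal{G}^{(2)}$ listed along an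 orthonormal basis of $L^2(E,\mathbf{m})$ consisting of eigenfunctions, and they satisfy $\sum_j e^{-\lambda_jt}<\infty$ for each $t>0$. Definition (FLTC). Let $\{T_t\}$ be a strong Feller semigroup on a locally compact separable metric space $E$ with transition kernel $\{p_{t,x}\}$. A bilinear operator $\diamond$ on $\mathcal{M}_{\mathbb{C}}(E)$ is an FLTC for $\{T_t\}$ if: (I) $(\mathcal{M}_{\mathbb{C}}(E),\diamond)$ is a commutative Banach algebra over $\mathbb{C}$ (with respect to the total variation norm) with identity element $\delta_a$ for some $a\in E$, and $(\mu,\nu)\mapsto\mu\diamond\nu$ is continuous in the weak topology of measures; (II) $\mathcal{P}(E)\diamond\mathcal{P}(E)\subset\mathcal{P}(E)$; (III) there is a family $\Theta\subset\mathrm{B}_{\mathrm{b}}(E)\setminus\{0\}$ (the trivializing family) such that $\mu=\mu_1\diamond\mu_2$ if and only if $\mu(\vartheta)=\mu_1(\vartheta)\,\mu_2(\vartheta)$ for all $\vartheta\in\Theta$; (IV) $p_{t,x}=\gamma_t\diamond\delta_x$ for all $t\ge0$, $x\in E$, where $\{\gamma_t\}_{t\ge0}\subset\mathcal{P}(E)$ satisfies $\gamma_{t+s}=\gamma_t\diamond\gamma_s$ for all $t,s\ge0$.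
   Formalization: The equivalence (i)⇔(ii) is stated for real-valued φ_j or when φ_j(a)=1 for some a and all j; FLTC is concluded for conservative T_t (else γ_t are sub-probabilities); weak continuity of ⋄ is for sequences, in each variable, and jointly on norm-bounded sets. *)

(* Defs.v *)
From HB Require Import structures.
From mathcomp Require Import all_boot all_order all_algebra.
From mathcomp Require Import all_classical all_reals all_analysis.
From mathcomp Require Import measurable_realfun complex.

Set Implicit Arguments.
Unset Strict Implicit.
Unset Printing Implicit Defensive.

Import Order.TTheory GRing.Theory Num.Theory.
Import numFieldNormedType.Exports.
Import ComplexField.Normc.

Local Open Scope classical_set_scope.
Local Open Scope ring_scope.

(* The measurable types of the library are pointed, hence this join; the
   base point plays no role beyond making the space nonempty. *)
#[short(type="pmetricType")]
HB.structure Definition PointedMetric (K : numDomainType) :=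
  { M of Metric K M & Pointed M }.

Definition borel (E : ptopologicalType) := g_sigma_algebraType (@open E).

Section Complex.
Context {R : realType}.

Lemma normr_normc (z : R[i]) : `|z| = (normc z)%:C%C.
Proof. by rewrite normc_def; case: z. Qed.

Lemma normr_normc_Re (z : R[i]) : `|complex.Re z| <= normc z.
Proof. by have := normc_ge_Re z; rewrite normr_normc lecR. Qed.

Lemma normc_real (x : R) : normc x%:C%C = `|x|.
Proof. by rewrite /= expr0n addr0 sqrtr_sqr. Qed.

Lemma cvg_Re (u : nat -> R[i]) (l : R[i]) :
  ((u : nat -> (R[i])^o) @ \oo --> (l : (R[i])^o)) ->
  (fun n => complex.Re (u n)) @ \oo --> complex.Re l.
Proof.
move=> /cvgrPdist_lt ul; apply/cvgrPdist_lt => e e0.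
have e0' : (0 : R[i]) < e%:C%C by rewrite ltcR.
apply: filterS (ul _ e0') => n /=.
rewrite normr_normc ltcR; apply: le_lt_trans.
by have := normr_normc_Re (l - u n); case: l {ul} (u n) => a b [].
Qed.

Lemma cvg_Im (u : nat -> R[i]) (l : R[i]) :
  ((u : nat -> (R[i])^o) @ \oo --> (l : (R[i])^o)) ->
  (fun n => complex.Im (u n)) @ \oo --> complex.Im l.
Proof.
have ImRe (z : R[i]) : complex.Im z = complex.Re (- 'i%C * z).
  by case: z => a b /=; rewrite oppr0 mul0r mulN1r opprK add0r.
rewrite ImRe; under eq_fun do rewrite ImRe.
by move=> ul; apply: cvg_Re; exact: (cvgMl_tmp ul).
Qed.

Lemma cvg_real_complex (u : nat -> R) (l : R) :
  u @ \oo --> l ->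
  ((fun n => (u n)%:C%C) : nat -> (R[i])^o) @ \oo --> (l%:C%C : (R[i])^o).
Proof.
move=> /cvgrPdist_lt ul; apply/cvgrPdist_lt => e e0.
have eR : e = (complex.Re e)%:C%C by rewrite RRe_real// ger0_real// ltW.
have e0' : 0 < complex.Re e by rewrite -ltcR -eR.
apply: filterS (ul _ e0') => n /=.
by rewrite -rmorphB normr_normc normc_real eR ltcR.
Qed.

End Complex.

Section ComplexIntegral.
Context d (T : measurableType d) {R : realType}.
Implicit Types (mu : {measure set T -> \bar R}) (f g : T -> R[i]).

Definition cmeasurable f :=
  measurable_fun setT (fun x => complex.Re (f x)) /\
  measurable_fun setT (fun x => complex.Im (f x)).

Definition cintm mu f : R[i] :=
  ((\int[mu]_x complex.Re (f x)) +i* (\int[mu]_x complex.Im (f x)))%C.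

(* Complex L^2 classes are handled through representatives, equality being
   almost everywhere equality. *)
Definition Lnorm2 mu f : \bar R := Lnorm mu 2%:E (fun x => (normc (f x))%:E).

Definition L2 mu f := cmeasurable f /\ (Lnorm2 mu f < +oo)%E.

Definition L2norm mu f : R := fine (Lnorm2 mu f).

Definition L2inner mu f g : R[i] := cintm mu (fun x => f x * ((g x)^*)%C).

Definition orthogonal_family mu (phi : nat -> T -> R[i]) :=
  [/\ forall j, L2 mu (phi j),
      forall j, L2norm mu (phi j) != 0
    & forall j k, j != k -> L2inner mu (phi j) (phi k) = 0].

Definition orthonormal_basis mu (omega : nat -> T -> R[i]) :=
  [/\ orthogonal_family mu omega,
      forall j, L2norm mu (omega j) = 1
    & forall f, L2 mu f ->
        L2norm mu (fun x =>
          f x - \sum_(0 <= j < n) L2inner mu f (omega j) * omega j x)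
        @[n --> \oo] --> (0 : R)].

Record L2_semigroup mu (S : R -> (T -> R[i]) -> (T -> R[i])) : Prop := {
  L2_semigroup_L2 : forall t f, 0 <= t -> L2 mu f -> L2 mu (S t f) ;
  L2_semigroup_ae : forall t f g, 0 <= t -> L2 mu f -> L2 mu g ->
    f = g %[ae mu] -> S t f = S t g %[ae mu] ;
  L2_semigroup_linear : forall t c f g, 0 <= t -> L2 mu f -> L2 mu g ->
    S t (fun x => c * f x + g x) = (fun x => c * S t f x + S t g x) %[ae mu] ;
  L2_semigroup_bounded : forall t, 0 <= t -> exists M : R, forall f, L2 mu f ->
    L2norm mu (S t f) <= M * L2norm mu f ;
  L2_semigroup0 : forall f, L2 mu f -> S 0 f = f %[ae mu] ;
  L2_semigroupD : forall s t f, 0 <= s -> 0 <= t -> L2 mu f ->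
    S (s + t) f = S s (S t f) %[ae mu] ;
  L2_semigroup_continuous : forall f, L2 mu f ->
    L2norm mu (fun x => S t f x - f x) @[t --> 0^'+] --> (0 : R)
}.

(* f is in the domain of the generator of S, which maps f to g *)
Definition L2_generator mu (S : R -> (T -> R[i]) -> (T -> R[i])) f g :=
  [/\ L2 mu f, L2 mu g
    & L2norm mu (fun x => (t^-1)%:C%C * (S t f x - f x) - g x) @[t --> 0^'+]
      --> (0 : R)].

(* lambda lists, in nondecreasing order and with multiplicities, the
   eigenvalues of minus the generator of S, the latter having an orthonormal
   basis of eigenfunctions *)
Definition eigenvalue_listing mu (S : R -> (T -> R[i]) -> (T -> R[i]))
    (lambda : nat -> R) :=
  [/\ 0 <= lambda 0%N, {homo lambda : i j / (i <= j)%N >-> i <= j}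
    & exists2 omega, orthonormal_basis mu omega &
        forall j, L2_generator mu S (omega j)
                    (fun x => - ((lambda j)%:C%C * omega j x))].

End ComplexIntegral.

Section ComplexMeasure.
Context d (T : measurableType d) (R : realType).

(* Set functions are total in the library: a complex measure is normalized to
   vanish on nonmeasurable sets, so that Leibniz equality is equality of
   measures. *)
Definition is_cmeasure (mu : set T -> R[i]) : Prop :=
  [/\ forall A, ~ measurable A -> mu A = 0,
      mu set0 = 0
    & forall F : (set T)^nat, (forall i, measurable (F i)) -> trivIset setT F ->
        (fun n => \sum_(0 <= i < n) mu (F i) : (R[i])^o) @ \oo
        --> (mu (\bigcup_i F i) : (R[i])^o)].

Definition cmeasure_pred : {pred set T -> R[i]} :=
  [pred mu | `[< is_cmeasure mu >]].

Record cmeasure := CMeasure {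
  cmeasure_fun :> set T -> R[i] ;
  _ : cmeasure_fun \in cmeasure_pred }.

HB.instance Definition _ := [isSub for cmeasure_fun].
HB.instance Definition _ := [Choice of cmeasure by <:].

Lemma cmeasure_predP mu : reflect (is_cmeasure mu) (mu \in cmeasure_pred).
Proof. exact: asboolP. Qed.

Lemma is_cmeasure0 : is_cmeasure (fun=> 0).
Proof.
split=> // F mF tF; under eq_fun do rewrite big1//; exact: cvg_cst.
Qed.

Lemma is_cmeasure_lin (a : R[i]) (u v : set T -> R[i]) :
  is_cmeasure u -> is_cmeasure v -> is_cmeasure (fun A => a * u A + v A).
Proof.
move=> [u0 u1 u2] [v0 v1 v2]; split.
- by move=> A nA; rewrite u0// v0// mulr0 addr0.
- by rewrite u1 v1 mulr0 addr0.
- move=> F mF tF.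
  rewrite (_ : (fun n => _) = (fun n => a * (\sum_(0 <= i < n) u (F i)) +
      \sum_(0 <= i < n) v (F i) : (R[i])^o)).
    by apply: cvgD; [apply: cvgMl_tmp; exact: u2|exact: v2].
  by apply/funext => n; rewrite big_split -big_distrr.
Qed.

Lemma cmeasure_submod_closed : submod_closed cmeasure_pred.
Proof.
split=> [|a u v]; first exact/cmeasure_predP/is_cmeasure0.
move=> /cmeasure_predP u0 /cmeasure_predP v0; apply/cmeasure_predP.
exact: is_cmeasure_lin.
Qed.

HB.instance Definition _ := GRing.isSubmodClosed.Build _ _ cmeasure_pred
  cmeasure_submod_closed.
HB.instance Definition _ :=
  [SubChoice_isSubLmodule of cmeasure by <:].

Lemma cmeasureP (mu : cmeasure) : is_cmeasure mu.
Proof. by case: mu => mu /= /cmeasure_predP. Qed.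

Lemma cmeasure_charge (h : R[i] -> R) (mu : cmeasure) :
  h 0 = 0 -> {morph h : x y / x + y} ->
  (forall (u : nat -> R[i]) (l : R[i]),
    ((u : nat -> (R[i])^o) @ \oo --> (l : (R[i])^o)) ->
    (fun n => h (u n)) @ \oo --> h l) ->
  semi_sigma_additive (fun A => (h (mu A))%:E).
Proof.
move=> h0 hD ch F mF tF _.
have [_ _ /(_ F mF tF)/ch cmu] := cmeasureP mu.
under eq_fun do rewrite sumEFin.
apply/cvg_EFin; first exact: nearW.
apply: cvg_trans cmu; apply: near_eq_cvg; apply: nearW => n /=.
by rewrite (big_morph h hD h0).
Qed.

Section Parts.
Variable mu : cmeasure.

Definition re_charge (A : set T) : \bar R := (complex.Re (mu A))%:E.

Let re0 : re_charge set0 = 0%E.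
Proof. by rewrite /re_charge; have [_ -> _] := cmeasureP mu. Qed.

Let re_fin A : measurable A -> re_charge A \is a fin_num.
Proof. by []. Qed.

Let re_sigma : semi_sigma_additive re_charge.
Proof.
by apply: (@cmeasure_charge (@complex.Re R)) => //; [case=> ? ? []|exact: cvg_Re].
Qed.

HB.instance Definition _ := isCharge.Build _ T R re_charge re0 re_fin re_sigma.

Definition im_charge (A : set T) : \bar R := (complex.Im (mu A))%:E.

Let im0 : im_charge set0 = 0%E.
Proof. by rewrite /im_charge; have [_ -> _] := cmeasureP mu. Qed.

Let im_fin A : measurable A -> im_charge A \is a fin_num.
Proof. by []. Qed.

Let im_sigma : semi_sigma_additive im_charge.
Proof.
by apply: (@cmeasure_charge (@complex.Im R)) => //; [case=> ? ? []|exact: cvg_Im].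
Qed.

HB.instance Definition _ := isCharge.Build _ T R im_charge im0 im_fin im_sigma.

End Parts.

(* integral against the Jordan decomposition of a real charge *)
Definition charge_integral (nu : {charge set T -> \bar R}) (f : T -> R) : R :=
  let nuP := projT2 (cid (projT2 (cid (Hahn_decomposition nu)))) in
  (\int[jordan_pos nuP]_x f x) - (\int[jordan_neg nuP]_x f x).

Definition cint (mu : cmeasure) (f : T -> R[i]) : R[i] :=
  ((charge_integral (re_charge mu) (fun x => complex.Re (f x))
    - charge_integral (im_charge mu) (fun x => complex.Im (f x)))
   +i*
   (charge_integral (re_charge mu) (fun x => complex.Im (f x))
    + charge_integral (im_charge mu) (fun x => complex.Re (f x))))%C.

(* The supremum over countable measurable partitions is the supremum of their
   partial sums. *)
Definition total_variation (mu : cmeasure) : R :=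
  sup [set s | exists (A : (set T)^nat) (n : nat),
    [/\ forall i, measurable (A i), trivIset setT A
      & s = \sum_(0 <= i < n) normc (mu (A i))]].

Section OfMeasure.
Variable m : {finite_measure set T -> \bar R}.

Definition of_measure_fun (A : set T) : R[i] :=
  if `[< measurable A >] then (fine (m A))%:C%C else 0.

Lemma of_measure_subproof : of_measure_fun \in cmeasure_pred.
Proof.
apply/cmeasure_predP; split=> [A nA||F mF tF]; rewrite /of_measure_fun.
- by rewrite asboolF.
- by rewrite measure0 if_same.
- have mUF : measurable (\bigcup_i F i) by exact: bigcupT_measurable.
  rewrite asboolT//.
  have cm : (fun n => fine (\sum_(0 <= i < n) m (F i))%E) @ \oo
      --> fine (m (\bigcup_i F i)).
    apply: fine_cvg; rewrite fineK ?fin_num_measure//.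
    exact: measure_semi_sigma_additive.
  rewrite (_ : (fun n => _) = (fun n =>
      (fine (\sum_(0 <= i < n) m (F i))%E)%:C%C)); first exact: cvg_real_complex.
  apply/funext => n; rewrite -sum_fine; last first.
    by move=> i _; rewrite fin_num_measure.
  by rewrite rmorph_sum; apply: eq_bigr => i _; rewrite asboolT.
Qed.

Definition of_measure : cmeasure := CMeasure of_measure_subproof.

End OfMeasure.

End ComplexMeasure.

Arguments cmeasure {d} T R.

Section BanachAlgebra.
Context {R : realType} (V : lmodType R[i]).

Record comm_banach_algebra (nrm : V -> R) (mul : V -> V -> V) (e : V) : Prop := {
  cba_norm0 : forall x, nrm x = 0 -> x = 0 ;
  cba_normD : forall x y, nrm (x + y) <= nrm x + nrm y ;
  cba_normZ : forall c x, nrm (c *: x) = normc c * nrm x ;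
  cba_complete : forall u : nat -> V,
    (forall eps : R, 0 < eps -> exists N, forall i j, (N <= i)%N -> (N <= j)%N ->
      nrm (u i - u j) < eps) ->
    exists l, nrm (u n - l) @[n --> \oo] --> (0 : R) ;
  cba_linear : forall c x y z, mul (c *: x + y) z = c *: mul x z + mul y z ;
  cba_mulC : forall x y, mul x y = mul y x ;
  cba_mulA : forall x y z, mul x (mul y z) = mul (mul x y) z ;
  cba_mul1 : forall x, mul e x = x ;
  cba_norm1 : nrm e = 1 ;
  cba_normM : forall x y, nrm (mul x y) <= nrm x * nrm y
}.

End BanachAlgebra.

Section FellerSemigroups.
Context {R : realType} (E : pmetricType R).
Implicit Types (f g : E -> R[i]) (T : R -> (E -> R[i]) -> (E -> R[i])).

Definition ccontinuous f := continuous (f : E -> (R[i])^o).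

Definition cbounded f := exists M : R, forall x, normc (f x) <= M.

Definition Bb : set (E -> R[i]) :=
  [set f | @cmeasurable _ (borel E) R f /\ cbounded f].

Definition Cb : set (E -> R[i]) := [set f | ccontinuous f /\ cbounded f].

Definition C0 : set (E -> R[i]) :=
  [set f | ccontinuous f /\ forall eps : R, 0 < eps ->
    exists2 K : set E, compact K & forall x, ~ K x -> normc (f x) < eps].

Definition sup_norm f : R := sup [set normc (f x) | x in [set: E]].

Record feller_semigroup T : Prop := {
  feller_C0 : forall t f, 0 <= t -> C0 f -> C0 (T t f) ;
  feller_linear : forall t c f g, 0 <= t -> C0 f -> C0 g ->
    T t (fun x => c * f x + g x) = (fun x => c * T t f x + T t g x) ;
  feller_positive : forall t f, 0 <= t -> C0 f ->
    (forall x, 0 <= f x) -> forall x, 0 <= T t f x ;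
  feller_contraction : forall t f, 0 <= t -> C0 f ->
    sup_norm (T t f) <= sup_norm f ;
  feller0 : forall f, C0 f -> T 0 f = f ;
  fellerD : forall s t f, 0 <= s -> 0 <= t -> C0 f -> T (s + t) f = T s (T t f) ;
  feller_continuous : forall f, C0 f ->
    sup_norm (fun x => T t f x - f x) @[t --> 0^'+] --> (0 : R)
}.

Definition transition_kernel T (p : R -> E -> subprobability (borel E) R) :=
  forall t f x, 0 <= t -> C0 f -> T t f x = cintm (p t x) f.

Definition conservative (p : R -> E -> subprobability (borel E) R) :=
  forall t x, 0 <= t -> p t x setT = 1%E.

Definition strong_feller T (p : R -> E -> subprobability (borel E) R) :=
  [/\ feller_semigroup T, transition_kernel T p
    & forall t f, 0 < t -> Bb f -> Cb (fun x => cintm (p t x) f)].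

End FellerSemigroups.

Section FLTC.
Context {R : realType} (E : pmetricType R).
Local Notation M := (cmeasure (borel E) R).
Implicit Types conv : M -> M -> M.

Definition cdirac (x : E) : M := of_measure (@dirac _ (borel E) x R).

(* topology induced by integration against bounded continuous functions *)
Definition weak_cmeasure : Type :=
  initial_topology ((fun mu f => cint mu (sval f)) :
    M -> prod_topology (fun _ : {f : E -> R[i] | Cb f} => (R[i])^o)).

HB.instance Definition _ := Topological.on weak_cmeasure.

(* Continuity for the weak convergence of sequences of measures, continuity in
   each variable, and joint continuity on norm-bounded sets.  Joint continuity
   for the weak topology on the whole of M * M would be too strong: a bilinear
   form with this property is of finite rank. *)
Definition weakly_continuous conv :=
  [/\ forall (u v : nat -> weak_cmeasure) (mu nu : weak_cmeasure),
        u @ \oo --> mu -> v @ \oo --> nu ->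
        ((fun n => conv (u n) (v n)) : nat -> weak_cmeasure) @ \oo
          --> (conv mu nu : weak_cmeasure),
      forall nu, continuous ((conv ^~ nu) : weak_cmeasure -> weak_cmeasure),
      forall mu, continuous (conv mu : weak_cmeasure -> weak_cmeasure)
    & forall r : R, {within
        [set z : weak_cmeasure * weak_cmeasure |
          total_variation z.1 <= r /\ total_variation z.2 <= r],
        continuous ((fun z => conv z.1 z.2)
          : weak_cmeasure * weak_cmeasure -> weak_cmeasure)}].

Definition probabilities : set M :=
  [set mu | exists P : probability (borel E) R, mu = of_measure P].

Definition subprobabilities : set M :=
  [set mu | exists P : subprobability (borel E) R, mu = of_measure P].

(* The set G is where the convolution semigroup gamma takes its values. *)
Record trivializable_convolution (G : set M) T
    (p : R -> E -> subprobability (borel E) R) conv (Theta : set (E -> R[i]))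
    : Prop := {
  tc_strong_feller : strong_feller T p ;
  tc_banach : exists a, comm_banach_algebra (@total_variation _ (borel E) R)
                          conv (cdirac a) ;
  tc_weakly_continuous : weakly_continuous conv ;
  tc_probabilities : forall mu nu, probabilities mu -> probabilities nu ->
    probabilities (conv mu nu) ;
  tc_family : Theta `<=` (@Bb R E) `\ (fun=> 0) ;
  tc_trivializing : forall mu mu1 mu2, mu = conv mu1 mu2 <->
    forall th, Theta th -> cint mu th = cint mu1 th * cint mu2 th ;
  tc_semigroup : exists gamma : R -> M,
    [/\ forall t, 0 <= t -> G (gamma t),
        forall s t, 0 <= s -> 0 <= t -> gamma (t + s) = conv (gamma t) (gamma s)
      & forall t x, 0 <= t -> of_measure (p t x) = conv (gamma t) (cdirac x)]
}.

Definition FLTC := trivializable_convolution probabilities.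

End FLTC.

Section ProductSeries.
Context {R : realType} (E : pmetricType R).
Variables (m : {measure set (borel E) -> \bar R}) (lambda : nat -> R).
Variable phi : nat -> E -> R[i].

(* indices are shifted by one: phi 0 is the constant function 1 *)
Definition q_term (t : R) (x y xi : E) (j : nat) : R[i] :=
  (L2norm m (phi j) ^- 2)%:C%C * (expR (- lambda j * t))%:C%C
  * phi j x * phi j y * phi j xi.

Definition q (t : R) (x y xi : E) : R[i] :=
  lim ((series (q_term t x y xi) : nat -> (R[i])^o) @ \oo).

Definition represents_product (x y : E) (nu : probability (borel E) R) :=
  forall j, phi j x * phi j y = cintm nu (phi j).

End ProductSeries.

(* phic j is the continuous representative of the class of phi j *)
Definition continuous_representatives {R : realType} (E : pmetricType R)
    (m : {measure set (borel E) -> \bar R}) (phi phic : nat -> E -> R[i]) :=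
  forall j, ccontinuous (phic j) /\ ae_eq m setT (phic j) (phi j).

(* The factor phi j xi in q_term is not conjugated.  For complex-valued phi
   without a point a such that phi j a = 1 for all j, nonnegativity of q and the
   product formula do not imply each other. *)
Definition real_valued {R : realType} (E : Type) (phi : nat -> E -> R[i]) :=
  forall j x, phi j x \is Num.real.

(* Main.v *)
Require Import Defs.
From HB Require Import structures.
From mathcomp Require Import all_boot all_order all_algebra.
From mathcomp Require Import all_classical all_reals all_analysis.
From mathcomp Require Import measurable_realfun complex.
From mathcomp Require Import ring lra.

Import Order.TTheory GRing.Theory Num.Theory.
Import numFieldNormedType.Exports.
Import ComplexField.Normc.

Local Open Scope classical_set_scope.
Local Open Scope ring_scope.

Set Implicit Arguments.
Unset Strict Implicit.
Unset Printing Implicit Defensive.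

(** The operator T_t is integration against a bounded symmetric kernel k_t.
    Everything rests on the expansion, valid at every point x,

      (T_t f)(x) = sum_j s_j^-1 exp (- lambda_j t) <f, phi_j> phi_j(x)

    for square-integrable f, where s_j is the squared norm of phi_j
    (spectral_expansion).  The phi_j are only known to be orthogonal
    eigenfunctions, whereas the lambda_j are listed along some orthonormal basis
    of eigenfunctions of the generator (generator_eigenfunction passes from the
    generator to the semigroup).  Parseval's identity in that basis, integrated
    over the rows k_t(x, .), shows that the sum of the exp (- 2 lambda_j t) is
    the integral of |k_t(x, .)|^2 (hilbert_schmidt_trace).  Integrating Bessel's
    inequality of the same rows for the phi_j yields the same sum, so Bessel's
    inequality is an equality for almost every row (bessel_defect_cvg0).  The
    equality passes to every x because k_t maps L^2 to continuous functions and m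
    charges every nonempty open set, the latter since T_t g tends to g.  Bessel's
    inequality also bounds exp (- 2 lambda_j t) |phi_j(x)|^2 / s_j uniformly in j
    and x; a part of each exponential therefore pays for the eigenfunctions and
    the rest makes the series converge normally.  In particular the series of q
    converges, the heat kernel h_t(x, y), the sum of the
    s_j^-1 exp (- lambda_j t) phi_j(x) conj(phi_j(y)), is continuous and
    nonnegative, and the phi_j span a uniformly dense subspace of C(E)
    (phi_span_dense).

    For the product formula, let r_t(x, y, z) be the series q_t(x, y, z) with its
    last factor conjugated.  If nu represents the product at (x, y), then
    r_t(x, y, z) is the integral of h_t(., z) against nu, hence nonnegative.
    Conversely, if r_t >= 0, the measures r_t(x, y, .) m have mass at most one
    and integrate phi_k to exp (- lambda_k t) phi_k(x) phi_k(y).  As t tends to 0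
    they converge on the span of the phi_k, hence on C(E), and the Riesz theorem
    represents the limit by a probability (representation_of_product_kernel).
    For real phi_j, q and r coincide.  If phi_j(a) = 1 for all j, each is obtained
    from the other: r_2t(x, y, z) is the integral over u of
    q_t(x, y, u) conj(q_t(u, a, z)) (triple_series_convolution), while q_t is an
    iterated integral of h_t(., a) against representing measures
    (triple_series_integral, heat_pairing_integral).

    A complex measure is determined by its integrals against the phi_j
    (transform_injective), and the convolution multiplies these integrals
    (transform_convolution).  This reduces the algebra axioms, the trivialization
    and the identities for the transition measures to identities between complex
    numbers.  The integral of f against nu_xy is jointly measurable because for
    continuous f it is a uniform limit of sums of c_j phi_j(x) phi_j(y)
    (translation_cbm).  The same approximation, uniform on sets of measures that
    are bounded as functionals on C(E), gives weak continuity; for sequences the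
    bound comes from the uniform boundedness principle
    (convolution_weakly_continuous). *)

(** * Complex numbers: limits, continuity, measurability *)

Section complex_numbers.
Context {R : realType}.
Implicit Types z w : R[i].

Lemma complex_eq z w :
  complex.Re z = complex.Re w -> complex.Im z = complex.Im w -> z = w.
Proof. by case: z w => a b [c d] /= -> ->. Qed.

Lemma reD z w : complex.Re (z + w) = complex.Re z + complex.Re w.
Proof. by case: z w => ? ? []. Qed.

Lemma imD z w : complex.Im (z + w) = complex.Im z + complex.Im w.
Proof. by case: z w => ? ? []. Qed.

Lemma reN z : complex.Re (- z) = - complex.Re z. Proof. by case: z. Qed.

Lemma imN z : complex.Im (- z) = - complex.Im z. Proof. by case: z. Qed.

Lemma reM z w : complex.Re (z * w) =
  complex.Re z * complex.Re w - complex.Im z * complex.Im w.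
Proof. by case: z w => ? ? []. Qed.

Lemma imM z w : complex.Im (z * w) =
  complex.Re z * complex.Im w + complex.Im z * complex.Re w.
Proof. by case: z w => ? ? []. Qed.

Lemma reJ z : complex.Re (z^*)%C = complex.Re z. Proof. by case: z. Qed.

Lemma imJ z : complex.Im (z^*)%C = - complex.Im z. Proof. by case: z. Qed.

Lemma re_sum I (r : seq I) (P : pred I) (F : I -> R[i]) :
  complex.Re (\sum_(i <- r | P i) F i) = \sum_(i <- r | P i) complex.Re (F i).
Proof. exact: (big_morph _ reD). Qed.

Lemma im_sum I (r : seq I) (P : pred I) (F : I -> R[i]) :
  complex.Im (\sum_(i <- r | P i) F i) = \sum_(i <- r | P i) complex.Im (F i).
Proof. exact: (big_morph _ imD). Qed.

Lemma conjc_mul z w : ((z * w)^*)%C = (z^*)%C * (w^*)%C.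
Proof. by apply: complex_eq; rewrite !(reJ, imJ, reM, imM) //; ring. Qed.

Lemma conjc_add z w : ((z + w)^*)%C = (z^*)%C + (w^*)%C.
Proof. by apply: complex_eq; rewrite !(reJ, imJ, reD, imD) //; ring. Qed.

Lemma conjc_invol z : ((z^*)^*)%C = z.
Proof. by apply: complex_eq; rewrite !(reJ, imJ) ?opprK. Qed.

Lemma conjc_real (r : R) : ((r%:C)^*)%C = r%:C%C.
Proof. by apply: complex_eq => //=; rewrite oppr0. Qed.

Lemma conjc_sum I (r : seq I) (P : pred I) (F : I -> R[i]) :
  ((\sum_(i <- r | P i) F i)^*)%C = \sum_(i <- r | P i) ((F i)^*)%C.
Proof. by apply: (big_morph _ conjc_add); exact: conjc_real. Qed.

Lemma real_complexM (r s : R) : (r * s)%:C%C = r%:C%C * s%:C%C :> R[i].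
Proof. exact: rmorphM. Qed.

Lemma real_complexD (r s : R) : (r + s)%:C%C = r%:C%C + s%:C%C :> R[i].
Proof. exact: rmorphD. Qed.

Lemma normcE z : normc z = Num.sqrt (complex.Re z ^+ 2 + complex.Im z ^+ 2).
Proof. by case: z. Qed.

Lemma normc_sqr z : normc z ^+ 2 = complex.Re z ^+ 2 + complex.Im z ^+ 2.
Proof. by rewrite normcE sqr_sqrtr// addr_ge0 ?sqr_ge0. Qed.

Lemma normc_ge0 z : 0 <= normc z.
Proof. by rewrite normcE sqrtr_ge0. Qed.

Lemma normc_mul z w : normc (z * w) = normc z * normc w.
Proof. exact: normcM. Qed.

Lemma normc_triangle z w : normc (z + w) <= normc z + normc w.
Proof. exact: le_normcD. Qed.

Lemma normc_opp z : normc (- z) = normc z.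
Proof. exact: normcN. Qed.

Lemma normc_distC z w : normc (z - w) = normc (w - z).
Proof. by rewrite -normc_opp opprB. Qed.

Lemma normc_conj z : normc (z^*)%C = normc z.
Proof. by rewrite !normcE reJ imJ sqrrN. Qed.

Lemma normc_eq0P z : normc z = 0 -> z = 0.
Proof. exact: eq0_normc. Qed.

Lemma normc0E : normc (0 : R[i]) = 0.
Proof. exact: normc0. Qed.

Lemma normc1E : normc (1 : R[i]) = 1.
Proof. exact: normc1. Qed.

Lemma normc_sum I (r : seq I) (P : pred I) (F : I -> R[i]) :
  normc (\sum_(i <- r | P i) F i) <= \sum_(i <- r | P i) normc (F i).
Proof.
elim/big_rec2: _ => [|i y x _ le]; first by rewrite normc0E.
by rewrite (le_trans (normc_triangle _ _))// lerD2l.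
Qed.

Lemma abs_Re_le z : `|complex.Re z| <= normc z.
Proof. exact: normr_normc_Re. Qed.

Lemma abs_Im_le z : `|complex.Im z| <= normc z.
Proof. by rewrite normcE -sqrtr_sqr ler_wsqrtr// lerDr sqr_ge0. Qed.

Lemma normc_le z : normc z <= `|complex.Re z| + `|complex.Im z|.
Proof.
rewrite -ler_sqr ?nnegrE ?normc_ge0 ?addr_ge0// normc_sqr sqrrD !real_normK ?num_real//.
by rewrite -addrA [in leRHS](addrC (_ *+ 2)) addrA lerDl mulrn_wge0// mulr_ge0.
Qed.

Lemma mulcJ z : z * (z^*)%C = (normc z ^+ 2)%:C%C.
Proof. by apply: complex_eq; rewrite !(reJ, imJ, reM, imM) /= ?normc_sqr //; ring. Qed.

Lemma Re_le_normc z : complex.Re z <= normc z.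
Proof. exact: le_trans (ler_norm _) (abs_Re_le _). Qed.

Lemma complex_ge0E z : (0 <= z) = (complex.Im z == 0) && (0 <= complex.Re z).
Proof. by case: z. Qed.

Lemma complex_realE z : (z \is Num.real) = (complex.Im z == 0).
Proof. by rewrite Num.Theory.realE !(lecE, complex_ge0E) /= eq_sym -andb_orr le_total andbT. Qed.

Lemma conjc_fix z : complex.Im z = 0 -> (z^*)%C = z.
Proof. by move=> z0; apply: complex_eq; rewrite !(reJ, imJ) ?z0 ?oppr0. Qed.

End complex_numbers.

Section complex_limits.
Context {R : realType}.

(** The norm of the field R[i] takes its values in R[i] itself; here it is
    traded for the real-valued modulus. *)
Lemma ccvg_normcP {I : Type} (F : set_system I) {FF : Filter F}
    (u : I -> R[i]) (l : R[i]) :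
  ((u : I -> (R[i])^o) @ F --> (l : (R[i])^o)) <->
  (normc (u x - l) @[x --> F] --> (0 : R)).
Proof.
split=> [/cvgrPdist_lt ul|/cvgrPdist_lt ul].
- apply/cvgrPdist_lt => e e0.
  have e0' : (0 : R[i]) < e%:C%C by rewrite ltcR.
  apply: filterS (ul _ e0') => x /=.
  by rewrite normr_normc ltcR sub0r normrN ger0_norm ?normc_ge0// normc_distC.
- apply/cvgrPdist_lt => e e0.
  have eR : e = (complex.Re e)%:C%C by rewrite RRe_real// ger0_real// ltW.
  have e0' : 0 < complex.Re e by rewrite -ltcR -eR.
  apply: filterS (ul _ e0') => x /=.
  by rewrite sub0r normrN ger0_norm ?normc_ge0// normr_normc eR ltcR normc_distC.
Qed.

Lemma ccvgP {I : Type} (F : set_system I) {FF : Filter F}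
    (u : I -> R[i]) (l : R[i]) :
  ((u : I -> (R[i])^o) @ F --> (l : (R[i])^o)) <->
  (complex.Re (u x) @[x --> F] --> complex.Re l) /\
  (complex.Im (u x) @[x --> F] --> complex.Im l).
Proof.
rewrite ccvg_normcP; split=> [ul|[/cvgrPdist_lt ur /cvgrPdist_lt ui]].
- split; apply/cvgrPdist_lt => e e0;
    apply: filterS ((cvgrPdist_lt _ _).1 ul e e0) => x /=;
    rewrite sub0r normrN ger0_norm ?normc_ge0//; apply: le_lt_trans;
    rewrite distrC -?reN -?imN -?reD -?imD; [exact: abs_Re_le|exact: abs_Im_le].
- apply/cvgrPdist_lt => e e0; have e2 : 0 < e / 2 by rewrite divr_gt0.
  near=> x; rewrite sub0r normrN ger0_norm ?normc_ge0//.
  rewrite (le_lt_trans (normc_le _))// reD imD reN imN (splitr e) ltrD// distrC;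
    near: x; [exact: ur|exact: ui].
Unshelve. all: by end_near. Qed.

Lemma ccvgD {I : Type} (F : set_system I) {FF : Filter F}
    (u v : I -> R[i]) (k l : R[i]) :
  ((u : I -> (R[i])^o) @ F --> (k : (R[i])^o)) ->
  ((v : I -> (R[i])^o) @ F --> (l : (R[i])^o)) ->
  (((fun x => u x + v x) : I -> (R[i])^o) @ F --> (k + l : (R[i])^o)).
Proof.
move=> /ccvgP[ur ui] /ccvgP[vr vi]; apply/ccvgP; rewrite reD imD; split.
- by under eq_fun do rewrite reD; exact: cvgD.
- by under eq_fun do rewrite imD; exact: cvgD.
Qed.

Lemma ccvgM {I : Type} (F : set_system I) {FF : Filter F}
    (u v : I -> R[i]) (k l : R[i]) :
  ((u : I -> (R[i])^o) @ F --> (k : (R[i])^o)) ->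
  ((v : I -> (R[i])^o) @ F --> (l : (R[i])^o)) ->
  (((fun x => u x * v x) : I -> (R[i])^o) @ F --> (k * l : (R[i])^o)).
Proof.
move=> /ccvgP[ur ui] /ccvgP[vr vi]; apply/ccvgP; rewrite reM imM; split.
- by under eq_fun do rewrite reM; apply: cvgB; exact: cvgM.
- by under eq_fun do rewrite imM; apply: cvgD; exact: cvgM.
Qed.

Lemma ccvgB {I : Type} (F : set_system I) {FF : Filter F}
    (u v : I -> R[i]) (k l : R[i]) :
  ((u : I -> (R[i])^o) @ F --> (k : (R[i])^o)) ->
  ((v : I -> (R[i])^o) @ F --> (l : (R[i])^o)) ->
  (((fun x => u x - v x) : I -> (R[i])^o) @ F --> (k - l : (R[i])^o)).
Proof.
move=> /ccvgP[ur ui] /ccvgP[vr vi]; apply/ccvgP; rewrite reD imD reN imN; split.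
- by under eq_fun do rewrite reD reN; exact: cvgB.
- by under eq_fun do rewrite imD imN; exact: cvgB.
Qed.

Lemma ccvg_cst {I : Type} (F : set_system I) {FF : Filter F} (k : R[i]) :
  ((fun=> k) : I -> (R[i])^o) @ F --> (k : (R[i])^o).
Proof. exact: cvg_cst. Qed.

Lemma ccvg_conj {I : Type} (F : set_system I) {FF : Filter F}
    (u : I -> R[i]) (k : R[i]) :
  ((u : I -> (R[i])^o) @ F --> (k : (R[i])^o)) ->
  (((fun x => ((u x)^*)%C) : I -> (R[i])^o) @ F --> ((k^*)%C : (R[i])^o)).
Proof.
move=> /ccvgP[ur ui]; apply/ccvgP; rewrite reJ imJ; split.
- by under eq_fun do rewrite reJ.
- by under eq_fun do rewrite imJ; exact: cvgN.
Qed.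

Lemma ccvg_sum {I J : Type} (F : set_system I) {FF : Filter F} (r : seq J)
    (u : J -> I -> R[i]) (k : J -> R[i]) :
  (forall j, (u j : I -> (R[i])^o) @ F --> (k j : (R[i])^o)) ->
  (((fun x => \sum_(j <- r) u j x) : I -> (R[i])^o) @ F
    --> (\sum_(j <- r) k j : (R[i])^o)).
Proof.
move=> uk; elim: r => [|j r IH].
  by under eq_fun do rewrite big_nil; rewrite big_nil; exact: ccvg_cst.
under eq_fun do rewrite big_cons.
rewrite big_cons; exact: (ccvgD (uk j) IH).
Qed.

Lemma ccvg_unique {I : Type} (F : set_system I) {FF : ProperFilter F}
    (u : I -> R[i]) (k l : R[i]) :
  ((u : I -> (R[i])^o) @ F --> (k : (R[i])^o)) ->
  ((u : I -> (R[i])^o) @ F --> (l : (R[i])^o)) -> k = l.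
Proof.
move=> /ccvgP[kr ki] /ccvgP[lr li]; apply: complex_eq.
- exact: (@cvg_unique _ (@norm_hausdorff _ R^o) _ _ _ _ kr lr).
- exact: (@cvg_unique _ (@norm_hausdorff _ R^o) _ _ _ _ ki li).
Qed.

Lemma ccvg_lim {I : pointedType} (F : set_system I) {FF : ProperFilter F}
    (u : I -> R[i]) (k : R[i]) :
  ((u : I -> (R[i])^o) @ F --> (k : (R[i])^o)) ->
  lim ((u : I -> (R[i])^o) @ F) = k.
Proof.
by move=> uk; apply: (ccvg_unique _ uk); apply/cvg_ex; exists k.
Qed.

Lemma ccvg_normc {I : Type} (F : set_system I) {FF : Filter F}
    (u : I -> R[i]) (k : R[i]) :
  ((u : I -> (R[i])^o) @ F --> (k : (R[i])^o)) ->
  normc (u x) @[x --> F] --> normc k.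
Proof.
move=> /ccvg_normcP/cvgrPdist_lt uk; apply/cvgrPdist_lt => e e0.
apply: filterS (uk e e0) => x /=.
rewrite sub0r normrN ger0_norm ?normc_ge0//; apply: le_lt_trans.
rewrite ler_norml; apply/andP; split.
  rewrite lerBrDl lerBlDl -{1}(subrK k (u x)).
  by rewrite (le_trans (normc_triangle _ _))// addrC.
rewrite lerBlDl -{1}(subrK (u x) k) normc_distC.
by rewrite (le_trans (normc_triangle _ _))// addrC normc_distC.
Qed.

End complex_limits.

Section complex_continuity.
Context {R : realType} {E : pmetricType R}.
Implicit Types f g : E -> R[i].

Lemma ccontinuousP f : ccontinuous f <->
  continuous (fun x => complex.Re (f x)) /\ continuous (fun x => complex.Im (f x)).
Proof.
split=> [cf|[cr ci] x]; first by split=> x; have /ccvgP[] := cf x.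
by apply/ccvgP; split; [exact: cr|exact: ci].
Qed.

Lemma ccontinuous_cst (c : R[i]) : ccontinuous (fun _ : E => c).
Proof. by move=> x; exact: ccvg_cst. Qed.

Lemma ccontinuousD f g : ccontinuous f -> ccontinuous g ->
  ccontinuous (fun x => f x + g x).
Proof. by move=> cf cg x; apply: ccvgD; [exact: cf|exact: cg]. Qed.

Lemma ccontinuousM f g : ccontinuous f -> ccontinuous g ->
  ccontinuous (fun x => f x * g x).
Proof. by move=> cf cg x; apply: ccvgM; [exact: cf|exact: cg]. Qed.

Lemma ccontinuousZ (c : R[i]) f : ccontinuous f -> ccontinuous (fun x => c * f x).
Proof.
by move=> cf; apply: ccontinuousM; [exact: ccontinuous_cst|exact: cf].
Qed.

Lemma ccontinuousB f g : ccontinuous f -> ccontinuous g ->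
  ccontinuous (fun x => f x - g x).
Proof.
move=> cf cg.
rewrite (_ : (fun x => _) = (fun x => f x + -1 * g x)); last first.
  by apply/funext => x; rewrite mulN1r.
by apply: ccontinuousD; [exact: cf|apply: ccontinuousZ; exact: cg].
Qed.

Lemma ccontinuousJ f : ccontinuous f -> ccontinuous (fun x => ((f x)^*)%C).
Proof. by move=> cf x; apply: ccvg_conj; exact: cf. Qed.

Lemma ccontinuous_sum J (r : seq J) (u : J -> E -> R[i]) :
  (forall j, ccontinuous (u j)) -> ccontinuous (fun x => \sum_(j <- r) u j x).
Proof. by move=> uk x; apply: ccvg_sum => j; exact: uk. Qed.

Lemma ccontinuous_real (f : E -> R) : continuous f ->
  ccontinuous (fun x => (f x)%:C%C).
Proof. by move=> cf; apply/ccontinuousP; split=> //=; exact: cst_continuous. Qed.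

Lemma ccontinuous_dist f x : ccontinuous f -> forall e : R, 0 < e ->
  \forall y \near x, normc (f y - f x) < e.
Proof.
move=> /(_ x) /ccvg_normcP /cvgrPdist_lt cf e e0.
by apply: filterS (cf e e0) => y; rewrite sub0r normrN ger0_norm ?normc_ge0.
Qed.

Lemma ccontinuous_uniform_limit f :
  (forall e : R, 0 < e ->
    exists2 g, ccontinuous g & forall x, normc (f x - g x) <= e) ->
  ccontinuous f.
Proof.
move=> fg x; apply/ccvg_normcP/cvgrPdist_lt => e e0.
have e3 : 0 < e / 3 by rewrite divr_gt0.
have [g cg Hg] := fg _ e3.
apply: filterS (ccontinuous_dist x cg e3) => y yx.
rewrite sub0r normrN ger0_norm ?normc_ge0//.
have -> : f y - f x = (f y - g y) + (g y - g x) + (g x - f x) by ring.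
rewrite (le_lt_trans (normc_triangle _ _))//.
rewrite (le_lt_trans (lerD (normc_triangle _ _) (lexx _)))//.
have := Hg y; have := Hg x; rewrite (normc_distC (g x)) => h1 h2.
have -> : e = e / 3 + e / 3 + e / 3 by field.
by rewrite ltr_leD// ler_ltD.
Qed.

Hypothesis compactE : compact [set: E].

Lemma continuous_bounded (f : E -> R) : continuous f ->
  exists M : R, forall x, `|f x| <= M.
Proof.
move=> cf.
have : compact (f @` [set: E]).
  by apply: continuous_compact => //; exact: continuous_subspaceT.
move/compact_bounded => [M [_ HM]]; exists (M + 1) => x.
by apply: (HM (M + 1)); [rewrite ltrDl|exists x].
Qed.

Lemma ccontinuous_cbounded f : ccontinuous f -> cbounded f.
Proof.
move=> /ccontinuousP[/continuous_bounded[M HM] /continuous_bounded[N HN]].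
by exists (M + N) => x; rewrite (le_trans (normc_le _))// lerD.
Qed.

End complex_continuity.

Section complex_measurability.
Context d (T : measurableType d) {R : realType}.
Implicit Types f g : T -> R[i].

Lemma cmeasurable_cst (c : R[i]) : cmeasurable (fun _ : T => c).
Proof. by split; exact: measurable_cst. Qed.

Lemma cmeasurableD f g : cmeasurable f -> cmeasurable g ->
  cmeasurable (fun x => f x + g x).
Proof.
move=> [fr fi] [gr gi]; split.
- by under eq_fun do rewrite reD; exact: measurable_funD.
- by under eq_fun do rewrite imD; exact: measurable_funD.
Qed.

Lemma cmeasurableM f g : cmeasurable f -> cmeasurable g ->
  cmeasurable (fun x => f x * g x).
Proof.
move=> [fr fi] [gr gi]; split.
- by under eq_fun do rewrite reM; apply: measurable_funB; exact: measurable_funM.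
- by under eq_fun do rewrite imM; apply: measurable_funD; exact: measurable_funM.
Qed.

Lemma cmeasurableZ (c : R[i]) f : cmeasurable f -> cmeasurable (fun x => c * f x).
Proof. by move=> cf; apply: cmeasurableM => //; exact: cmeasurable_cst. Qed.

Lemma cmeasurableB f g : cmeasurable f -> cmeasurable g ->
  cmeasurable (fun x => f x - g x).
Proof.
move=> cf cg; under eq_fun do rewrite -(mulN1r (g _)).
by apply: cmeasurableD => //; exact: cmeasurableZ.
Qed.

Lemma cmeasurableJ f : cmeasurable f -> cmeasurable (fun x => ((f x)^*)%C).
Proof.
move=> [fr fi]; split; first by under eq_fun do rewrite reJ.
by under eq_fun do rewrite imJ; exact: measurable_funN.
Qed.

Lemma cmeasurable_sum J (r : seq J) (u : J -> T -> R[i]) :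
  (forall j, cmeasurable (u j)) -> cmeasurable (fun x => \sum_(j <- r) u j x).
Proof.
move=> mu; elim: r => [|j r IH].
  by under eq_fun do rewrite big_nil; exact: cmeasurable_cst.
by under eq_fun do rewrite big_cons; exact: cmeasurableD.
Qed.

Lemma cmeasurable_real (f : T -> R) : measurable_fun setT f ->
  cmeasurable (fun x => (f x)%:C%C).
Proof. by move=> mf; split => //; exact: measurable_cst. Qed.

Lemma cmeasurable_lim (u : nat -> T -> R[i]) f : (forall n, cmeasurable (u n)) ->
  (forall x, ((fun n => u n x) : nat -> (R[i])^o) @ \oo --> (f x : (R[i])^o)) ->
  cmeasurable f.
Proof.
move=> mu uf; split.
- apply: (@measurable_fun_cvg _ _ _ _ (fun n x => complex.Re (u n x))).
  + by move=> n; have [] := mu n.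
  + by move=> x _; have /ccvgP[] := uf x.
- apply: (@measurable_fun_cvg _ _ _ _ (fun n x => complex.Im (u n x))).
  + by move=> n; have [] := mu n.
  + by move=> x _; have /ccvgP[] := uf x.
Qed.

Lemma measurable_sqrtr : measurable_fun setT (@Num.sqrt R).
Proof. by apply: continuous_measurable_fun; exact: sqrt_continuous. Qed.

Lemma measurable_normc f : cmeasurable f ->
  measurable_fun setT (fun x => normc (f x)).
Proof.
move=> [fr fi]; under eq_fun do rewrite normcE.
apply: (measurableT_comp measurable_sqrtr).
by apply: measurable_funD; exact: measurable_funX.
Qed.

End complex_measurability.

Lemma continuous_borel {R : realType} (E : pmetricType R) (f : E -> R) :
  continuous f -> measurable_fun setT (f : borel E -> R).
Proof.
move=> cf.
apply: (measurability _ (RGenOpens.measurableE R)).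
move=> _ [_ [a [b ->] <-]]; rewrite setTI; apply: sub_sigma_algebra.
by move/continuousP : cf; apply; exact: interval_open.
Qed.

Lemma ccontinuous_borel {R : realType} (E : pmetricType R) (f : E -> R[i]) :
  ccontinuous f -> @cmeasurable _ (borel E) R f.
Proof. by move=> /ccontinuousP[fr fi]; split; exact: continuous_borel. Qed.

(** * Integration of complex functions *)

Section real_integrals.
Context d (T : measurableType d) {R : realType}.
Variable mu : {measure set T -> \bar R}.
Implicit Types f g : T -> R.

Definition rintegrable f := mu.-integrable setT (EFin \o f).

Lemma rintegrable_measurable f : rintegrable f -> measurable_fun setT f.
Proof. by move=> /measurable_int /measurable_EFinP. Qed.

Lemma rintegrableD f g : rintegrable f -> rintegrable g ->
  rintegrable (fun x => f x + g x).
Proof. by move=> fi gi; exact: (integrableD measurableT fi gi). Qed.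

Lemma rintegrableZ (c : R) f : rintegrable f -> rintegrable (fun x => c * f x).
Proof. by move=> fi; exact: (integrableZl measurableT c fi). Qed.

Lemma rintegrableB f g : rintegrable f -> rintegrable g ->
  rintegrable (fun x => f x - g x).
Proof. by move=> fi gi; exact: (integrableB measurableT fi gi). Qed.

Lemma rintegrable_le f g : measurable_fun setT f -> rintegrable g ->
  (forall x, `|f x| <= g x) -> rintegrable f.
Proof.
move=> mf gi fg; apply: (le_integrable measurableT _ _ gi).
- exact/measurable_EFinP.
- by move=> x _ /=; rewrite lee_fin (le_trans (fg x))// ler_norm.
Qed.

Lemma rintegrable_abs f : rintegrable f -> rintegrable (fun x => `|f x|).
Proof. by move=> /integrable_abse. Qed.

Lemma rintegrable_sum J (r : seq J) (u : J -> T -> R) :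
  (forall j, rintegrable (u j)) -> rintegrable (fun x => \sum_(j <- r) u j x).
Proof.
move=> ui; elim: r => [|j r IH].
  by under eq_fun do rewrite big_nil; exact: integrable0.
by under eq_fun do rewrite big_cons; exact: rintegrableD.
Qed.

Lemma Rintegral_sum J (r : seq J) (u : J -> T -> R) :
  (forall j, rintegrable (u j)) ->
  \int[mu]_x (\sum_(j <- r) u j x) = \sum_(j <- r) \int[mu]_x u j x.
Proof.
move=> ui; elim: r => [|j r IH].
  rewrite big_nil; under eq_Rintegral do rewrite big_nil.
  by rewrite Rintegral_cst// mul0r.
rewrite big_cons; under eq_Rintegral do rewrite big_cons.
by rewrite RintegralD ?IH//; [exact: ui|exact: rintegrable_sum].
Qed.

Lemma Rintegral_le f g : rintegrable f -> rintegrable g ->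
  (forall x, f x <= g x) -> \int[mu]_x f x <= \int[mu]_x g x.
Proof. by move=> fi gi fg; apply: le_Rintegral. Qed.

Lemma Rintegral_nneg f : (forall x, 0 <= f x) -> 0 <= \int[mu]_x f x.
Proof. by move=> f0; apply: Rintegral_ge0. Qed.

Lemma RintegralE f : rintegrable f ->
  (\int[mu]_x (f x)%:E)%E = (\int[mu]_x f x)%:E.
Proof. by move=> fi; rewrite fineK//; exact: integrable_fin_num. Qed.

Lemma rintegrable_nneg f : measurable_fun setT f -> (forall x, 0 <= f x) ->
  ((\int[mu]_x (f x)%:E)%E < +oo)%E -> rintegrable f.
Proof.
move=> mf f0 fi; apply/integrableP; split; first exact/measurable_EFinP.
apply: le_lt_trans fi; rewrite le_eqVlt; apply/orP; left; apply/eqP.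
by apply: eq_integral => x _ /=; rewrite ger0_norm.
Qed.

Lemma ae_eq_Rintegral f g : measurable_fun setT f -> measurable_fun setT g ->
  ae_eq mu setT f g -> \int[mu]_x f x = \int[mu]_x g x.
Proof.
move=> mf mg fg; congr fine; apply: ae_eq_integral => //.
- exact/measurable_EFinP.
- exact/measurable_EFinP.
- by apply: filterS fg => x /= h _; rewrite h.
Qed.

Lemma Rintegral_eq0_ae f : measurable_fun setT f -> (forall x, 0 <= f x) ->
  rintegrable f -> \int[mu]_x f x = 0 -> ae_eq mu setT f (fun=> 0).
Proof.
move=> mf f0 fi f0'.
have : (\int[mu]_x `|(f x)%:E| = 0)%E.
  under eq_integral => x _ do rewrite /= ger0_norm//.
  by rewrite RintegralE// f0'.
move/(ae_eq_integral_abs mu measurableT (proj2 (measurable_EFinP _ _) mf)).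
by apply: filterS => x /= h xT; have [] := h xT.
Qed.

End real_integrals.

Section finite_real_integrals.
Context d (T : measurableType d) {R : realType}.
Variable mu : {finite_measure set T -> \bar R}.
Implicit Types f g : T -> R.

Lemma rintegrable_cst (k : R) : rintegrable mu (fun=> k).
Proof. by apply: finite_measure_integrable_cst. Qed.

Lemma rintegrable_bounded f (M : R) : measurable_fun setT f ->
  (forall x, `|f x| <= M) -> rintegrable mu f.
Proof. by move=> mf fM; exact: (rintegrable_le mf (rintegrable_cst M) fM). Qed.

Lemma Rintegral_bounded_cvg (u : nat -> T -> R) f (M : R) :
  (forall n, measurable_fun setT (u n)) -> (forall n x, `|u n x| <= M) ->
  (forall x, u n x @[n --> \oo] --> f x) ->
  \int[mu]_x u n x @[n --> \oo] --> \int[mu]_x f x.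
Proof.
move=> mu_ uM uf.
have mf : measurable_fun setT f.
  by apply: (measurable_fun_cvg mu_) => x _; exact: uf.
have fM x : `|f x| <= M.
  have : `|u n x| @[n --> \oo] --> `|f x| by apply: cvg_norm; exact: uf.
  by move=> h; apply: (ler_cvg_to h (cvg_cst M)); exact: nearW.
apply: fine_cvg; rewrite fineK; last first.
  by apply: integrable_fin_num => //; exact: (rintegrable_bounded mf fM).
apply: (@dominated_cvg _ _ _ _ _ _ _ _ (EFin \o cst M)) => //.
- by move=> n; exact/measurable_EFinP.
- by move=> x _; apply/cvg_EFin; [exact: nearW|exact: uf].
- exact: rintegrable_cst.
- by move=> n x _; rewrite lee_fin.
Qed.

End finite_real_integrals.

Section complex_integrals.
Context d (T : measurableType d) {R : realType}.
Variable mu : {measure set T -> \bar R}.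
Implicit Types f g : T -> R[i].

Definition cintegrable f :=
  rintegrable mu (fun x => complex.Re (f x)) /\
  rintegrable mu (fun x => complex.Im (f x)).

Lemma cintegrable_cmeasurable f : cintegrable f -> cmeasurable f.
Proof. by move=> [/rintegrable_measurable ? /rintegrable_measurable]. Qed.

Lemma cintegrable_le f (g : T -> R) : cmeasurable f -> rintegrable mu g ->
  (forall x, normc (f x) <= g x) -> cintegrable f.
Proof.
move=> [mr mi] gi fg; split.
- by apply: (rintegrable_le mr gi) => x; rewrite (le_trans (abs_Re_le _)).
- by apply: (rintegrable_le mi gi) => x; rewrite (le_trans (abs_Im_le _)).
Qed.

Lemma cintegrable_normc f : cintegrable f -> rintegrable mu (fun x => normc (f x)).
Proof.
move=> fi; have mf := cintegrable_cmeasurable fi; case: fi => fr fi.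
apply: (rintegrable_le (measurable_normc mf)
  (rintegrableD (rintegrable_abs fr) (rintegrable_abs fi))) => x.
by rewrite ger0_norm ?normc_ge0// normc_le.
Qed.

Lemma cintegrableZ (c : R[i]) f : cintegrable f -> cintegrable (fun x => c * f x).
Proof.
move=> [fr fi]; split.
- by under eq_fun do rewrite reM; apply: rintegrableB; exact: rintegrableZ.
- by under eq_fun do rewrite imM; apply: rintegrableD; exact: rintegrableZ.
Qed.

Lemma cintmD f g : cintegrable f -> cintegrable g ->
  cintm mu (fun x => f x + g x) = cintm mu f + cintm mu g.
Proof.
move=> [fr fi] [gr gi]; apply: complex_eq; rewrite ?reD ?imD /=.
- by under eq_Rintegral do rewrite reD; rewrite RintegralD.
- by under eq_Rintegral do rewrite imD; rewrite RintegralD.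
Qed.

Lemma cintmZ (c : R[i]) f : cintegrable f ->
  cintm mu (fun x => c * f x) = c * cintm mu f.
Proof.
move=> [fr fi]; apply: complex_eq; rewrite ?reM ?imM /=.
- under eq_Rintegral do rewrite reM.
  by rewrite RintegralB ?RintegralZl//; exact: rintegrableZ.
- under eq_Rintegral do rewrite imM.
  by rewrite RintegralD ?RintegralZl//; exact: rintegrableZ.
Qed.

Lemma cintmB f g : cintegrable f -> cintegrable g ->
  cintm mu (fun x => f x - g x) = cintm mu f - cintm mu g.
Proof.
move=> fi gi; under [X in cintm mu X]eq_fun do rewrite -(mulN1r (g _)).
by rewrite cintmD// ?cintmZ ?mulN1r//; exact: cintegrableZ.
Qed.

Lemma cintegrable_sum J (r : seq J) (u : J -> T -> R[i]) :
  (forall j, cintegrable (u j)) -> cintegrable (fun x => \sum_(j <- r) u j x).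
Proof.
move=> ui; split.
- under eq_fun do rewrite re_sum.
  by apply: rintegrable_sum => j; have [] := ui j.
- under eq_fun do rewrite im_sum.
  by apply: rintegrable_sum => j; have [] := ui j.
Qed.

Lemma cintm_sum J (r : seq J) (u : J -> T -> R[i]) :
  (forall j, cintegrable (u j)) ->
  cintm mu (fun x => \sum_(j <- r) u j x) = \sum_(j <- r) cintm mu (u j).
Proof.
move=> ui; apply: complex_eq; rewrite ?re_sum ?im_sum /=.
- under eq_Rintegral do rewrite re_sum.
  by rewrite Rintegral_sum// => j; have [] := ui j.
- under eq_Rintegral do rewrite im_sum.
  by rewrite Rintegral_sum// => j; have [] := ui j.
Qed.

Lemma cintmJ f : cintegrable f ->
  cintm mu (fun x => ((f x)^*)%C) = ((cintm mu f)^*)%C.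
Proof.
move=> [fr fi]; apply: complex_eq; rewrite ?reJ ?imJ /=.
- by under eq_Rintegral do rewrite reJ.
- by under eq_Rintegral do rewrite imJ -mulN1r; rewrite RintegralZl// mulN1r.
Qed.

Lemma cintm_real (f : T -> R) :
  cintm mu (fun x => (f x)%:C%C) = (\int[mu]_x f x)%:C%C.
Proof.
apply: complex_eq => //=; by rewrite Rintegral_cst// mul0r.
Qed.

(** Rotating the integral onto the positive real axis reduces the inequality
    to the one between real part and modulus. *)
Lemma normc_cintm f : cintegrable f -> normc (cintm mu f) <= \int[mu]_x normc (f x).
Proof.
move=> fi; set c := cintm mu f.
have I0 : 0 <= \int[mu]_x normc (f x).
  by apply: Rintegral_nneg => x; exact: normc_ge0.
have [->//|c0] := eqVneq (normc c) 0.
have cp : 0 < normc c by rewrite lt_neqAle eq_sym c0 normc_ge0.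
rewrite -(ler_pM2l cp) -expr2.
have -> : normc c ^+ 2 = \int[mu]_x complex.Re ((c^*)%C * f x).
  rewrite -[RHS]/(complex.Re (cintm mu (fun x => (c^*)%C * f x))).
  by rewrite cintmZ// mulrC mulcJ.
rewrite -RintegralZl//; last exact: cintegrable_normc.
apply: Rintegral_le.
- by have [] := cintegrableZ (c^*)%C fi.
- exact/rintegrableZ/cintegrable_normc.
- by move=> x; rewrite (le_trans (Re_le_normc _))// normc_mul normc_conj.
Qed.

Lemma ae_eq_cintm f g : cmeasurable f -> cmeasurable g ->
  ae_eq mu setT f g -> cintm mu f = cintm mu g.
Proof.
move=> [fr fi] [gr gi] fg; apply: complex_eq => /=.
- by apply: ae_eq_Rintegral => //; apply: filterS fg => x h xT; rewrite h.
- by apply: ae_eq_Rintegral => //; apply: filterS fg => x h xT; rewrite h.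
Qed.

End complex_integrals.

Section bounded_functions.
Context d (T : measurableType d) {R : realType}.
Implicit Types (f g : T -> R[i]) (A : set T).

Definition cbm f := cmeasurable f /\ exists M : R, forall x, normc (f x) <= M.

Definition cind A : T -> R[i] := fun x => (\1_A x)%:C%C.

Lemma cbm_cst (c : R[i]) : cbm (fun=> c).
Proof. by split; [exact: cmeasurable_cst|exists (normc c)]. Qed.

Lemma cbmD f g : cbm f -> cbm g -> cbm (fun x => f x + g x).
Proof.
move=> [mf [M fM]] [mg [N gN]]; split; first exact: cmeasurableD.
by exists (M + N) => x; rewrite (le_trans (normc_triangle _ _))// lerD.
Qed.

Lemma cbmM f g : cbm f -> cbm g -> cbm (fun x => f x * g x).
Proof.
move=> [mf [M fM]] [mg [N gN]]; split; first exact: cmeasurableM.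
by exists (M * N) => x; rewrite normc_mul ler_pM ?normc_ge0.
Qed.

Lemma cbmZ (c : R[i]) f : cbm f -> cbm (fun x => c * f x).
Proof. by move=> bf; apply: cbmM => //; exact: cbm_cst. Qed.

Lemma cbmB f g : cbm f -> cbm g -> cbm (fun x => f x - g x).
Proof.
move=> bf bg; under eq_fun do rewrite -(mulN1r (g _)).
by apply: cbmD => //; exact: cbmZ.
Qed.

Lemma cbmJ f : cbm f -> cbm (fun x => ((f x)^*)%C).
Proof.
move=> [mf [M fM]]; split; first exact: cmeasurableJ.
by exists M => x; rewrite normc_conj.
Qed.

Lemma cbm_sum J (r : seq J) (u : J -> T -> R[i]) :
  (forall j, cbm (u j)) -> cbm (fun x => \sum_(j <- r) u j x).
Proof.
move=> mu; elim: r => [|j r IH].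
  by under eq_fun do rewrite big_nil; exact: cbm_cst.
by under eq_fun do rewrite big_cons; exact: cbmD.
Qed.

Lemma cbm_real (f : T -> R) (M : R) : measurable_fun setT f ->
  (forall x, `|f x| <= M) -> cbm (fun x => (f x)%:C%C).
Proof.
move=> mf fM; split; first exact: cmeasurable_real.
by exists M => x; rewrite normc_real.
Qed.

Lemma normc_cind A x : normc (cind A x) <= 1.
Proof.
by rewrite /cind normc_real /indic; case: (x \in A); rewrite ?normr0 ?normr1.
Qed.

Lemma cbm_cind A : measurable A -> cbm (cind A).
Proof.
move=> mA; split; first by apply: cmeasurable_real; exact: measurable_indic.
by exists 1 => x; exact: normc_cind.
Qed.

Lemma cind_in A x : A x -> cind A x = 1.
Proof. by move=> Ax; rewrite /cind indicE mem_set. Qed.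

Lemma cind_notin A x : ~ A x -> cind A x = 0.
Proof. by move=> Ax; rewrite /cind indicE memNset. Qed.

(** The range of f lies in a square of half-width M, which an L x L grid of
    mesh e / 2 covers; node number k has coordinates k %/ L and k %% L. *)
Lemma simple_partition f (M e : R) : cmeasurable f ->
  (forall x, normc (f x) <= M) -> 0 < e ->
  exists (N : nat) (c : nat -> R[i]) (A : nat -> set T),
  [/\ forall k, measurable (A k), trivIset setT A,
      forall x, exists2 k, (k < N)%N & A k x
    & forall k x, A k x -> normc (f x - c k) <= e].
Proof.
move=> mf fM e0; pose h := e / 2; have h0 : 0 < h by rewrite divr_gt0.
pose L := (Num.truncn (2 * M / h)).+1.
pose c k : R[i] := (((k %/ L)%:R * h - M) +i* ((k %% L)%:R * h - M))%C.
pose B k := [set x | normc (f x - c k) <= e].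
have mB k : measurable (B k).
  rewrite -[B k]setTI.
  have : measurable_fun setT (fun x => normc (f x - c k)).
    by apply: measurable_normc; apply: cmeasurableB => //; exact: cmeasurable_cst.
  by move=> /(_ measurableT _ (measurable_itv `]-oo, e])); rewrite set_itvE.
have cov (r : R) : `|r| <= M -> exists2 a, (a < L)%N & `|r - (a%:R * h - M)| <= h.
  move=> rM; exists (Num.truncn ((r + M) / h)).
    rewrite ltnS; apply: le_truncn; rewrite ler_pM2r ?invr_gt0//.
    by rewrite mulr2n mulrDl !mul1r lerD2r (le_trans (ler_norm _)).
  have : 0 <= (r + M) / h.
    rewrite divr_ge0 ?(ltW h0)// -lerBlDr sub0r.
    by move: rM; rewrite ler_norml => /andP[].
  move=> /truncn_itv; set a := Num.truncn _.
  rewrite ler_pdivlMr// ltr_pdivrMr// -natr1 mulrDl mul1r => /andP[h1 h2].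
  by rewrite ler_norml; apply/andP; split; lra.
exists (L * L)%N, c, (seqDU B); split.
- move=> k; apply: measurableD => //; apply: bigsetU_measurable => i _; exact: mB.
- exact: trivIset_seqDU.
- move=> x.
  have [a aL Ha] := cov (complex.Re (f x)) (le_trans (abs_Re_le _) (fM x)).
  have [b bL Hb] := cov (complex.Im (f x)) (le_trans (abs_Im_le _) (fM x)).
  have Bx : B (a * L + b)%N x.
    rewrite /B /= (le_trans (normc_le _))// reD imD reN imN /c /=.
    rewrite divnMDl// modnMDl (divn_small bL) addn0 (modn_small bL).
    by rewrite [leRHS](_ : e = h + h) ?lerD// /h -splitr.
  have : (\big[setU/set0]_(i < (L * L)%N) B i) x.
    rewrite -bigcup_mkord; exists (a * L + b)%N => //=.
    by rewrite (@leq_trans (a * L + L))%N ?ltn_add2l// -mulSnr leq_mul2r aL orbT.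
  rewrite bigsetU_seqDU -bigcup_mkord => -[k /= kN kx]; by exists k.
- by move=> k x [].
Qed.

Lemma sum_partition (A : nat -> set T) (c : nat -> R[i]) N k x :
  trivIset setT A -> (k < N)%N -> A k x ->
  \sum_(0 <= i < N) c i * cind (A i) x = c k.
Proof.
move=> tA kN kx; rewrite (bigD1_seq k) ?mem_index_iota ?iota_uniq//=.
rewrite cind_in// mulr1 big1 ?addr0// => i ik.
rewrite cind_notin ?mulr0// => ix.
by case/eqP: ik; apply: tA => //; exists x.
Qed.

(** Integrals against measures and complex measures, iterated integrals and
    their combinations all have these two properties, which allow identities
    between them to be checked on indicators. *)
Record bfunctional (F : (T -> R[i]) -> R[i]) : Prop := {
  bfunctional_lin : forall c f g, cbm f -> cbm g ->
    F (fun x => c * f x + g x) = c * F f + F g ;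
  bfunctional_bounded : exists C : R, forall f M, cbm f ->
    (forall x, normc (f x) <= M) -> normc (F f) <= C * M }.

Section bfunctional_theory.
Variable F : (T -> R[i]) -> R[i].
Hypothesis hF : bfunctional F.

Lemma bfunctional0 : F (fun=> 0) = 0.
Proof.
have := bfunctional_lin hF (-1) (cbm_cst 0) (cbm_cst 0).
by under eq_fun do rewrite mulr0 addr0; rewrite mulN1r addNr.
Qed.

Lemma bfunctionalZ c f : cbm f -> F (fun x => c * f x) = c * F f.
Proof.
move=> bf; have := bfunctional_lin hF c bf (cbm_cst 0).
by rewrite bfunctional0 addr0 => <-; under [in RHS]eq_fun do rewrite addr0.
Qed.

Lemma bfunctionalD f g : cbm f -> cbm g -> F (fun x => f x + g x) = F f + F g.
Proof.
move=> bf bg; have := bfunctional_lin hF 1 bf bg; rewrite mul1r => <-.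
by under [in RHS]eq_fun do rewrite mul1r.
Qed.

Lemma bfunctionalB f g : cbm f -> cbm g -> F (fun x => f x - g x) = F f - F g.
Proof.
move=> bf bg; under [X in F X]eq_fun do rewrite -(mulN1r (g _)).
by rewrite bfunctionalD ?bfunctionalZ ?mulN1r//; exact: cbmZ.
Qed.

Lemma bfunctional_sum J (r : seq J) (c : J -> R[i]) (u : J -> T -> R[i]) :
  (forall j, cbm (u j)) ->
  F (fun x => \sum_(j <- r) c j * u j x) = \sum_(j <- r) c j * F (u j).
Proof.
move=> bu; elim: r => [|j r IH].
  by under [X in F X]eq_fun do rewrite big_nil; rewrite big_nil bfunctional0.
under [X in F X]eq_fun do rewrite big_cons.
rewrite big_cons bfunctional_lin ?IH//.
by apply: cbm_sum => i; exact: cbmZ.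
Qed.

End bfunctional_theory.

Lemma eq0_le_eps (a C : R) : 0 <= a -> (forall e : R, 0 < e -> a <= C * e) -> a = 0.
Proof.
move=> a0 H; apply/eqP; rewrite eq_le a0 andbT leNgt; apply/negP => ap.
have C0 : 0 < C.
  by rewrite ltNge; apply/negP => C0; have := H 1 ltr01; rewrite mulr1; lra.
have := H (a / (2 * C)); rewrite divr_gt0 ?mulr_gt0// => /(_ isT).
by rewrite (_ : C * _ = a / 2); [lra|field; lra].
Qed.

(** Simple functions are uniformly dense among the bounded measurable
    functions. *)
Lemma bfunctional_ext (F G : (T -> R[i]) -> R[i]) :
  bfunctional F -> bfunctional G ->
  (forall A, measurable A -> F (cind A) = G (cind A)) ->
  forall f, cbm f -> F f = G f.
Proof.
move=> hF hG FG f bf.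
have [C FC] := bfunctional_bounded hF; have [D GD] := bfunctional_bounded hG.
apply/eqP; rewrite -subr_eq0; apply/eqP/normc_eq0P.
apply: (@eq0_le_eps _ (C + D)); first exact: normc_ge0.
move=> e e0; have [mf [M fM]] := bf.
have [N [c [A [mA tA covA fc]]]] := simple_partition mf fM e0.
pose g x := \sum_(0 <= i < N) c i * cind (A i) x.
have bg : cbm g by apply: cbm_sum => i; exact/cbmZ/cbm_cind.
have fg x : normc (f x - g x) <= e.
  by have [k kN kx] := covA x; rewrite /g (sum_partition c tA kN kx) fc.
have FGg : F g = G g.
  rewrite /g !bfunctional_sum//; try (by move=> i; exact: cbm_cind).
  by apply: eq_bigr => i _; rewrite FG.
have -> : F f - G f = F (fun x => f x - g x) - G (fun x => f x - g x).
  by rewrite !bfunctionalB// FGg; ring.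
rewrite (le_trans (normc_triangle _ _))// normc_opp mulrDl.
by rewrite lerD ?FC ?GD//; exact: cbmB.
Qed.

Lemma cbm_cintegrable (mu : {finite_measure set T -> \bar R}) f :
  cbm f -> cintegrable mu f.
Proof.
by move=> [mf [M fM]]; apply: (cintegrable_le mf _ fM); exact: rintegrable_cst.
Qed.

Lemma normc_cintm_bounded (mu : {finite_measure set T -> \bar R}) f (M : R) :
  cbm f -> (forall x, normc (f x) <= M) ->
  normc (cintm mu f) <= M * fine (mu setT).
Proof.
move=> bf fM; rewrite (le_trans (normc_cintm (cbm_cintegrable mu bf)))//.
rewrite -Rintegral_cst//; apply: Rintegral_le => //.
- exact/cintegrable_normc/cbm_cintegrable.
- exact: rintegrable_cst.
Qed.

Lemma cintm_bfunctional (mu : {finite_measure set T -> \bar R}) :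
  bfunctional (cintm mu).
Proof.
split=> [c f g bf bg|].
  by rewrite cintmD ?cintmZ//; [exact: cbm_cintegrable..|exact/cbm_cintegrable/cbmZ
    |exact: cbm_cintegrable].
by exists (fine (mu setT)) => f M bf fM; rewrite mulrC normc_cintm_bounded.
Qed.

Lemma cintm_cind (mu : {measure set T -> \bar R}) A : measurable A ->
  cintm mu (cind A) = (fine (mu A))%:C%C.
Proof.
move=> mA; rewrite /cind cintm_real; congr (_%:C)%C.
by rewrite /Rintegral integral_indic// setIT.
Qed.

Lemma cintm_bounded_cvg (mu : {finite_measure set T -> \bar R})
    (u : nat -> T -> R[i]) f (M : R) :
  (forall n, cmeasurable (u n)) -> (forall n x, normc (u n x) <= M) ->
  (forall x, ((fun n => u n x) : nat -> (R[i])^o) @ \oo --> (f x : (R[i])^o)) ->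
  ((fun n => cintm mu (u n)) : nat -> (R[i])^o) @ \oo
    --> (cintm mu f : (R[i])^o).
Proof.
move=> mu_ uM uf; apply/ccvgP; split=> /=.
- apply: (@Rintegral_bounded_cvg _ _ _ _ (fun n x => complex.Re (u n x)) _ M).
  + by move=> n; have [] := mu_ n.
  + by move=> n x; rewrite (le_trans (abs_Re_le _)).
  + by move=> x; have /ccvgP[] := uf x.
- apply: (@Rintegral_bounded_cvg _ _ _ _ (fun n x => complex.Im (u n x)) _ M).
  + by move=> n; have [] := mu_ n.
  + by move=> n x; rewrite (le_trans (abs_Im_le _)).
  + by move=> x; have /ccvgP[] := uf x.
Qed.

End bounded_functions.

Lemma normc_ge0E (R : realType) (z : R[i]) : 0 <= z -> normc z = complex.Re z.
Proof.
case: z => a b; rewrite complex_ge0E /= => /andP[/eqP -> a0].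
by rewrite expr0n addr0 sqrtr_sqr ger0_norm.
Qed.

Lemma cintm_ge0 d (T : measurableType d) (R : realType)
    (mu : {measure set T -> \bar R}) (f : T -> R[i]) :
  (forall x, 0 <= f x) -> 0 <= cintm mu f.
Proof.
move=> f0; rewrite complex_ge0E; apply/andP; split.
  have im0 x : complex.Im (f x) = 0.
    by have := f0 x; rewrite complex_ge0E => /andP[/eqP].
  apply/eqP; rewrite /=; under eq_Rintegral do rewrite im0.
  by rewrite Rintegral_cst// mul0r.
by apply: Rintegral_nneg => x; have := f0 x; rewrite complex_ge0E => /andP[].
Qed.

Lemma cintm_mul_bfunctional d (T : measurableType d) (R : realType)
    (mu : {finite_measure set T -> \bar R}) (h : T -> R[i]) : cbm h ->
  bfunctional (fun g => cintm mu (fun y => g y * h y)).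
Proof.
move=> bh; split=> [c g f bg bf|].
  rewrite -cintmZ; last exact/cbm_cintegrable/cbmM.
  rewrite -cintmD; last 2 first.
  - by apply: cintegrableZ; exact/cbm_cintegrable/cbmM.
  - exact/cbm_cintegrable/cbmM.
  by congr cintm; apply/funext => y; ring.
have [_ [M hM]] := bh; exists (M * fine (mu setT)) => g N bg gN.
rewrite mulrAC; apply: normc_cintm_bounded; first exact: cbmM.
by move=> y; rewrite normc_mul mulrC ler_pM ?normc_ge0.
Qed.

(** * Square-integrable functions *)

(** The choice c = a / F gives the inequality behind the Cauchy-Schwarz and
    Jensen inequalities. *)
Lemma quadratic_bound (R : realFieldType) (a F G : R) : 0 <= a -> 0 <= F -> 0 <= G ->
  (forall c : R, 0 < c -> 2 * a <= c * F + c^-1 * G) -> a ^+ 2 <= F * G.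
Proof.
move=> a0 F0 G0 H.
have [->|an0] := eqVneq a 0; first by rewrite expr0n mulr_ge0.
have ap : 0 < a by rewrite lt_neqAle eq_sym an0.
have [F00|Fn0] := eqVneq F 0.
  have := H ((G + 1) / a); rewrite divr_gt0// ?ltr_wpDl// => /(_ isT).
  rewrite F00 mulr0 add0r invf_div mulrAC ler_pdivlMr ?ltr_wpDl//.
  by move=> h; exfalso; nra.
have Fp : 0 < F by rewrite lt_neqAle eq_sym Fn0.
have := H (a / F); rewrite divr_gt0// => /(_ isT).
rewrite divfK// invf_div => h.
have : a <= F / a * G by lra.
by rewrite mulrAC ler_pdivlMr// expr2.
Qed.

Section square_integrable.
Context d (T : measurableType d) {R : realType}.
Variable mu : {measure set T -> \bar R}.
Implicit Types f g : T -> R[i].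

Definition sqint f := cmeasurable f /\ rintegrable mu (fun x => normc (f x) ^+ 2).

(** Squared norms are used instead of norms: they are plain integrals, and
    sqnD plays the role of the triangle inequality. *)
Definition sqn f : R := \int[mu]_x normc (f x) ^+ 2.

Lemma sqn_ge0 f : 0 <= sqn f.
Proof. by apply: Rintegral_nneg => x; exact: sqr_ge0. Qed.

Lemma measurable_normc2 f : cmeasurable f ->
  measurable_fun setT (fun x => normc (f x) ^+ 2).
Proof. by move=> mf; apply: measurable_funX; exact: measurable_normc. Qed.

Lemma Lnorm2_sqr f :
  ((Lnorm2 mu f) `^ 2)%E = (\int[mu]_x (normc (f x) ^+ 2)%:E)%E.
Proof.
rewrite /Lnorm2 poweR_Lnorm//; apply: eq_integral => x _ /=.
by rewrite ger0_norm ?normc_ge0// -powR_mulrn ?normc_ge0.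
Qed.

Lemma L2P f : L2 mu f <-> sqint f.
Proof.
split=> [[mf Lf]|[mf fi]]; split => //.
- apply: rintegrable_nneg; first exact: measurable_normc2.
    by move=> x; exact: sqr_ge0.
  by rewrite -Lnorm2_sqr poweR_lty.
- have : (Lnorm2 mu f `^ 2 < +oo)%E by rewrite Lnorm2_sqr RintegralE// ltry.
  have := Lnorm_ge0 mu 2%:E (fun x => (normc (f x))%:E).
  rewrite /Lnorm2; case: (Lnorm _ _ _) => [r| |]// _; first by rewrite !ltry.
  by rewrite poweRyr.
Qed.

Lemma L2norm_ge0 f : 0 <= L2norm mu f.
Proof. by apply: fine_ge0; exact: Lnorm_ge0. Qed.

Lemma L2norm_sqr f : sqint f -> L2norm mu f ^+ 2 = sqn f.
Proof.
move=> fi; have [_ Lf] := (L2P f).2 fi; have [_ fi'] := fi.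
have L0 := Lnorm_ge0 mu 2%:E (fun x => (normc (f x))%:E).
have Lfin : Lnorm2 mu f = (L2norm mu f)%:E.
  by rewrite /L2norm fineK// ge0_fin_numE.
have := Lnorm2_sqr f; rewrite Lfin poweR_EFin RintegralE// => -[].
by rewrite powR_mulrn// L2norm_ge0.
Qed.

Lemma sqint_le f (g : T -> R) : cmeasurable f -> rintegrable mu g ->
  (forall x, normc (f x) ^+ 2 <= g x) -> sqint f.
Proof.
move=> mf gi fg; split => //; apply: (rintegrable_le (measurable_normc2 mf) gi) => x.
by rewrite ger0_norm ?sqr_ge0.
Qed.

(** Young's inequality, with weight s, for the cross term of the square. *)
Lemma normc_add_sqr (s : R) (z w : R[i]) : 0 < s ->
  normc (z + w) ^+ 2 <= (1 + s) * normc z ^+ 2 + (1 + s^-1) * normc w ^+ 2.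
Proof.
move=> s0; have := normc_triangle z w.
have := normc_ge0 z; have := normc_ge0 w; have := normc_ge0 (z + w).
move: (normc z) (normc w) (normc _) => a b c c0 b0 a0 cab.
have h : c ^+ 2 <= (a + b) ^+ 2 by rewrite lerXn2r// nnegrE addr_ge0.
apply: le_trans h _; rewrite -subr_ge0.
rewrite (_ : _ - _ = s * (a - s^-1 * b) ^+ 2).
  by rewrite mulr_ge0 ?sqr_ge0// ltW.
by field; lra.
Qed.

Lemma sqintD f g : sqint f -> sqint g -> sqint (fun x => f x + g x).
Proof.
move=> [mf fi] [mg gi].
apply: (@sqint_le _ (fun x => (1 + 1) * normc (f x) ^+ 2 + (1 + 1^-1) * normc (g x) ^+ 2)).
- exact: cmeasurableD.
- by apply: rintegrableD; exact: rintegrableZ.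
- by move=> x; exact: normc_add_sqr.
Qed.

Lemma sqintZ (c : R[i]) f : sqint f -> sqint (fun x => c * f x).
Proof.
move=> [mf fi]; split; first exact: cmeasurableZ.
by under eq_fun do rewrite normc_mul exprMn; exact: rintegrableZ.
Qed.

Lemma sqintB f g : sqint f -> sqint g -> sqint (fun x => f x - g x).
Proof.
move=> fi gi; under eq_fun do rewrite -(mulN1r (g _)).
by apply: sqintD => //; exact: sqintZ.
Qed.

Lemma sqintJ f : sqint f -> sqint (fun x => ((f x)^*)%C).
Proof.
move=> [mf fi]; split; first exact: cmeasurableJ.
by under eq_fun do rewrite normc_conj.
Qed.

Lemma sqnJ f : sqn (fun x => ((f x)^*)%C) = sqn f.
Proof. by rewrite /sqn; under eq_Rintegral do rewrite normc_conj. Qed.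

Lemma sqnD (s : R) f g : 0 < s -> sqint f -> sqint g ->
  sqn (fun x => f x + g x) <= (1 + s) * sqn f + (1 + s^-1) * sqn g.
Proof.
move=> s0 fi gi; rewrite /sqn -!RintegralZl//; [|by case: gi|by case: fi].
rewrite -RintegralD//; last 2 first.
- by apply: rintegrableZ; case: fi.
- by apply: rintegrableZ; case: gi.
apply: Rintegral_le.
- by case: (sqintD fi gi).
- by apply: rintegrableD; apply: rintegrableZ; [case: fi|case: gi].
- by move=> x; exact: normc_add_sqr.
Qed.

Lemma sqnD2 f g : sqint f -> sqint g ->
  sqn (fun x => f x + g x) <= 2 * sqn f + 2 * sqn g.
Proof.
by move=> fi gi; have := sqnD ltr01 fi gi; rewrite invr1 (_ : 1 + 1 = 2).
Qed.

Lemma sqnZ (c : R[i]) f : sqint f ->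
  sqn (fun x => c * f x) = normc c ^+ 2 * sqn f.
Proof.
move=> [_ fi]; rewrite /sqn -RintegralZl//.
by apply: eq_Rintegral => x _; rewrite normc_mul exprMn.
Qed.

Lemma sqn_distC f g : sqn (fun x => f x - g x) = sqn (fun x => g x - f x).
Proof. by rewrite /sqn; apply: eq_Rintegral => x _; rewrite normc_distC. Qed.

Lemma ae_eq_sqn f g : cmeasurable f -> cmeasurable g -> ae_eq mu setT f g ->
  sqn f = sqn g.
Proof.
move=> mf mg fg; apply: ae_eq_Rintegral; [exact: measurable_normc2..|].
by apply: filterS fg => x h xT; rewrite h.
Qed.

Lemma sqn_eq0_ae f : sqint f -> sqn f = 0 -> ae_eq mu setT f (fun=> 0).
Proof.
move=> [mf fi] f0.
have := Rintegral_eq0_ae (measurable_normc2 mf) (fun x => sqr_ge0 _) fi f0.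
apply: filterS => x /= h xT; apply: normc_eq0P; apply/eqP.
by rewrite -sqrf_eq0; apply/eqP; exact: h.
Qed.

Lemma cintegrable_mul f g : sqint f -> sqint g -> cintegrable mu (fun x => f x * g x).
Proof.
move=> [mf fi] [mg gi].
apply: (@cintegrable_le _ _ _ _ _ (fun x => normc (f x) ^+ 2 + normc (g x) ^+ 2)).
- exact: cmeasurableM.
- exact: rintegrableD.
- move=> x; rewrite normc_mul; have := normc_ge0 (f x); have := normc_ge0 (g x).
  by move: (normc _) (normc _) => a b a0 b0; nra.
Qed.

Lemma cauchy_schwarz f g : sqint f -> sqint g ->
  normc (cintm mu (fun x => f x * g x)) ^+ 2 <= sqn f * sqn g.
Proof.
move=> fi gi; apply: quadratic_bound; rewrite ?normc_ge0 ?sqn_ge0// => c c0.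
have fgi := cintegrable_mul fi gi.
apply: (@le_trans _ _ (2 * \int[mu]_x normc (f x * g x))).
  by rewrite ler_pM2l// normc_cintm.
have nfi := cintegrable_normc fgi.
have [[_ fi'] [_ gi']] := (fi, gi).
rewrite /sqn -!RintegralZl// -RintegralD//; try exact: rintegrableZ.
apply: Rintegral_le.
- exact: rintegrableZ.
- by apply: rintegrableD; exact: rintegrableZ.
move=> x; rewrite normc_mul -subr_ge0.
rewrite (_ : _ - _ = c * (normc (f x) - c^-1 * normc (g x)) ^+ 2).
  by rewrite mulr_ge0 ?sqr_ge0// ltW.
by field; lra.
Qed.

Lemma sqint_sum J (r : seq J) (u : J -> T -> R[i]) :
  (forall j, sqint (u j)) -> sqint (fun x => \sum_(j <- r) u j x).
Proof.
move=> ui; elim: r => [|j r IH].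
  under eq_fun do rewrite big_nil; split; first exact: cmeasurable_cst.
  by under eq_fun do rewrite normc0E expr0n; exact: integrable0.
by under eq_fun do rewrite big_cons; exact: sqintD.
Qed.

Lemma L2innerE f g : L2inner mu f g = cintm mu (fun x => f x * ((g x)^*)%C).
Proof. by []. Qed.

Lemma L2inner_self f : L2inner mu f f = (sqn f)%:C%C.
Proof.
rewrite /L2inner /sqn -cintm_real; congr cintm.
by apply/funext => x; rewrite mulcJ.
Qed.

Lemma sqn_sub f g (c : R[i]) : sqint f -> sqint g ->
  sqn (fun x => f x - c * g x) =
  sqn f - 2 * complex.Re ((c^*)%C * L2inner mu f g) + normc c ^+ 2 * sqn g.
Proof.
move=> fi gi.
have fgi := cintegrable_mul fi (sqintJ gi).
have [[_ fi'] [_ gi']] := (fi, gi).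
rewrite /L2inner -cintmZ// [complex.Re _]/= /sqn -!RintegralZl//; last first.
  by have [] := cintegrableZ (c^*)%C fgi.
rewrite -RintegralB//; last by apply: rintegrableZ; have [] := cintegrableZ (c^*)%C fgi.
rewrite -RintegralD//; last 2 first.
- apply: rintegrableB => //.
  by apply: rintegrableZ; have [] := cintegrableZ (c^*)%C fgi.
- exact: rintegrableZ.
apply: eq_Rintegral => x _; rewrite -exprMn -normc_mul !normc_sqr.
move: c (f x) (g x) => [c1 c2] [a1 a2] [b1 b2] /=; ring.
Qed.

End square_integrable.

Section orthogonal_families.
Context d (T : measurableType d) {R : realType}.
Variable mu : {measure set T -> \bar R}.
Variables (e : nat -> T -> R[i]) (f : T -> R[i]).
Hypothesis orth : orthogonal_family mu e.
Hypothesis fi : sqint mu f.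

Let ei j : sqint mu (e j).
Proof. by apply/L2P; have [] := orth. Qed.

Lemma orthogonal_sqn_neq0 j : sqn mu (e j) != 0.
Proof. by rewrite -L2norm_sqr// sqrf_eq0; have [] := orth. Qed.

Lemma orthogonal_sqn_gt0 j : 0 < sqn mu (e j).
Proof. by rewrite lt_neqAle eq_sym orthogonal_sqn_neq0 sqn_ge0. Qed.

Definition fourier_coef j : R[i] := (sqn mu (e j))^-1%:C%C * L2inner mu f (e j).

Definition fourier_residual n : T -> R[i] :=
  fun x => f x - \sum_(0 <= j < n) fourier_coef j * e j x.

Lemma fourier_residual_sqint n : sqint mu (fourier_residual n).
Proof. by apply: sqintB => //; apply: sqint_sum => j; exact: sqintZ. Qed.

Lemma fourier_residual_inner n k : (n <= k)%N ->
  L2inner mu (fourier_residual n) (e k) = L2inner mu f (e k).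
Proof.
elim: n => [|n IH] nk.
  by congr cintm; apply/funext => x; rewrite /fourier_residual big_nil subr0.
rewrite -IH 1?ltnW// !L2innerE.
have -> : (fun x => fourier_residual n.+1 x * ((e k x)^*)%C) =
    (fun x => fourier_residual n x * ((e k x)^*)%C
      - fourier_coef n * (e n x * ((e k x)^*)%C)).
  by apply/funext => x; rewrite /fourier_residual big_nat_recr//=; ring.
rewrite cintmB; last 2 first.
- exact/(cintegrable_mul (fourier_residual_sqint n))/sqintJ.
- by apply: cintegrableZ; exact/(cintegrable_mul (ei n))/sqintJ.
rewrite cintmZ; last exact/(cintegrable_mul (ei n))/sqintJ.
have [_ _ ort] := orth; have := ort n k; rewrite L2innerE => ->.
  by rewrite mulr0 subr0.
by rewrite ltn_eqF.
Qed.

(** Pythagoras: each term removed from the residual is orthogonal to what is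
    left. *)
Lemma fourier_residual_sqn n : sqn mu (fourier_residual n) =
  sqn mu f - \sum_(0 <= j < n) normc (L2inner mu f (e j)) ^+ 2 / sqn mu (e j).
Proof.
elim: n => [|n IH].
  rewrite big_nil subr0; congr sqn; apply/funext => x.
  by rewrite /fourier_residual big_nil subr0.
have -> : fourier_residual n.+1 =
    (fun x => fourier_residual n x - fourier_coef n * e n x).
  by apply/funext => x; rewrite /fourier_residual big_nat_recr//=; ring.
rewrite sqn_sub//; last exact: fourier_residual_sqint.
rewrite IH big_nat_recr// fourier_residual_inner// /fourier_coef.
have := orthogonal_sqn_neq0 n; move: (sqn mu (e n)) (L2inner _ _ _) => s [a b] s0.
rewrite normc_mul normc_real exprMn real_normK ?num_real// normc_sqr /=.
by field.
Qed.

Lemma bessel n :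
  \sum_(0 <= j < n) normc (L2inner mu f (e j)) ^+ 2 / sqn mu (e j) <= sqn mu f.
Proof. by rewrite -subr_ge0 -fourier_residual_sqn sqn_ge0. Qed.

End orthogonal_families.

(** * Borel sets and approximation by continuous functions *)

Section distance_to_complement.
Context {R : realType} {E : pmetricType R}.
Implicit Types U : set E.

(** Distance to the complement of U. The case U = setT is separate because the
    infimum of the empty set is 0, whereas a positive value is wanted on U. *)
Definition codist U (x : E) : R :=
  if `[< U = setT >] then 1 else inf [set mdist x a | a in ~` U].

Lemma codist_lbound U x : has_lbound [set mdist x a | a in ~` U].
Proof. by exists 0 => _ [a _ <-]; exact: mdist_ge0. Qed.

Lemma codist_nonempty U x : U <> setT -> [set mdist x a | a in ~` U] !=set0.
Proof.
move=> UT; have [//|h] := pselect ([set mdist x a | a in ~` U] !=set0).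
exfalso; apply: UT; apply/seteqP; split => // a _; apply: contrapT => Ua.
by apply: h; exists (mdist x a), a.
Qed.

Lemma codist_ge0 U x : 0 <= codist U x.
Proof.
rewrite /codist; case: asboolP => // UT; apply: lb_le_inf; first exact: codist_nonempty.
by move=> _ [a _ <-]; exact: mdist_ge0.
Qed.

Lemma codist_lipschitz U x y : codist U x <= mdist x y + codist U y.
Proof.
rewrite /codist; case: asboolP => UT; first by rewrite lerDr mdist_ge0.
rewrite -lerBlDl; apply: lb_le_inf; first exact: codist_nonempty.
move=> _ [a Ua <-]; rewrite lerBlDl (le_trans _ (metric_triangle x y a))//.
by apply: ge_inf; [exact: codist_lbound|exists a].
Qed.

Lemma codist_continuous U : continuous (codist U).
Proof.
move=> x; apply/cvgrPdist_lt => e e0.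
have : nbhs x (ball x e) by exact: nbhsx_ballx.
apply: filterS => y; rewrite ballEmdist /= => xy.
rewrite (le_lt_trans _ xy)// ler_norml; apply/andP; split.
- by rewrite lerBrDl lerBlDr (le_trans (codist_lipschitz U y x))// addrC lerD2l metric_sym.
- by rewrite lerBlDr codist_lipschitz.
Qed.

Lemma codist_gt0 U x : open U -> U x -> 0 < codist U x.
Proof.
move=> oU Ux; rewrite /codist; case: asboolP => // UT.
have /nbhs_ballP[e /= e0 eU] : nbhs x U by exact: open_nbhs_nbhs.
rewrite (lt_le_trans e0)//; apply: lb_le_inf; first exact: codist_nonempty.
move=> _ [a Ua <-]; rewrite leNgt; apply/negP => h; apply: Ua; apply: eU.
by rewrite ballEmdist.
Qed.

Lemma codist_eq0 U x : ~ U x -> codist U x = 0.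
Proof.
move=> Ux; apply/eqP; rewrite eq_le codist_ge0 andbT.
rewrite /codist; case: asboolP => UT; first by exfalso; apply: Ux; rewrite UT.
by apply: ge_inf; [exact: codist_lbound|exists x => //; exact: mdistxx].
Qed.

(** For open U these continuous functions increase to the indicator of U. *)
Definition obump U (n : nat) (x : E) : R := Num.min 1 (n%:R * codist U x).

Lemma obump_continuous U n : continuous (obump U n).
Proof.
move=> x; apply: (@continuous_min R E (fun=> 1) (fun x => n%:R * codist U x)).
  exact: cvg_cst.
by apply: cvgMl_tmp; exact: codist_continuous.
Qed.

Lemma obump_ge0 U n x : 0 <= obump U n x.
Proof. by rewrite le_min ler01 mulr_ge0 ?codist_ge0. Qed.

Lemma obump_le1 U n x : obump U n x <= 1.
Proof. by rewrite ge_min lexx. Qed.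

Lemma obump_nd U m n x : (m <= n)%N -> obump U m x <= obump U n x.
Proof.
move=> mn; rewrite le_min obump_le1/= (@le_trans _ _ (m%:R * codist U x))//.
  by rewrite ge_min lexx orbT.
by rewrite ler_wpM2r ?codist_ge0// ler_nat.
Qed.

Lemma obump_out U n x : ~ U x -> obump U n x = 0.
Proof. by move=> Ux; rewrite /obump codist_eq0// mulr0 min_r. Qed.

Lemma obump_near1 U x : open U -> U x -> \forall n \near \oo, obump U n x = 1.
Proof.
move=> oU Ux; have d0 := codist_gt0 oU Ux.
near=> n; rewrite /obump min_l//.
rewrite -ler_pdivrMr// mul1r.
by near: n; exact: nbhs_infty_ger.
Unshelve. all: by end_near. Qed.

Lemma obump_cvg U x : open U -> obump U n x @[n --> \oo] --> (\1_U x : R).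
Proof.
move=> oU; apply: cvg_near_cst; have [Ux|Ux] := pselect (U x).
- by rewrite indicE mem_set//; apply: obump_near1.
- by rewrite indicE memNset//; apply: nearW => n; rewrite obump_out.
Qed.

End distance_to_complement.

Section borel_sets.
Context {R : realType} {E : pmetricType R}.

(** Open sets are stable under finite intersections, so Dynkin's theorem
    applies. *)
Lemma borel_induction (P : set (set (borel E))) :
  (forall U : set E, open U -> P U) ->
  (forall A, measurable A -> P A -> P (~` A)) ->
  (forall F : nat -> set (borel E), (forall n, measurable (F n)) ->
    trivIset setT F -> (forall n, P (F n)) -> P (\bigcup_n F n)) ->
  forall A, measurable A -> P A.
Proof.
move=> PU PC PF A mA.
apply: (@dynkin_induction _ (borel E) (@open E) P erefl) => //.
- by move=> U V oU oV; exact: openI.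
- by apply: PU; exact: openT.
Qed.

Lemma open_borel (U : set E) : open U -> measurable (U : set (borel E)).
Proof. exact: sub_sigma_algebra. Qed.

End borel_sets.

Section indicator_series.
Context d (T : measurableType d) {R : realType}.
Variable A : nat -> set T.
Hypothesis tA : trivIset setT A.

Lemma sum_cind_in N k x : (k < N)%N -> A k x ->
  \sum_(0 <= i < N) cind (A i) x = 1 :> R[i].
Proof.
move=> kN kx; rewrite -(sum_partition (fun=> 1 : R[i]) tA kN kx).
by apply: eq_bigr => i _; rewrite mul1r.
Qed.

Lemma sum_cind_notin N x : (forall k, (k < N)%N -> ~ A k x) ->
  \sum_(0 <= i < N) cind (A i) x = 0 :> R[i].
Proof.
move=> h; rewrite big_nat big1// => i /andP[_ iN].
by rewrite cind_notin//; exact: h.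
Qed.

Lemma normc_sum_cind N x : normc (\sum_(0 <= i < N) cind (A i) x : R[i]) <= 1.
Proof.
have [[k kN kx]|h] := pselect (exists2 k, (k < N)%N & A k x).
  by rewrite (sum_cind_in kN kx) normc1E.
rewrite sum_cind_notin ?normc0E// => k kN kx; apply: h; by exists k.
Qed.

Lemma cvg_sum_cind x :
  ((fun N => \sum_(0 <= i < N) cind (A i) x) : nat -> (R[i])^o) @ \oo
  --> (cind (\bigcup_i A i) x : (R[i])^o).
Proof.
apply: cvg_near_cst; have [[k _ kx]|h] := pselect ((\bigcup_i A i) x).
  rewrite cind_in; last by exists k.
  by near=> N; apply: (sum_cind_in _ kx); near: N; exact: nbhs_infty_gt.
rewrite cind_notin//; apply: nearW => N; apply: sum_cind_notin => k _ kx.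
by apply: h; exists k.
Unshelve. all: by end_near. Qed.

End indicator_series.

Section borel_functionals.
Context {R : realType} {E : pmetricType R}.
Local Notation BE := (borel E).

(** The conclusion of the bounded convergence theorem, as a property of
    functionals. *)
Definition bounded_cvg_continuous d (T : measurableType d)
    (F : (T -> R[i]) -> R[i]) : Prop :=
  forall (u : nat -> T -> R[i]) f (M : R), (forall n, cmeasurable (u n)) ->
    (forall n x, normc (u n x) <= M) ->
    (forall x, ((fun n => u n x) : nat -> (R[i])^o) @ \oo --> (f x : (R[i])^o)) ->
    ((fun n => F (u n)) : nat -> (R[i])^o) @ \oo --> (F f : (R[i])^o).

Lemma cvg_cind_obump (U : set E) x : open U ->
  ((fun n => (obump U n x)%:C%C) : nat -> (R[i])^o) @ \oo --> (cind (U : set BE) x : (R[i])^o).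
Proof.
move=> oU; apply/ccvgP; split => /=; first exact: obump_cvg.
exact: cvg_cst.
Qed.

Lemma normc_obump (U : set E) n x : normc ((obump U n x)%:C%C : R[i]) <= 1.
Proof. by rewrite normc_real ger0_norm ?obump_ge0// obump_le1. Qed.

Lemma cind_setC d (T : measurableType d) (A : set T) :
  cind (~` A) = (fun x => 1 - cind A x) :> (T -> R[i]).
Proof.
apply/funext => x; have [Ax|Ax] := pselect (A x).
- by rewrite (cind_in Ax) cind_notin ?subrr//; exact.
- by rewrite (cind_notin Ax) cind_in ?subr0.
Qed.

(** A functional monotone class theorem. Indicators of open sets are bounded
    limits of continuous functions, indicators of Borel sets are reached by
    borel_induction, and bounded Borel functions are uniform limits of simple
    ones. *)
Lemma cbm_induction (P : (BE -> R[i]) -> Prop) :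
  (forall f : E -> R[i], ccontinuous f -> P f) ->
  (forall c f g, cbm f -> cbm g -> P f -> P g -> P (fun x => c * f x + g x)) ->
  (forall (u : nat -> BE -> R[i]) f (M : R), (forall n, cbm (u n)) -> cbm f ->
    (forall n x, normc (u n x) <= M) ->
    (forall x, ((fun n => u n x) : nat -> (R[i])^o) @ \oo --> (f x : (R[i])^o)) ->
    (forall n, P (u n)) -> P f) ->
  forall f, cbm f -> P f.
Proof.
move=> Pcont Plin Plim.
have bcind A : measurable A -> @cbm _ BE R (cind A) by exact: cbm_cind.
have Psum N (c : nat -> R[i]) (A : nat -> set BE) : (forall i, measurable (A i)) ->
    (forall i, P (cind (A i))) -> P (fun x => \sum_(0 <= i < N) c i * cind (A i) x).
  move=> mA PA; elim: N => [|N IH].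
    under eq_fun do rewrite big_nil.
    by apply: Pcont; exact: ccontinuous_cst.
  under eq_fun do rewrite big_nat_recr//= addrC.
  apply: Plin => //; first exact: bcind.
  by apply: cbm_sum => i; apply: cbmZ; exact: bcind.
have Pcind A : measurable A -> P (cind A).
  apply: (@borel_induction R E (fun A => P (cind A))) => {A} [U oU|A mA PA|A mA tA PA].
  - apply: (Plim (fun n x => (obump U n x)%:C%C) _ 1).
    + move=> n; split; last by exists 1 => x; exact: normc_obump.
      apply: cmeasurable_real; apply: (@continuous_borel R E (obump U n)).
      exact: obump_continuous.
    + by apply: bcind; exact: open_borel.
    + exact: normc_obump.
    + by move=> x; exact: cvg_cind_obump.
    + by move=> n; apply: Pcont; apply: ccontinuous_real; exact: obump_continuous.
  - rewrite cind_setC (_ : (fun x => _) = (fun x => -1 * cind A x + 1)); last first.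
      by apply/funext => x; ring.
    apply: Plin => //; [exact: bcind|exact: cbm_cst|].
    by apply: Pcont; exact: ccontinuous_cst.
  - apply: (Plim (fun n x => \sum_(0 <= i < n) cind (A i) x) _ 1).
    + by move=> n; apply: cbm_sum => i; exact: bcind.
    + exact/bcind/bigcupT_measurable.
    + by move=> n x; exact: normc_sum_cind.
    + by move=> x; exact: cvg_sum_cind.
    + move=> n; have := Psum n (fun=> 1) A mA PA.
      by under eq_fun do under eq_bigr do rewrite mul1r.
move=> f bf; have [mf [M fM]] := bf.
have H (n : nat) : exists g, [/\ cbm g, P g & forall x, normc (f x - g x) <= n.+1%:R^-1].
  have [//|N [c [A [mA tA covA fc]]]] := simple_partition mf fM (e := n.+1%:R^-1).
  exists (fun x => \sum_(0 <= i < N) c i * cind (A i) x); split.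
  - by apply: cbm_sum => i; apply: cbmZ; exact: bcind.
  - by apply: Psum => // i; exact: Pcind.
  - by move=> x; have [k kN kx] := covA x; rewrite (sum_partition c tA kN kx) fc.
have [u Hu] := boolp.choice H.
apply: (Plim u f (M + 1)) => [n||n x|x|n] //; first by have [] := Hu n.
- have [_ _ /(_ x) h] := Hu n; rewrite (_ : u n x = f x - (f x - u n x)); last by ring.
  rewrite (le_trans (normc_triangle _ _))// lerD// normc_opp (le_trans h)//.
  by rewrite invf_le1// ler1n.
- apply/ccvg_normcP; apply: (@squeeze_cvgr _ _ _ _ (fun=> 0) (fun n => n.+1%:R^-1)).
  + apply: nearW => n; rewrite normc_ge0/= normc_distC.
    by have [_ _] := Hu n; apply.
  + exact: cvg_cst.
  + exact: cvg_harmonic.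
- by have [] := Hu n.
Qed.

Lemma borel_functional_ext (F G : (BE -> R[i]) -> R[i]) :
  bfunctional F -> bfunctional G ->
  bounded_cvg_continuous F -> bounded_cvg_continuous G ->
  (forall f : E -> R[i], ccontinuous f -> F f = G f) ->
  forall f, cbm f -> F f = G f.
Proof.
move=> hF hG cF cG FG; apply: cbm_induction => [|c f g bf bg Ff Fg|u f M bu bf uM uf Fu].
- exact: FG.
- by rewrite (bfunctional_lin hF)// (bfunctional_lin hG)// Ff Fg.
- have mu n : cmeasurable (u n) by have [] := bu n.
  apply: (ccvg_unique (cF u f M mu uM uf)).
  by rewrite (funext Fu : (fun n => F (u n)) = _); exact: cG.
Qed.

Lemma cintm_bounded_cvg_continuous d (T : measurableType d)
    (mu : {finite_measure set T -> \bar R}) : bounded_cvg_continuous (cintm mu).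
Proof. by move=> u f M mu_ uM uf; exact: (@cintm_bounded_cvg _ _ _ mu u f M mu_ uM uf). Qed.

Lemma ccontinuous_cbm (f : E -> R[i]) : compact [set: E] -> ccontinuous f ->
  @cbm _ BE R f.
Proof.
by move=> cE cf; split; [exact: ccontinuous_borel|exact: ccontinuous_cbounded].
Qed.

End borel_functionals.

Section continuous_dense.
Context {R : realType} {E : pmetricType R}.
Hypothesis compactE : compact [set: E].
Local Notation BE := (borel E).
Variable m : {finite_measure set BE -> \bar R}.
Implicit Types f g : BE -> R[i].

Lemma cbm_sqint d (T : measurableType d) (mu : {finite_measure set T -> \bar R})
    (f : T -> R[i]) : cbm f -> sqint mu f.
Proof.
move=> [mf [M fM]]; apply: (sqint_le mf (rintegrable_cst mu (M ^+ 2))) => x.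
have := fM x; have := normc_ge0 (f x); move: (normc _) => a a0 aM; nra.
Qed.

Lemma sqn_bounded d (T : measurableType d) (mu : {finite_measure set T -> \bar R})
    (f : T -> R[i]) (M : R) : cmeasurable f -> (forall x, normc (f x) <= M) ->
  sqn mu f <= M ^+ 2 * fine (mu setT).
Proof.
move=> mf fM; have bf : cbm f by split => //; exists M.
rewrite /sqn -Rintegral_cst//; apply: Rintegral_le.
- by case: (cbm_sqint mu bf).
- exact: rintegrable_cst.
- move=> x; have := fM x; have := normc_ge0 (f x).
  by move: (normc _) => a a0 aM; nra.
Qed.

Lemma sqn_dominated_cvg d (T : measurableType d) (mu : {measure set T -> \bar R})
    (u : nat -> T -> R[i]) (g : T -> R) :
  (forall n, cmeasurable (u n)) -> rintegrable mu g ->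
  (forall n x, normc (u n x) ^+ 2 <= g x) ->
  (forall x, normc (u n x) @[n --> \oo] --> (0 : R)) ->
  sqn mu (u n) @[n --> \oo] --> (0 : R).
Proof.
move=> mu_ gi ug u0.
suff : ((\int[mu]_x (normc (u n x) ^+ 2)%:E)%E @[n --> \oo]
    --> (\int[mu]_x (cst 0%E x))%E).
  by rewrite integral0 => /fine_cvg.
apply: (@dominated_cvg _ _ _ _ _ _ _ _ (EFin \o g)) => //.
- by move=> n; apply/measurable_EFinP; exact: measurable_normc2.
- move=> x _; apply/cvg_EFin; first exact: nearW.
  rewrite [X in _ --> X](_ : fine (cst 0%E x) = (0 : R) * 0)%R; last by rewrite mul0r.
  by under eq_fun do rewrite /= expr2; apply: cvgM; exact: u0.
- by move=> n x _; rewrite lee_fin ger0_norm ?sqr_ge0.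
Qed.

(** Membership in the L^2 closure of the continuous functions. *)
Definition L2approx f := forall e : R, 0 < e ->
  exists2 g : E -> R[i], ccontinuous g & sqn m (fun x => f x - g x) <= e.

Let ccont_sqint (g : E -> R[i]) : ccontinuous g -> sqint m g.
Proof. by move=> cg; apply: cbm_sqint; exact: ccontinuous_cbm. Qed.

Lemma L2approx_closed f : sqint m f ->
  (forall e : R, 0 < e ->
    exists g, [/\ sqint m g, L2approx g & sqn m (fun x => f x - g x) <= e]) ->
  L2approx f.
Proof.
move=> fi H e e0; have e4 : 0 < e / 4 by rewrite divr_gt0.
have [g [gi ga fg]] := H _ e4; have [h ch gh] := ga _ e4.
exists h => //; have hi := ccont_sqint ch.
have -> : (fun x => f x - h x) = (fun x => (f x - g x) + (g x - h x)).
  by apply/funext => x; ring.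
rewrite (le_trans (sqnD2 (sqintB fi gi) (sqintB gi hi)))//.
lra.
Qed.

Lemma L2approx_continuous (g : E -> R[i]) : ccontinuous g -> L2approx g.
Proof.
move=> cg e e0; exists g => //; rewrite (_ : (fun x => _) = (fun=> 0 * 1)).
  rewrite sqnZ ?normc0E ?expr0n ?mul0r ?ltW//.
  by apply: ccont_sqint; exact: ccontinuous_cst.
by apply/funext => x; rewrite subrr mul0r.
Qed.

Lemma L2approxD f g : sqint m f -> sqint m g -> L2approx f -> L2approx g ->
  L2approx (fun x => f x + g x).
Proof.
move=> fi gi fa ga e e0; have e4 : 0 < e / 4 by rewrite divr_gt0.
have [h ch fh] := fa _ e4; have [k ck gk] := ga _ e4.
exists (fun x => h x + k x); first by apply: ccontinuousD; [exact: ch|exact: ck].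
have -> : (fun x => f x + g x - (h x + k x)) = (fun x => (f x - h x) + (g x - k x)).
  by apply/funext => x; ring.
have hi := ccont_sqint ch; have ki := ccont_sqint ck.
by rewrite (le_trans (sqnD2 (sqintB fi hi) (sqintB gi ki)))//; lra.
Qed.

Lemma L2approxZ (c : R[i]) f : sqint m f -> L2approx f -> L2approx (fun x => c * f x).
Proof.
move=> fi fa e e0; have c0 : 0 < normc c ^+ 2 + 1 by rewrite ltr_wpDl ?sqr_ge0.
have [g cg fg] := fa (e / (normc c ^+ 2 + 1)) (divr_gt0 e0 c0).
exists (fun x => c * g x); first by apply: ccontinuousZ; exact: cg.
have gi := ccont_sqint cg.
have -> : (fun x => c * f x - c * g x) = (fun x => c * (f x - g x)).
  by apply/funext => x; ring.
rewrite sqnZ; last exact: sqintB.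
rewrite (le_trans (ler_wpM2l (sqr_ge0 _) fg))// mulrCA ler_piMr ?(ltW e0)//.
by rewrite ler_pdivrMr// mul1r lerDl.
Qed.

Lemma L2approx_cvg (u : nat -> BE -> R[i]) f (g : BE -> R) :
  sqint m f -> (forall n, sqint m (u n)) -> (forall n, L2approx (u n)) ->
  rintegrable m g -> (forall n x, normc (f x - u n x) ^+ 2 <= g x) ->
  (forall x, normc (f x - u n x) @[n --> \oo] --> (0 : R)) ->
  L2approx f.
Proof.
move=> fi ui ua gi fg fu; apply: L2approx_closed => // e e0.
have mf n : cmeasurable (fun x => f x - u n x).
  by apply: cmeasurableB; [case: fi|case: (ui n)].
have /cvgrPdist_le/(_ e e0) := sqn_dominated_cvg mf gi fg fu.
move=> [N _ /(_ N)]; rewrite /= leqnn sub0r normrN ger0_norm ?sqn_ge0// => /(_ isT) h.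
by exists (u N).
Qed.

Lemma normc_le_sqr (z : R[i]) (M : R) : normc z <= M -> normc z ^+ 2 <= M ^+ 2.
Proof. by have := normc_ge0 z; move: (normc _) => a a0 aM; nra. Qed.

Lemma L2approx_cbm f : cbm f -> L2approx f.
Proof.
apply: cbm_induction => [||u g M bu bg uM ug ua]; first exact: L2approx_continuous.
  move=> c g h bg bh ag ah; apply: L2approxD => //.
  - by apply: sqintZ; exact: cbm_sqint.
  - exact: cbm_sqint.
  - by apply: L2approxZ => //; exact: cbm_sqint.
have [_ [N gN]] := bg.
apply: (@L2approx_cvg u _ (fun=> (N + M) ^+ 2)) => //.
- exact: cbm_sqint.
- by move=> n; exact: cbm_sqint.
- exact: rintegrable_cst.
- move=> n x; apply: normc_le_sqr; rewrite (le_trans (normc_triangle _ _))//.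
  by rewrite normc_opp lerD.
- by move=> x; have /ccvg_normcP := ug x; under eq_fun do rewrite normc_distC.
Qed.

(** Setting f to zero where it exceeds n gives bounded functions that converge
    to f and are dominated by it. *)
Lemma L2approx_sqint f : sqint m f -> L2approx f.
Proof.
move=> fi; have [mf fi2] := fi.
pose A n := [set x | normc (f x) <= n%:R].
have mA n : measurable (A n).
  rewrite -[A n]setTI; have := measurable_normc mf.
  by move=> /(_ measurableT _ (measurable_itv `]-oo, n%:R])); rewrite set_itvE.
have bA n : cbm (fun x => f x * cind (A n) x).
  split; first by apply: cmeasurableM => //; case: (@cbm_cind _ _ R _ (mA n)).
  exists n%:R => x; rewrite normc_mul.
  have [Ax|Ax] := pselect (A n x); first by rewrite cind_in// normc1E mulr1.
  by rewrite cind_notin// normc0E mulr0.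
apply: (@L2approx_cvg (fun n x => f x * cind (A n) x) f
  (fun x => normc (f x) ^+ 2)) => //.
- by move=> n; exact: cbm_sqint.
- by move=> n; exact: L2approx_cbm.
- move=> n x; apply: normc_le_sqr.
  have [Ax|Ax] := pselect (A n x).
    by rewrite cind_in// mulr1 subrr normc0E normc_ge0.
  by rewrite cind_notin// mulr0 subr0.
- move=> x; apply: cvg_near_cst; near=> n.
  rewrite cind_in ?mulr1 ?subrr ?normc0E//= /A /=.
  by near: n; exact: nbhs_infty_ger.
Unshelve. all: by end_near. Qed.

End continuous_dense.

(** * The Riesz representation theorem on a compact metric space *)

Section riesz.
Context {R : realType} {E : pmetricType R}.
Hypothesis compactE : compact [set: E].
Variable L : (E -> R) -> R.
Hypothesis L_lin : forall c (f g : E -> R), continuous f -> continuous g ->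
  L (fun x => c * f x + g x) = c * L f + L g.
Hypothesis L_pos : forall f : E -> R, continuous f -> (forall x, 0 <= f x) -> 0 <= L f.
Hypothesis L_one : L (fun=> 1) = 1.
Implicit Types (U : set E) (f g : E -> R).

Let continuous_cst (c : R) : continuous (fun _ : E => c).
Proof. by move=> x; exact: cvg_cst. Qed.

Let continuousB f g : continuous f -> continuous g ->
  continuous (fun x => f x - g x).
Proof. by move=> cf cg x; apply: cvgB; [exact: cf|exact: cg]. Qed.

Let continuousZ c f : continuous f -> continuous (fun x => c * f x).
Proof. by move=> cf x; apply: cvgMl_tmp; exact: cf. Qed.

Let continuous_sumr n (u : nat -> E -> R) : (forall j, continuous (u j)) ->
  continuous (fun x => \sum_(0 <= j < n) u j x).
Proof.
move=> cu; elim: n => [|n IH].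
  by under eq_fun do rewrite big_nil; exact: continuous_cst.
under eq_fun do rewrite big_nat_recr//=.
by move=> x; apply: cvgD; [exact: IH|exact: cu].
Qed.

Let L0 : L (fun=> 0) = 0.
Proof.
have := L_lin (-1) (@continuous_cst 0) (@continuous_cst 0).
by under eq_fun do rewrite mulr0 addr0; rewrite mulN1r addNr.
Qed.

Let LZ c f : continuous f -> L (fun x => c * f x) = c * L f.
Proof.
move=> cf; have := L_lin c cf (@continuous_cst 0).
by rewrite L0 addr0 => <-; under [in RHS]eq_fun do rewrite addr0.
Qed.

Let LD f g : continuous f -> continuous g -> L (fun x => f x + g x) = L f + L g.
Proof.
move=> cf cg; have := L_lin 1 cf cg; rewrite mul1r => <-.
by under [in RHS]eq_fun do rewrite mul1r.
Qed.

Let LB f g : continuous f -> continuous g -> L (fun x => f x - g x) = L f - L g.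
Proof.
move=> cf cg.
rewrite (_ : (fun x => _) = (fun x => f x + -1 * g x)); last first.
  by apply/funext => x; rewrite mulN1r.
by rewrite LD ?LZ ?mulN1r//; exact: continuousZ.
Qed.

Let L_sum n (u : nat -> E -> R) : (forall j, continuous (u j)) ->
  L (fun x => \sum_(0 <= j < n) u j x) = \sum_(0 <= j < n) L (u j).
Proof.
move=> cu; elim: n => [|n IH].
  by under [X in L X]eq_fun do rewrite big_nil; rewrite big_nil L0.
under [X in L X]eq_fun do rewrite big_nat_recr//=.
by rewrite LD ?IH ?big_nat_recr//; exact: continuous_sumr.
Qed.

Let L_le f g : continuous f -> continuous g -> (forall x, f x <= g x) -> L f <= L g.
Proof.
move=> cf cg fg; rewrite -subr_ge0 -LB//; apply: L_pos; first exact: continuousB.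
by move=> x; rewrite subr_ge0.
Qed.

Let L_cst c : L (fun=> c) = c.
Proof.
rewrite (_ : (fun=> c) = (fun _ : E => c * 1)); last by apply/funext => x; rewrite mulr1.
by rewrite LZ ?L_one ?mulr1//; exact: continuous_cst.
Qed.

Definition subordinate U f :=
  [/\ continuous f, forall x, 0 <= f x <= 1 & forall x, ~ U x -> f x = 0].

(** The mass that a measure representing L has to give to the open set U. *)
Definition capacity U : R := sup [set L f | f in subordinate U].

Lemma subordinate0 U : subordinate U (fun=> 0).
Proof. by split; [exact: continuous_cst|move=> x; rewrite lexx ler01|]. Qed.

Lemma subordinate_le1 U f : subordinate U f -> L f <= 1.
Proof.
move=> [cf f01 _]; rewrite -L_one; apply: L_le => //.
by move=> x; have /andP[] := f01 x.
Qed.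

Lemma capacity_has_sup U : has_sup [set L f | f in subordinate U].
Proof.
split; first by exists (L (fun=> 0)), (fun=> 0) => //; exact: subordinate0.
by exists 1 => _ [f sf <-]; exact: subordinate_le1 sf.
Qed.

Lemma capacity_ge U f : subordinate U f -> L f <= capacity U.
Proof.
move=> sf; apply: sup_upper_bound; first exact: capacity_has_sup.
by exists f.
Qed.

Lemma capacity_le U (c : R) : (forall f, subordinate U f -> L f <= c) ->
  capacity U <= c.
Proof.
move=> h; apply: ge_sup; first by have [] := capacity_has_sup U.
by move=> _ [f sf <-]; exact: h.
Qed.

Lemma capacity_ge0 U : 0 <= capacity U.
Proof. by rewrite -L0; apply: capacity_ge; exact: subordinate0. Qed.

Lemma capacity_mono U V : U `<=` V -> capacity U <= capacity V.
Proof.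
move=> UV; apply: capacity_le => f [cf f01 f0]; apply: capacity_ge; split => //.
by move=> x Vx; apply: f0 => /UV.
Qed.

Lemma capacity_setT : capacity setT = 1.
Proof.
apply/eqP; rewrite eq_le; apply/andP; split.
  by apply: capacity_le => f; exact: subordinate_le1.
rewrite -{1}L_one; apply: capacity_ge.
by split => [|x|x /(_ I)//]; [exact: continuous_cst|rewrite ler01 lexx].
Qed.

Lemma obump_subordinate U n : subordinate U (obump U n).
Proof.
split; first exact: obump_continuous.
- by move=> x; rewrite obump_ge0 obump_le1.
- by move=> x; exact: obump_out.
Qed.

(** Dini's argument: the sum of the first N functions obump (U n) N increases
    with N and eventually exceeds f - e near each point, hence everywhere by
    compactness. *)
Lemma capacity_bigcup (U : nat -> set E) f (e : R) : (forall n, open (U n)) ->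
  subordinate (\bigcup_n U n) f -> 0 < e ->
  exists N, L f <= \sum_(0 <= n < N) capacity (U n) + e.
Proof.
move=> oU [cf f01 f0] e0.
pose g N x := \sum_(0 <= n < N) obump (U n) N x.
have cg N : continuous (g N) by apply: continuous_sumr => j; exact: obump_continuous.
have g_nd M N x : (M <= N)%N -> g M x <= g N x.
  move=> MN; rewrite /g (big_cat_nat _ MN)//=.
  rewrite -[leLHS]addr0 lerD//; last by apply: sumr_ge0 => i _; exact: obump_ge0.
  by apply: ler_sum => i _; exact: obump_nd.
have : \forall N \near \oo, [set: E] `<=` (fun x => f x - e < g N x).
  move/compact_near_coveringP : compactE => H.
  apply: (H nat \oo (fun N x => f x - e < g N x)) => x _.
  have [N0 HN] : exists N0, f x - e < g N0 x.
    have [[n _ Ux]|Ux] := pselect ((\bigcup_n U n) x); last first.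
      exists 0%N; rewrite (f0 x Ux) /g big_nil; lra.
    have [M _ HM] := obump_near1 (oU n) Ux.
    exists (maxn M n.+1).
    have fx1 : f x <= 1 by have /andP[] := f01 x.
    apply: (@lt_le_trans _ _ 1); first lra.
    rewrite /g (bigD1_seq n) ?mem_index_iota ?iota_uniq//=; last by rewrite leq_maxr.
    rewrite (HM (maxn M n.+1)) /=; last by rewrite leq_maxl.
    by rewrite lerDl sumr_ge0// => i _; exact: obump_ge0.
  have : \forall x' \near x, f x' - e < g N0 x'.
    have cfg : continuous (fun x => f x - g N0 x) by apply: continuousB => //.
    have /cvgrPdist_lt/(_ (e - (f x - g N0 x))) := cfg x.
    rewrite subr_gt0 (_ : (f x - g N0 x < e)); last by lra.
    move=> /(_ isT); apply: filterS => y; rewrite ltr_norml => /andP[h _]; lra.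
  move=> hx; exists ([set x' | f x' - e < g N0 x'], [set N | (N0 <= N)%N]).
    by split => //=; exact: nbhs_infty_ge.
  by move=> [y N] /= [hy hN]; exact: lt_le_trans (g_nd _ _ _ hN).
move=> [N _ /(_ N (leqnn _)) HN]; exists N.
have -> : \sum_(0 <= n < N) capacity (U n) + e = \sum_(0 <= n < N) capacity (U n) + L (fun=> e).
  by rewrite L_cst.
apply: (@le_trans _ _ (L (g N) + L (fun=> e))).
  rewrite -LD//; apply: L_le => //.
    by move=> x; apply: cvgD; [exact: cg|exact: cvg_cst].
  by move=> x; have := HN x I; lra.
rewrite lerD2r L_sum; last by move=> j; exact: obump_continuous.
by apply: ler_sum => i _; apply: capacity_ge; exact: obump_subordinate.
Qed.

Definition outer_capacity (A : set E) : R :=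
  inf [set capacity U | U in [set U | open U /\ A `<=` U]].

Lemma outer_capacity_has_inf A :
  has_inf [set capacity U | U in [set U | open U /\ A `<=` U]].
Proof.
split; first by exists (capacity setT), setT => //; split => //; exact: openT.
by exists 0 => _ [U _ <-]; exact: capacity_ge0.
Qed.

Lemma outer_capacity_le A U : open U -> A `<=` U -> outer_capacity A <= capacity U.
Proof.
move=> oU AU; apply: ge_inf; first by have [] := outer_capacity_has_inf A.
by exists U.
Qed.

Lemma outer_capacity_ge A (c : R) :
  (forall U, open U -> A `<=` U -> c <= capacity U) -> c <= outer_capacity A.
Proof.
move=> h; apply: lb_le_inf; first by have [] := outer_capacity_has_inf A.
by move=> _ [U [oU AU] <-]; exact: h.
Qed.

Lemma outer_capacity_adherent A (e : R) : 0 < e ->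
  exists U, [/\ open U, A `<=` U & capacity U < outer_capacity A + e].
Proof.
move=> e0; have [_ [U [oU AU] <-] h] := inf_adherent e0 (outer_capacity_has_inf A).
by exists U.
Qed.

Lemma outer_capacity_open U : open U -> outer_capacity U = capacity U.
Proof.
move=> oU; apply/eqP; rewrite eq_le outer_capacity_le//=.
by apply: outer_capacity_ge => V _; exact: capacity_mono.
Qed.

Definition riesz_outer (A : set E) : \bar R := (outer_capacity A)%:E.

Let riesz_outer0 : riesz_outer set0 = 0%E.
Proof.
rewrite /riesz_outer outer_capacity_open; last exact: open0.
congr EFin; apply/eqP; rewrite eq_le capacity_ge0 andbT.
apply: capacity_le => f [cf _ f0]; rewrite (_ : f = (fun=> 0)) ?L0//.
by apply/funext => x; apply: f0.
Qed.

Let riesz_outer_ge0 A : (0 <= riesz_outer A)%E.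
Proof. by rewrite lee_fin; apply: outer_capacity_ge => U _ _; exact: capacity_ge0. Qed.

Let riesz_outer_le : {homo riesz_outer : A B / A `<=` B >-> (A <= B)%E}.
Proof.
move=> A B AB; rewrite lee_fin; apply: outer_capacity_ge => U oU BU.
by apply: outer_capacity_le => //; exact: subset_trans BU.
Qed.

Let sum_geometric (e : R) N : \sum_(0 <= n < N) e / 2 ^+ n.+1 = e - e / 2 ^+ N.
Proof.
elim: N => [|N IH]; first by rewrite big_nil expr0 divr1 subrr.
rewrite big_nat_recr//= IH exprS; field.
by rewrite expf_neq0.
Qed.

Let riesz_outer_subadditive : sigma_subadditive riesz_outer.
Proof.
move=> A; apply/lee_addgt0Pr => e e0; pose d := e / 2.
have d0 : 0 < d by rewrite divr_gt0.
have dn n : 0 < d / 2 ^+ n.+1 by rewrite divr_gt0// exprn_gt0.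
have /choice[U HU] n := outer_capacity_adherent (A n) (dn n).
have oU n : open (U n) by have [] := HU n.
apply: (@le_trans _ _ (capacity (\bigcup_n U n))%:E).
  rewrite lee_fin outer_capacity_le//; first exact: bigcup_open.
  by move=> x [n _ Anx]; exists n => //; have [_ AU _] := HU n; exact: AU.
have -> : (\sum_(n <oo) riesz_outer (A n) + e%:E =
  \sum_(n <oo) riesz_outer (A n) + e%:E)%E by [].
have ge N : ((\sum_(0 <= n < N) outer_capacity (A n))%:E
    <= \sum_(n <oo) riesz_outer (A n))%E.
  rewrite -sumEFin; apply: nneseries_lim_ge => n _ _; exact: riesz_outer_ge0.
have [r Hr] : exists r, (\sum_(n <oo) riesz_outer (A n) = r%:E \/
    \sum_(n <oo) riesz_outer (A n) = +oo)%E.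
  have : (0 <= \sum_(n <oo) riesz_outer (A n))%E.
    by apply: nneseries_ge0 => n _ _; exact: riesz_outer_ge0.
  by case: (\sum_(n <oo) _)%E => [r _| _|//]; [exists r; left|exists 0; right].
case: Hr => Hr; last by rewrite Hr leey.
rewrite Hr -EFinD lee_fin; apply: capacity_le => f sf.
have [N HN] := capacity_bigcup oU sf d0.
apply: (le_trans HN); have := ge N; rewrite Hr lee_fin => h.
have : \sum_(0 <= n < N) capacity (U n) <=
    \sum_(0 <= n < N) (outer_capacity (A n) + d / 2 ^+ n.+1).
  by apply: ler_sum => n _; have [_ _ /ltW] := HU n.
rewrite big_split/= sum_geometric => h2.
have : 0 <= d / 2 ^+ N by rewrite divr_ge0 ?exprn_ge0// ltW.
rewrite (_ : e = d + d); first by lra.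
by rewrite /d -splitr.
Qed.

HB.instance Definition _ := isOuterMeasure.Build R E riesz_outer
  riesz_outer0 riesz_outer_ge0 riesz_outer_le riesz_outer_subadditive.

(** Let f be subordinate to the intersection of U and V. The part W of V where
    f < e is open and still contains what X has outside U, and a function
    subordinate to W can be added to max (0, f - e) without exceeding 1; so
    the capacity of V is at least the sum of the two, up to e. *)
Lemma open_riesz_caratheodory U : open U -> riesz_outer.-caratheodory U.
Proof.
move=> oU; apply: le_caratheodory_measurable => X.
rewrite -EFinD lee_fin; apply: outer_capacity_ge => V oV XV.
apply: (@le_trans _ _ (capacity (U `&` V) + outer_capacity (X `&` ~` U))).
  rewrite lerD2r outer_capacity_le//; first exact: openI.
  by move=> x [Xx Ux]; split => //; exact: XV.
rewrite -lerBrDr; apply: capacity_le => f [cf f01 f0].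
apply/ler_addgt0Pr => e e0; rewrite -lerBlDr lerBrDr.
pose h x := Num.max 0 (f x - e).
have ch : continuous h.
  move=> x; apply: (@continuous_max R E (fun=> 0) (fun x => f x - e)).
    exact: cvg_cst.
  by apply: cvgB; [exact: cf|exact: cvg_cst].
pose W := V `&` [set x | f x < e].
have oW : open W.
  apply: openI => //; rewrite (_ : [set x | f x < e] = f @^-1` [set y | y < e])//.
  by move/continuousP : cf; apply; exact: open_lt.
have hf x : f x - e <= h x by rewrite le_max lexx orbT.
apply: (@le_trans _ _ (L h + capacity W)); last first.
  rewrite -lerBrDl; apply: capacity_le => g [cg g01 g0].
  rewrite lerBrDl -LD//; apply: capacity_ge; split.
  - by move=> x; apply: cvgD; [exact: ch|exact: cg].
  - move=> x; have := f01 x; have := g01 x; rewrite /h.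
    have [fe|fe] := ltP (f x) e.
      by rewrite max_l ?add0r//; lra.
    rewrite (g0 x); last by move=> [_ /=]; rewrite ltNge fe.
    by rewrite max_r; lra.
  - move=> x Vx; rewrite g0; last by move=> [].
    have fx0 : f x = 0 by apply: f0 => -[].
    by rewrite /h fx0 addr0 max_l//; lra.
rewrite lerD//.
  rewrite -(L_cst e) -LB//; apply: L_le => //; exact: continuousB.
apply: outer_capacity_le => // x [Xx Ux]; split; first exact: XV.
by rewrite /= f0// => -[].
Qed.

Lemma borel_riesz_caratheodory (A : set (borel E)) : measurable A ->
  riesz_outer.-caratheodory A.
Proof.
apply: (@borel_induction R E (fun A => riesz_outer.-caratheodory A)).
- exact: open_riesz_caratheodory.
- by move=> B _; exact: caratheodory_measurable_setC.
- by move=> F _ _ h; exact: caratheodory_measurable_bigcup.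
Qed.

Definition riesz_measure : set (borel E) -> \bar R := riesz_outer.

Let riesz_measure0 : riesz_measure set0 = 0%E.
Proof. exact: riesz_outer0. Qed.

Let riesz_measure_ge0 A : (0 <= riesz_measure A)%E.
Proof. exact: riesz_outer_ge0. Qed.

Let riesz_measure_sigma_additive : semi_sigma_additive riesz_measure.
Proof.
move=> F mF tF mUF; apply: (@caratheodory_measure_sigma_additive R E riesz_outer) => //.
- by move=> i; exact: (borel_riesz_caratheodory (mF i)).
- exact: borel_riesz_caratheodory.
Qed.

HB.instance Definition _ := isMeasure.Build _ (borel E) R riesz_measure
  riesz_measure0 riesz_measure_ge0 riesz_measure_sigma_additive.

Let riesz_measureT : riesz_measure setT = 1%E.
Proof.
by rewrite /riesz_measure /riesz_outer outer_capacity_open ?capacity_setT//; exact: openT.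
Qed.

HB.instance Definition _ := Measure_isProbability.Build _ (borel E) R riesz_measure
  riesz_measureT.

Definition riesz_probability : probability (borel E) R := riesz_measure.

Let cont_rint f : continuous f -> rintegrable riesz_measure (f : borel E -> R).
Proof.
move=> cf; have [M fM] := continuous_bounded compactE cf.
exact: (rintegrable_bounded riesz_probability (continuous_borel cf) fM).
Qed.

(** Layer-cake argument: f is the sum of n slices of height 1 / n, the i-th of
    which vanishes where f <= i / n. Hence L f is at most the sum of the
    capacities of the sets where f > i / n, divided by n, and the
    corresponding sum of indicators exceeds f by at most 1 / n. *)
Let layer_le f n : continuous f -> (forall x, 0 <= f x <= 1) -> (0 < n)%N ->
  L f <= \int[riesz_measure]_x f x + n%:R^-1.
Proof.
move=> cf f01 n0; have n0' : 0 < n%:R :> R by rewrite ltr0n.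
pose c i x : R := Num.min (f x) (i.+1%:R / n%:R) - Num.min (f x) (i%:R / n%:R).
pose U i := [set x | i%:R / n%:R < f x].
have ile i : i%:R / n%:R <= i.+1%:R / n%:R :> R.
  by rewrite ler_pM2r ?invr_gt0// ler_nat.
have icr i : i.+1%:R / n%:R = i%:R / n%:R + n%:R^-1 :> R.
  by rewrite -natr1 mulrDl mul1r.
have oU i : open (U i).
  rewrite (_ : U i = f @^-1` [set y | i%:R / n%:R < y])//.
  by move/continuousP : cf; apply; exact: open_gt.
have cmin (r : R) : continuous (fun x => Num.min (f x) r).
  by move=> x; apply: (@continuous_min R E f (fun=> r)); [exact: cf|exact: cvg_cst].
have cc i : continuous (c i) by apply: continuousB; exact: cmin.
have sumc x : \sum_(0 <= i < n) c i x = f x.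
  rewrite /c telescope_sumr// divff ?gt_eqF// mul0r.
  by rewrite min_l ?min_r ?subr0//; have /andP[] := f01 x.
have Lc i : L (c i) <= n%:R^-1 * capacity (U i).
  rewrite mulrC ler_pdivlMr// mulrC -LZ//; apply: capacity_ge; split.
  - exact: continuousZ.
  - move=> x; have c0 : 0 <= c i x.
      by rewrite /c subr_ge0 le_min ge_min lexx/= ge_min (ile i) orbT.
    rewrite mulr_ge0 ?ler0n//= -ler_pdivlMl// mulr1.
    rewrite /c; case: (leP (f x) (i%:R / n%:R)) => h1.
      by rewrite min_l ?subrr ?invr_ge0 ?ler0n// (le_trans h1).
    by rewrite lerBlDl -icr ge_min lexx orbT.
  - move=> x /negP; rewrite -leNgt => h; rewrite /c min_l ?min_l ?subrr ?mulr0//.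
    exact: le_trans (ile i).
have mU i : measurable (U i : set (borel E)) by exact: open_borel.
have ind_int i : rintegrable riesz_measure (\1_(U i) : borel E -> R).
  by apply: (rintegrable_bounded riesz_probability (M := 1)) => [|x];
    [exact: measurable_indic|rewrite indicE; case: (_ \in _); rewrite ?normr1 ?normr0].
have capE i : capacity (U i) = \int[riesz_measure]_x \1_(U i) x.
  rewrite /Rintegral integral_indic// setIT /riesz_measure /riesz_outer /=.
  by rewrite outer_capacity_open.
apply: (@le_trans _ _ (\int[riesz_measure]_x (\sum_(0 <= i < n) n%:R^-1 * \1_(U i) x))).
  rewrite Rintegral_sum; last by move=> j; exact: rintegrableZ.
  rewrite -[in L f](funext sumc : _ = f) L_sum//; apply: ler_sum => i _.
  apply: (le_trans (Lc i)); rewrite capE le_eqVlt; apply/orP; left; apply/eqP.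
  by apply/esym/RintegralZl => //; exact: ind_int.
rewrite [X in _ <= _ + X](_ : _ = \int[riesz_measure]_x n%:R^-1); last first.
  rewrite Rintegral_cst//.
  rewrite [X in fine X](_ : _ = 1%E) ?mulr1//; exact: riesz_measureT.
rewrite -RintegralD//; last 2 first.
- exact: cont_rint.
- exact: (rintegrable_cst riesz_probability).
apply: Rintegral_le.
- by apply: rintegrable_sum => i; exact: rintegrableZ.
- apply: rintegrableD; first exact: cont_rint.
  exact: (rintegrable_cst riesz_probability).
move=> x; suff H k : \sum_(0 <= i < k) n%:R^-1 * \1_(U i) x <=
    Num.min (f x) (k%:R / n%:R) + n%:R^-1 :> R.
  by apply: (le_trans (H n)); rewrite lerD2r ge_min lexx.
have triv l : \sum_(0 <= i < l) n%:R^-1 * \1_(U i) x <= l%:R / n%:R :> R.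
  elim: l => [|l IH]; first by rewrite big_nil mul0r.
  rewrite big_nat_recr//= icr lerD//.
  by rewrite ler_piMr ?invr_ge0 ?ler0n// indicE; case: (_ \in _).
elim: k => [|k IH].
  rewrite big_nil mul0r min_r ?add0r ?invr_ge0 ?ler0n//.
  by have /andP[] := f01 x.
case: (leP (f x) (k%:R / n%:R)) => h.
  have Ux : ~ U k x by rewrite /U /= => /lt_geF; rewrite h.
  rewrite big_nat_recr//= indicE memNset//.
  rewrite mulr0 addr0 (le_trans IH)// lerD2r.
  by rewrite min_l// le_min lexx (le_trans h).
rewrite (le_trans (triv _))// icr lerD2r le_min (ltW h) /=.
by rewrite lerDl invr_ge0 ler0n.
Qed.

Let riesz_le f : continuous f -> (forall x, 0 <= f x <= 1) ->
  L f <= \int[riesz_measure]_x f x.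
Proof.
move=> cf f01; apply/ler_addgt0Pr => e e0.
have [N _ /(_ N (leqnn _))/ltW h] := near_infty_natSinv_lt (PosNum e0).
rewrite (le_trans (layer_le cf f01 (ltn0Sn N)))// lerD2l.
exact: h.
Qed.

(** The inequality riesz_le for g and for 1 - g gives the equality when 0 <= g
    <= 1; an affine change of scale brings every continuous function into that
    range. *)
Lemma riesz_integral f : continuous f -> \int[riesz_probability]_x f x = L f.
Proof.
have H g : continuous g -> (forall x, 0 <= g x <= 1) ->
    \int[riesz_measure]_x g x = L g.
  move=> cg g01; apply/eqP; rewrite eq_le riesz_le// andbT.
  have c1g : continuous (fun x => 1 - g x) by apply: continuousB.
  have : L (fun x => 1 - g x) <= \int[riesz_measure]_x (1 - g x).
    by apply: riesz_le => // x; have := g01 x; lra.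
  rewrite LB// RintegralB//; [|exact: (rintegrable_cst riesz_probability)|exact: cont_rint].
  rewrite Rintegral_cst// [X in fine X](_ : _ = 1%E) ?L_one ?mul1r; last exact: riesz_measureT.
  by rewrite /= lerD2l lerN2.
move=> cf; have [M fM] := continuous_bounded compactE cf.
have M0 : 0 <= M by apply: le_trans (fM point); exact: normr_ge0.
pose K := 2 * (M + 1); have K0 : 0 < K by rewrite mulr_gt0// ltr_wpDl.
pose g x := K^-1 * (f x + (M + 1)).
have cfM : continuous (fun x => f x + (M + 1)).
  by move=> x; apply: cvgD; [exact: cf|exact: cvg_cst].
have cg : continuous g by exact: continuousZ.
have g01 x : 0 <= g x <= 1.
  have := fM x; rewrite ler_norml => /andP[h1 h2].
  rewrite mulr_ge0 ?invr_ge0 ?(ltW K0)//=; last lra.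
  by rewrite ler_pdivrMl// mulr1 /K; lra.
have fE : f = (fun x => K * g x - (M + 1)).
  by apply/funext => x; rewrite /g mulrA divff ?gt_eqF// mul1r addrK.
rewrite [in RHS]fE LB//; last exact: continuousZ.
rewrite LZ// -(H g cg g01) L_cst.
have gi := cont_rint cg.
transitivity (\int[riesz_measure]_x (K * g x - (M + 1))).
  by congr Rintegral.
rewrite RintegralB//; last 2 first.
- exact: rintegrableZ.
- exact: (rintegrable_cst riesz_probability).
rewrite RintegralZl// Rintegral_cst//.
by rewrite [X in fine X](_ : _ = 1%E) ?mulr1//; exact: riesz_measureT.
Qed.

End riesz.

Theorem riesz_representation (R : realType) (E : pmetricType R)
    (compactE : compact [set: E]) (L : (E -> R) -> R) :
  (forall c (f g : E -> R), continuous f -> continuous g ->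
    L (fun x => c * f x + g x) = c * L f + L g) ->
  (forall f : E -> R, continuous f -> (forall x, 0 <= f x) -> 0 <= L f) ->
  L (fun=> 1) = 1 ->
  exists P : probability (borel E) R,
    forall f : E -> R, continuous f -> \int[P]_x f x = L f.
Proof.
move=> Llin Lpos L1; exists (riesz_probability compactE Llin Lpos L1) => f cf.
exact: riesz_integral.
Qed.

(** * Complex measures and total variation *)

Local Notation tv := Defs.total_variation.

Lemma le_of_eps (R : realFieldType) (a b C : R) :
  (forall e : R, 0 < e -> a <= b + C * e) -> a <= b.
Proof.
move=> H; rewrite leNgt; apply/negP => ab.
pose D := `|C| + 1; have D0 : 0 < D by rewrite ltr_wpDl.
have e0 : 0 < (a - b) / (2 * D) by rewrite divr_gt0 ?subr_gt0// mulr_gt0.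
have := H _ e0; have CD : C <= D by rewrite (le_trans (ler_norm _))// lerDl.
have : C * ((a - b) / (2 * D)) <= D * ((a - b) / (2 * D)).
  by rewrite ler_pM2r.
rewrite (_ : D * _ = (a - b) / 2); first by lra.
by field; lra.
Qed.

Lemma cvgr_sum {R : realType} {I J : Type} (F : set_system I) {FF : Filter F}
    (r : seq J) (u : J -> I -> R) (k : J -> R) :
  (forall j, u j x @[x --> F] --> k j) ->
  \sum_(j <- r) u j x @[x --> F] --> \sum_(j <- r) k j.
Proof.
move=> uk; elim: r => [|j r IH].
  by under eq_fun do rewrite big_nil; rewrite big_nil; exact: cvg_cst.
by under eq_fun do rewrite big_cons; rewrite big_cons; apply: cvgD; [exact: uk|].
Qed.

Definition csign {R : realType} (z : R[i]) : R[i] :=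
  if normc z == 0 then 1 else (normc z)^-1%:C%C * (z^*)%C.

Lemma normc_csign {R : realType} (z : R[i]) : normc (csign z) = 1.
Proof.
rewrite /csign; case: eqVneq => [_|z0]; first by rewrite normc1E.
rewrite normc_mul normc_real normc_conj ger0_norm ?invr_ge0 ?normc_ge0//.
by rewrite mulVf.
Qed.

Lemma csign_mul {R : realType} (z : R[i]) : csign z * z = (normc z)%:C%C.
Proof.
rewrite /csign; case: eqVneq => [z0|z0].
  by rewrite z0 (normc_eq0P z0) mulr0.
rewrite -mulrA (mulrC _ z) mulcJ -real_complexM; congr (_%:C)%C.
by rewrite expr2 mulrA mulVf// mul1r.
Qed.

Section functional_combinations.
Context d (T : measurableType d) {R : realType}.
Implicit Types F G : (T -> R[i]) -> R[i].

Lemma bfunctional_comb (c : R[i]) F G : bfunctional F -> bfunctional G ->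
  bfunctional (fun f => F f + c * G f).
Proof.
move=> hF hG; split=> [a f g bf bg|].
  by rewrite (bfunctional_lin hF)// (bfunctional_lin hG)//; ring.
have [[C FC] [D GD]] := (bfunctional_bounded hF, bfunctional_bounded hG).
exists (C + normc c * D) => f M bf fM; rewrite (le_trans (normc_triangle _ _))//.
rewrite mulrDl lerD ?FC// normc_mul -mulrA ler_wpM2l ?normc_ge0//.
exact: GD.
Qed.

Lemma bounded_cvg_comb (c : R[i]) F G : bounded_cvg_continuous F ->
  bounded_cvg_continuous G -> bounded_cvg_continuous (fun f => F f + c * G f).
Proof.
move=> hF hG u f M mu uM uf; apply: ccvgD; first exact: (hF u f M).
by apply: ccvgM; [exact: ccvg_cst|exact: (hG u f M)].
Qed.

(** F is tested on a combination of the disjoint indicators whose unimodular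
    coefficients turn each F (cind (A i)) into its modulus. *)
Lemma bfunctional_sum_normc F (C : R) (A : nat -> set T) n : bfunctional F ->
  (forall f M, cbm f -> (forall x, normc (f x) <= M) -> normc (F f) <= C * M) ->
  (forall i, measurable (A i)) -> trivIset setT A ->
  \sum_(0 <= i < n) normc (F (cind (A i))) <= C.
Proof.
move=> hF FC mA tA.
pose g x := \sum_(0 <= i < n) csign (F (cind (A i))) * cind (A i) x.
have cA i : cbm (cind (A i) : T -> R[i]) by exact: cbm_cind.
have bg : cbm g by apply: cbm_sum => i; exact: cbmZ.
have g1 x : normc (g x) <= 1.
  have [[k kn kx]|h] := pselect (exists2 k, (k < n)%N & A k x).
    by rewrite /g (sum_partition _ tA kn kx) normc_csign.
  rewrite /g big_nat big1 ?normc0E// => i /andP[_ iN].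
  by rewrite cind_notin ?mulr0// => Ax; apply: h; exists i.
have : normc (F g) <= C by rewrite -[C]mulr1; exact: FC.
rewrite /g bfunctional_sum//; under eq_bigr do rewrite csign_mul.
by rewrite -rmorph_sum normc_real ger0_norm ?sumr_ge0// => i _; exact: normc_ge0.
Qed.

End functional_combinations.

Section complex_measures.
Context d (T : measurableType d) {R : realType}.
Implicit Types (mu nu : cmeasure T R) (f g : T -> R[i]) (A : set T).

(** The Jordan decompositions of the real and imaginary parts make cint mu a
    combination of four integrals against finite measures, from which it
    inherits linearity, boundedness and bounded convergence. *)
Lemma cint_decomposition mu :
  exists m1 m2 m3 m4 : {finite_measure set T -> \bar R},
  (forall f, cint mu f =
     cintm m1 f + (-1) * cintm m2 f + 'i%C * (cintm m3 f + (-1) * cintm m4 f)) /\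
  (forall A, measurable A -> mu A =
     (fine (m1 A))%:C%C + (-1) * (fine (m2 A))%:C%C
     + 'i%C * ((fine (m3 A))%:C%C + (-1) * (fine (m4 A))%:C%C)).
Proof.
pose rP := projT2 (cid (projT2 (cid (Hahn_decomposition (re_charge mu))))).
pose iP := projT2 (cid (projT2 (cid (Hahn_decomposition (im_charge mu))))).
exists (jordan_pos rP), (jordan_neg rP), (jordan_pos iP), (jordan_neg iP).
split=> [f|A mA].
  by apply: complex_eq; rewrite /cint /charge_integral !(reD, imD, reM, imM)/=;
    rewrite -?/rP -?/iP; ring.
have fE (m1 m2 : {finite_measure set T -> \bar R}) (r : R) :
    r%:E = (m1 A + (-1)%:E * m2 A)%E -> r = fine (m1 A) - fine (m2 A).
  rewrite -(fineK (fin_num_measure m1 A mA)) -(fineK (fin_num_measure m2 A mA)).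
  by rewrite -EFinM -EFinD mulN1r => -[].
have hr := jordan_decomp rP mA; have hi := jordan_decomp iP mA.
have Er : complex.Re (mu A) = fine (jordan_pos rP A) - fine (jordan_neg rP A).
  by apply: fE; rewrite -[LHS]/(re_charge mu A) hr.
have Ei : complex.Im (mu A) = fine (jordan_pos iP A) - fine (jordan_neg iP A).
  by apply: fE; rewrite -[LHS]/(im_charge mu A) hi.
by apply: complex_eq; rewrite !(reD, imD, reM, imM)/= ?Er ?Ei; ring.
Qed.

Lemma cint_bfunctional mu : bfunctional (cint mu).
Proof.
have [m1 [m2 [m3 [m4 [H _]]]]] := cint_decomposition mu.
rewrite (funext H : cint mu = _).
by apply: bfunctional_comb; apply: bfunctional_comb; exact: cintm_bfunctional.
Qed.

Lemma cint_bounded_cvg mu : bounded_cvg_continuous (cint mu).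
Proof.
have [m1 [m2 [m3 [m4 [H _]]]]] := cint_decomposition mu.
rewrite (funext H : cint mu = _).
by apply: bounded_cvg_comb; apply: bounded_cvg_comb;
  exact: cintm_bounded_cvg_continuous.
Qed.

Lemma cint_cind mu A : measurable A -> cint mu (cind A) = mu A.
Proof.
move=> mA; have [m1 [m2 [m3 [m4 [-> ->//]]]]] := cint_decomposition mu.
by rewrite !cintm_cind.
Qed.

Lemma cmeasure_ext mu nu : (forall A, measurable A -> mu A = nu A) -> mu = nu.
Proof.
move=> H; apply: val_inj; apply/funext => A.
have [mA|mA] := pselect (measurable A); first exact: H.
have [/(_ A mA) h _ _] := cmeasureP mu; have [/(_ A mA) k _ _] := cmeasureP nu.
by rewrite [LHS]h [RHS]k.
Qed.

Lemma cmeasure_set0 mu : mu set0 = 0.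
Proof. by have [] := cmeasureP mu. Qed.

Lemma cmeasureD mu nu A : (mu + nu) A = mu A + nu A. Proof. by []. Qed.

Lemma cmeasureZ (c : R[i]) mu A : (c *: mu) A = c * mu A. Proof. by []. Qed.

Lemma cmeasureB mu nu A : (mu - nu) A = mu A - nu A. Proof. by []. Qed.

Lemma cint_linear (c : R[i]) mu nu f : cbm f ->
  cint (c *: mu + nu) f = c * cint mu f + cint nu f.
Proof.
have hF := bfunctional_comb c (cint_bfunctional nu) (cint_bfunctional mu).
move=> bf; rewrite [RHS]addrC.
apply: (bfunctional_ext (cint_bfunctional (c *: mu + nu)) hF _ bf) => A mA.
rewrite (cint_cind (c *: mu + nu) mA) (cint_cind mu mA) (cint_cind nu mA).
by rewrite cmeasureD cmeasureZ addrC.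
Qed.

Lemma cint_of_measure (m : {finite_measure set T -> \bar R}) f : cbm f ->
  cint (of_measure m) f = cintm m f.
Proof.
apply: bfunctional_ext => //; [exact: cint_bfunctional|exact: cintm_bfunctional|].
move=> A mA; rewrite cint_cind// cintm_cind// /= /of_measure_fun asboolT//.
Qed.

Definition variation_sums mu := [set s | exists (A : (set T)^nat) (n : nat),
    [/\ forall i, measurable (A i), trivIset setT A
      & s = \sum_(0 <= i < n) normc (mu (A i))]].

Lemma variation_has_sup mu : has_sup (variation_sums mu).
Proof.
split; first by exists 0, (fun=> set0), 0%N; split => //; [exact: trivIset_set0|rewrite big_nil].
have [C HC] := bfunctional_bounded (cint_bfunctional mu).
exists C => _ [A [n [mA tA ->]]].
have := bfunctional_sum_normc n (cint_bfunctional mu) HC mA tA.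
by under eq_bigr do rewrite cint_cind//.
Qed.

Lemma variation_ge mu (A : nat -> set T) n : (forall i, measurable (A i)) ->
  trivIset setT A -> \sum_(0 <= i < n) normc (mu (A i)) <= tv mu.
Proof.
move=> mA tA; apply: sup_upper_bound; first exact: variation_has_sup.
by exists A, n.
Qed.

Lemma variation_le mu (c : R) :
  (forall (A : nat -> set T) (n : nat), (forall i, measurable (A i)) -> trivIset setT A ->
    \sum_(0 <= i < n) normc (mu (A i)) <= c) -> tv mu <= c.
Proof.
move=> H; apply: ge_sup; first by have [] := variation_has_sup mu.
by move=> _ [A [n [mA tA ->]]]; exact: H.
Qed.

Lemma variation_le_functional mu (F : (T -> R[i]) -> R[i]) (C : R) : bfunctional F ->
  (forall A, measurable A -> F (cind A) = mu A) ->
  (forall f M, cbm f -> (forall x, normc (f x) <= M) -> normc (F f) <= C * M) ->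
  tv mu <= C.
Proof.
move=> hF Fmu FC; apply: variation_le => A n mA tA.
have := bfunctional_sum_normc n hF FC mA tA.
by under eq_bigr do rewrite Fmu//.
Qed.

Lemma variation_nneg mu : 0 <= tv mu.
Proof.
have := @variation_ge mu (fun=> set0) 0%N; rewrite big_nil; apply => //.
exact: trivIset_set0.
Qed.

Lemma normc_cmeasure_le mu A : measurable A -> normc (mu A) <= tv mu.
Proof.
move=> mA; pose B (i : nat) := if i == 0%N then A else set0.
have := @variation_ge mu B 1%N; rewrite big_nat1; apply.
- by move=> i; rewrite /B; case: ifP.
- by apply/trivIsetP => -[|i] [|j]//= _ _ _; rewrite /B /= ?setI0 ?set0I.
Qed.

(** For a simple function the bound is the definition of the total variation;
    uniform approximation gives the general case. *)
Lemma normc_cint_le mu f (M : R) : cbm f -> (forall x, normc (f x) <= M) ->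
  normc (cint mu f) <= tv mu * M.
Proof.
move=> bf fM; have hF := cint_bfunctional mu.
have [C HC] := bfunctional_bounded hF.
apply: (@le_of_eps _ _ _ (tv mu + C)) => e e0.
have [mf _] := bf.
have [N [c [A [mA tA covA fc]]]] := simple_partition mf fM e0.
pose g x := \sum_(0 <= i < N) c i * cind (A i) x.
have bg : cbm g by apply: cbm_sum => i; exact/cbmZ/cbm_cind.
have fg x : normc (f x - g x) <= e.
  by have [k kN kx] := covA x; rewrite /g (sum_partition c tA kN kx) fc.
have -> : cint mu f = cint mu (fun x => f x - g x) + cint mu g.
  by rewrite (bfunctionalB hF)// subrK.
rewrite (le_trans (normc_triangle _ _))//.
have h1 : normc (cint mu (fun x => f x - g x)) <= C * e by apply: HC => //; exact: cbmB.
suff h2 : normc (cint mu g) <= tv mu * (M + e) by lra.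
rewrite /g (bfunctional_sum hF); last by move=> i; exact: cbm_cind.
rewrite (le_trans (normc_sum _ _ _))// mulrC.
have M0 : 0 <= M by rewrite (le_trans _ (fM point))// normc_ge0.
apply: (@le_trans _ _ (\sum_(0 <= i < N) (M + e) * normc (mu (A i)))).
  apply: ler_sum => i _; rewrite normc_mul cint_cind//.
  have [[x Ax]|Ax] := pselect (A i !=set0).
    rewrite ler_wpM2r ?normc_ge0//.
    rewrite (_ : c i = f x - (f x - c i)); last by ring.
    by rewrite (le_trans (normc_triangle _ _))// normc_opp lerD// fc.
  have -> : A i = set0 by apply/seteqP; split=> // x Ax'; apply: Ax; exists x.
  by rewrite cmeasure_set0 normc0E !mulr0.
rewrite -mulr_sumr ler_wpM2l ?addr_ge0 ?(ltW e0)//.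
exact: variation_ge.
Qed.

Lemma variation_eq0 mu : tv mu = 0 -> mu = 0.
Proof.
move=> mu0; apply: cmeasure_ext => A mA.
apply: normc_eq0P; apply/eqP; rewrite eq_le normc_ge0 andbT -mu0.
exact: normc_cmeasure_le.
Qed.

Lemma variation_triangle mu nu :
  tv (mu + nu) <= tv mu + tv nu.
Proof.
apply: variation_le => A n mA tA.
apply: (@le_trans _ _ (\sum_(0 <= i < n) (normc (mu (A i)) + normc (nu (A i))))).
  by apply: ler_sum => i _; rewrite cmeasureD normc_triangle.
by rewrite big_split/= lerD// variation_ge.
Qed.

Lemma variationZ_le (c : R[i]) mu :
  tv (c *: mu) <= normc c * tv mu.
Proof.
apply: variation_le => A n mA tA.
under eq_bigr do rewrite cmeasureZ normc_mul.
by rewrite -mulr_sumr ler_wpM2l ?normc_ge0// variation_ge.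
Qed.

Lemma variationZ (c : R[i]) mu :
  tv (c *: mu) = normc c * tv mu.
Proof.
apply/eqP; rewrite eq_le variationZ_le/=.
have [->|c0] := eqVneq c 0; first by rewrite normc0E mul0r variation_nneg.
have nc0 : 0 < normc c.
  rewrite lt_neqAle normc_ge0 andbT eq_sym.
  by apply: contra_neq c0; exact: normc_eq0P.
rewrite -ler_pdivlMl//.
rewrite -[in leLHS](scale1r mu) -(mulVf c0) -scalerA.
rewrite (le_trans (variationZ_le _ _))// ler_wpM2r ?variation_nneg//.
have : normc c^-1 * normc c = 1 by rewrite -normc_mul mulVf// normc1E.
by move=> h; rewrite -[leRHS]mul1r -h mulfK// gt_eqF.
Qed.

Lemma ccauchy_cvg (u : nat -> R[i]) :
  (forall e : R, 0 < e -> exists N, forall i j, (N <= i)%N -> (N <= j)%N ->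
    normc (u i - u j) < e) ->
  exists l, (u : nat -> (R[i])^o) @ \oo --> (l : (R[i])^o).
Proof.
move=> H.
have C (h : R[i] -> R) : (forall z w, h (z - w) = h z - h w) ->
    (forall z, `|h z| <= normc z) -> exists l : R, h (u n) @[n --> \oo] --> l.
  move=> hB hn; apply/(@cvg_ex R^o)/cauchy_cvgP/cauchy_exP => e e0.
  have [N HN] := H e e0; exists (h (u N)); exists N => //= n /= Nn.
  by rewrite /ball/= -hB (le_lt_trans (hn _))//; exact: HN.
have [lr hr] := C (@complex.Re R) (fun z w => etrans (reD _ _) (congr1 _ (reN w))) abs_Re_le.
have [li hi] := C (@complex.Im R) (fun z w => etrans (imD _ _) (congr1 _ (imN w))) abs_Im_le.
by exists (lr +i* li)%C; apply/ccvgP.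
Unshelve. all: by end_near. Qed.

(** A Cauchy sequence converges on every set. The convergence is uniform over
    finite disjoint families, which makes the limit countably additive and the
    convergence hold in variation. *)
Lemma variation_complete (u : nat -> cmeasure T R) :
  (forall eps : R, 0 < eps -> exists N, forall i j, (N <= i)%N -> (N <= j)%N ->
     tv (u i - u j) < eps) ->
  exists l, tv (u n - l) @[n --> \oo] --> (0 : R).
Proof.
move=> H.
have /choice[l Hl] (A : set T) : exists l, 
    ((fun n => u n A) : nat -> (R[i])^o) @ \oo --> (l : (R[i])^o).
  have [mA|nA] := pselect (measurable A); last first.
    exists 0; rewrite (_ : (fun n => u n A) = (fun=> 0)); first exact: ccvg_cst.
    by apply/funext => n; have [/(_ A nA)] := cmeasureP (u n).
  apply: ccauchy_cvg => e /H[N HN]; exists N => i j Ni Nj.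
  by rewrite -cmeasureB (le_lt_trans (normc_cmeasure_le _ mA))// HN.
have unif (e : R) : 0 < e -> exists N, forall k, (N <= k)%N ->
    forall (F : nat -> set T) n, (forall i, measurable (F i)) -> trivIset setT F ->
    \sum_(0 <= i < n) normc (u k (F i) - l (F i)) <= e.
  move=> /H[N HN]; exists N => k Nk F n mF tF.
  have : \sum_(0 <= i < n) normc (u k (F i) - u j (F i)) @[j --> \oo]
      --> \sum_(0 <= i < n) normc (u k (F i) - l (F i)).
    apply: cvgr_sum => i.
    apply: ccvg_normc; apply: ccvgB; [exact: ccvg_cst|exact: Hl].
  move=> /ler_cvg_to/(_ (cvg_cst e)); apply.
  near=> j; apply: ltW; apply: (@le_lt_trans _ _ (tv (u k - u j))).
    exact: (@variation_ge (u k - u j) F n mF tF).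
  apply: HN => //; near: j; exact: nbhs_infty_ge.
have lc : is_cmeasure l.
  split.
  - move=> A nA; apply: (ccvg_unique (Hl A)).
    rewrite (_ : (fun n => u n A) = (fun=> 0)); first exact: ccvg_cst.
    by apply/funext => n; have [/(_ A nA)] := cmeasureP (u n).
  - apply: (ccvg_unique (Hl set0)).
    rewrite (_ : (fun n => _) = (fun=> 0)); first exact: ccvg_cst.
    by apply/funext => n; rewrite cmeasure_set0.
  - move=> F mF tF; apply/ccvg_normcP/cvgrPdist_le => e e0.
    have e3 : 0 < e / 3 by rewrite divr_gt0.
    have [N /(_ N (leqnn N)) HN] := unif _ e3.
    have mU : measurable (\bigcup_i F i) by exact: bigcupT_measurable.
    have one : normc (u N (\bigcup_i F i) - l (\bigcup_i F i)) <= e / 3.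
      pose B (i : nat) := if i == 0%N then \bigcup_i F i else set0.
      have := HN B 1%N; rewrite big_nat1; apply.
      + by move=> i; rewrite /B; case: ifP.
      + by apply/trivIsetP => -[|i] [|j]//= _ _ _; rewrite /B /= ?setI0 ?set0I.
    have [_ _ /(_ F mF tF) uN] := cmeasureP (u N).
    have /ccvg_normcP/cvgrPdist_le/(_ _ e3) := uN.
    apply: filterS => n; rewrite !sub0r !normrN !ger0_norm ?normc_ge0// => h.
    have -> : \sum_(0 <= i < n) l (F i) - l (\bigcup_i F i) =
      - (\sum_(0 <= i < n) (u N (F i) - l (F i))) +
      (\sum_(0 <= i < n) u N (F i) - u N (\bigcup_i F i)) +
      (u N (\bigcup_i F i) - l (\bigcup_i F i)).
      by rewrite sumrB; ring.
    rewrite (_ : e = e / 3 + e / 3 + e / 3); last by field.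
    rewrite (le_trans (normc_triangle _ _))// lerD//.
    rewrite (le_trans (normc_triangle _ _))// lerD// normc_opp.
    by rewrite (le_trans (normc_sum _ _ _))// HN.
pose lm := CMeasure (introT (cmeasure_predP l) lc).
exists lm; apply/cvgrPdist_le => e e0; have [N HN] := unif e e0.
near=> k; rewrite sub0r normrN ger0_norm ?variation_nneg//.
apply: variation_le => A n mA tA; apply: HN => //.
by near: k; exact: nbhs_infty_ge.
Unshelve. all: by end_near. Qed.

End complex_measures.

(** * Kernel operators of the semigroup *)

(** Kernel of the transition measures with the sign that a density only has up
    to null sets. *)
Record symmetric_kernel {R : realType} (E : pmetricType R)
    (m : {finite_measure set (borel E) -> \bar R})
    (p : R -> E -> subprobability (borel E) R) (k : R -> E -> E -> R) : Prop := {
  sk_measurable : forall t : R, 0 < t ->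
    measurable_fun setT (fun z : borel E * borel E => k t z.1 z.2) ;
  sk_ge0 : forall t x y, 0 <= k t x y ;
  sk_bounded : forall t : R, 0 < t -> exists M : R, forall x y, k t x y <= M ;
  sk_sym : forall (t : R) x y, 0 < t -> k t x y = k t y x ;
  sk_density : forall (t : R) x (A : set (borel E)), 0 < t -> measurable A ->
    p t x A = (\int[m]_(y in A) (k t x y)%:E)%E
}.

(** The set where dens t x is negative has nonnegative mass for p t x, and
    this mass is the integral of a negative function, so it vanishes; the
    positive part of the density therefore defines the same measures. *)
Lemma symmetric_kernel_of_density {R : realType} (E : pmetricType R)
    (m : {finite_measure set (borel E) -> \bar R})
    (p : R -> E -> subprobability (borel E) R) (dens : R -> E -> E -> R) :
  (forall t : R, 0 < t ->
      measurable_fun setT (fun z : borel E * borel E => dens t z.1 z.2)) ->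
  (forall t : R, 0 < t -> exists M : R, forall x y, `|dens t x y| <= M) ->
  (forall (t : R) x y, 0 < t -> dens t x y = dens t y x) ->
  (forall (t : R) x (A : set (borel E)), 0 < t -> measurable A ->
      p t x A = (\int[m]_(y in A) (dens t x y)%:E)%E) ->
  symmetric_kernel m p (fun t x y => Num.max (dens t x y) 0).
Proof.
move=> dm db ds dE; split.
- by move=> t t0; apply: measurable_maxr; [exact: dm|exact: measurable_cst].
- by move=> t x y; rewrite le_max lexx orbT.
- move=> t t0; have [M HM] := db t t0; exists M => x y.
  by rewrite ge_max (le_trans (ler_norm _) (HM x y))/= (le_trans _ (HM x y)).
- by move=> t x y t0; rewrite ds.
move=> t x A t0 mA; pose N : set (borel E) := [set y | dens t x y < 0].
have md : measurable_fun setT (fun y : borel E => dens t x y).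
  exact: (@measurable_fun_pair2 _ _ _ (borel E) (borel E) _
    (fun z : borel E * borel E => dens t z.1 z.2) x (dm t t0)).
have mN : measurable N.
  rewrite -[N]setTI; have := md measurableT _ (measurable_itv `]-oo, 0[).
  by rewrite set_itvE.
have pN : p t x N = 0%E.
  apply/eqP; rewrite eq_le measure_ge0 andbT dE// integralE.
  rewrite [X in (X - _)%E](_ : _ = 0%E); last first.
    apply: integral0_eq => y; rewrite /N /= funeposE => /ltW Ny.
    by rewrite max_r// lee_fin.
  by rewrite add0e oppe_le0; apply: integral_ge0 => y _; exact: funeneg_ge0.
have pA : p t x A = p t x (A `&` ~` N).
  rewrite [in LHS](_ : A = (A `&` ~` N) `|` (A `&` N)); last first.
    by rewrite -setIUr setvU setIT.
  rewrite measureU//; last 3 first.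
  - by apply: measurableI => //; exact: measurableC.
  - exact: measurableI.
  - by rewrite setIACA setICl setI0.
  rewrite [X in (_ + X)%E](_ : _ = 0%E) ?adde0//.
  apply/eqP; rewrite eq_le measure_ge0 andbT -pN.
  by apply: le_measure; rewrite ?inE//; exact: measurableI.
rewrite pA dE//; last by apply: measurableI => //; exact: measurableC.
rewrite integral_mkcondr; apply: eq_integral => y _.
rewrite patchE; case: ifPn => [/set_mem /= h|/negP h].
  by rewrite max_l// leNgt; apply/negP.
by rewrite max_r//; apply/ltW; apply: contrapT => h'; apply: h; rewrite inE.
Qed.

Section kernel_operator.
Context {R : realType} {E : pmetricType R}.
Hypothesis compactE : compact [set: E].
Local Notation BE := (borel E).
Variable T : R -> (E -> R[i]) -> (E -> R[i]).
Variable p : R -> E -> subprobability BE R.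
Hypothesis fellerT : feller_semigroup T.
Hypothesis kernelT : transition_kernel T p.
Variable m : {finite_measure set BE -> \bar R}.
Variable k : R -> E -> E -> R.
Hypothesis sk : symmetric_kernel m p k.
Implicit Types (f g : BE -> R[i]) (t : R).

Lemma ccontinuous_C0 (f : E -> R[i]) : ccontinuous f -> C0 f.
Proof. by move=> cf; split => // e e0; exists setT => // x []. Qed.

Definition kop t f : E -> R[i] := fun x => cintm m (fun y => (k t x y)%:C%C * f y).

Lemma kopE t f x : kop t f x = cintm m (fun y => (k t x y)%:C%C * f y).
Proof. by []. Qed.

Lemma kernel_row_measurable t x : 0 < t ->
  measurable_fun setT (fun y : BE => k t x y).
Proof.
move=> t0; exact: (@measurable_fun_pair2 _ _ _ BE BE _
  (fun z : BE * BE => k t z.1 z.2) x (sk_measurable sk t0)).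
Qed.

Lemma kernel_abs_bounded t : 0 < t -> exists2 M : R, 0 <= M &
  forall x y, `|k t x y| <= M.
Proof.
move=> t0; have [M HM] := sk_bounded sk t0.
exists M; first exact: le_trans (sk_ge0 sk t point point) (HM _ _).
by move=> x y; rewrite ger0_norm// (sk_ge0 sk).
Qed.

Lemma kernel_row_cbm t x : 0 < t -> cbm (fun y : BE => (k t x y)%:C%C).
Proof.
move=> t0; have [M _ HM] := kernel_abs_bounded t0.
exact: (cbm_real (kernel_row_measurable x t0) (HM x)).
Qed.

Lemma kernel_row_sqint t x : 0 < t -> sqint m (fun y : BE => (k t x y)%:C%C).
Proof. by move=> t0; apply: cbm_sqint; exact: kernel_row_cbm. Qed.

Lemma kernel_row_sqn t : 0 < t -> exists2 K : R, 0 <= K &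
  forall x, sqn m (fun y : BE => (k t x y)%:C%C) <= K.
Proof.
move=> t0; have [M _ HM] := kernel_abs_bounded t0.
exists (M ^+ 2 * fine (m setT)); first by rewrite mulr_ge0 ?sqr_ge0 ?fine_ge0.
move=> x; apply: sqn_bounded; first by case: (kernel_row_cbm x t0).
by move=> y; rewrite normc_real.
Qed.

Lemma kop_integrable t f x : 0 < t -> sqint m f ->
  cintegrable m (fun y => (k t x y)%:C%C * f y).
Proof. by move=> t0 fi; apply: cintegrable_mul => //; exact: kernel_row_sqint. Qed.

Lemma kop_lin t (c : R[i]) f g : 0 < t -> sqint m f -> sqint m g ->
  kop t (fun x => c * f x + g x) = (fun x => c * kop t f x + kop t g x).
Proof.
move=> t0 fi gi; apply/funext => x; rewrite /kop -cintmZ; last exact: kop_integrable.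
rewrite -cintmD; [|by apply: cintegrableZ; exact: kop_integrable|exact: kop_integrable].
by congr cintm; apply/funext => y; ring.
Qed.

Lemma kopB t f g : 0 < t -> sqint m f -> sqint m g ->
  kop t (fun x => f x - g x) = (fun x => kop t f x - kop t g x).
Proof.
move=> t0 fi gi.
rewrite (_ : (fun x => f x - g x) = (fun x => -1 * g x + f x)); last first.
  by apply/funext => x; ring.
by rewrite kop_lin//; apply/funext => x; ring.
Qed.

Lemma ae_eq_kop t f g : 0 < t -> cmeasurable f -> cmeasurable g ->
  ae_eq m setT f g -> kop t f = kop t g.
Proof.
move=> t0 mf mg fg; apply/funext => x; apply: ae_eq_cintm.
- by apply: cmeasurableM => //; case: (kernel_row_cbm x t0).
- by apply: cmeasurableM => //; case: (kernel_row_cbm x t0).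
- by apply: filterS fg => y h yT; rewrite h.
Qed.

Lemma kop_bound t f K x : 0 < t -> sqint m f ->
  sqn m (fun y : BE => (k t x y)%:C%C) <= K ->
  normc (kop t f x) ^+ 2 <= K * sqn m f.
Proof.
move=> t0 fi HK; rewrite (le_trans (cauchy_schwarz (kernel_row_sqint x t0) fi))//.
by rewrite ler_wpM2r ?sqn_ge0.
Qed.

Lemma kernel_integral_bounded t f x : 0 < t -> cbm f ->
  cintm (p t x) f = kop t f x.
Proof.
move=> t0 bf.
apply: (@bfunctional_ext _ _ _ (cintm (p t x)) (fun g => kop t g x) _ _ _ f bf).
- exact: cintm_bfunctional.
- split=> [c g h bg bh|].
    by rewrite (kop_lin c t0 (cbm_sqint m bg) (cbm_sqint m bh)).
  have [M M0 HM] := kernel_abs_bounded t0.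
  exists (M * fine (m setT)) => g N bg gN; rewrite mulrAC.
  apply: normc_cintm_bounded; first by apply: cbmM => //; exact: kernel_row_cbm.
  by move=> y; rewrite normc_mul normc_real ler_pM ?normc_ge0.
- move=> A mA; rewrite cintm_cind// /kop.
  rewrite [in LHS](_ : fine _ = fine (\int[m]_(y in A) (k t x y)%:E)%E); last first.
    by congr fine; exact: (sk_density sk).
  rewrite [in RHS](_ : (fun y => _) = (fun y => (k t x y * \1_A y)%:C%C)); last first.
    by apply/funext => y; rewrite /cind real_complexM.
  rewrite cintm_real; congr (_%:C)%C; rewrite /Rintegral; congr fine.
  rewrite [LHS]integral_mkcond; apply: eq_integral => y _.
  by rewrite patchE indicE; case: ifP => _; rewrite ?mulr1 ?mulr0.
Qed.

Lemma kop_continuous_eq t (f : E -> R[i]) : 0 < t -> ccontinuous f ->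
  kop t f = T t f.
Proof.
move=> t0 cf; apply/funext => x; rewrite (kernelT x (ltW t0) (ccontinuous_C0 cf)).
by rewrite kernel_integral_bounded//; exact: ccontinuous_cbm.
Qed.

(** By Cauchy-Schwarz on the rows of the kernel, kop t f is the uniform limit
    of the functions T t g for continuous g close to f in L^2. *)
Lemma kop_continuous t f : 0 < t -> sqint m f -> ccontinuous (kop t f).
Proof.
move=> t0 fi; apply: ccontinuous_uniform_limit => e e0.
have [K K0 HK] := kernel_row_sqn t0.
have K1 : 0 < K + 1 by rewrite ltr_wpDl.
have [g cg fg] := L2approx_sqint compactE fi (divr_gt0 (exprn_gt0 2 e0) K1).
have gi : sqint m (g : BE -> R[i]) by apply: cbm_sqint; exact: ccontinuous_cbm.
exists (T t g).
  by have [] := feller_C0 fellerT (ltW t0) (ccontinuous_C0 cg).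
move=> x; rewrite -kop_continuous_eq//.
have -> : kop t f x - kop t g x = kop t (fun x => f x - g x) x by rewrite kopB.
rewrite -ler_sqr ?nnegrE ?normc_ge0 ?(ltW e0)//.
rewrite (le_trans (kop_bound t0 (sqintB fi gi) (HK x)))//.
rewrite (le_trans (ler_wpM2l K0 fg))// mulrCA ler_piMr ?sqr_ge0//.
by rewrite ler_pdivrMr// mul1r lerDl.
Qed.

Lemma kop_sqint t f : 0 < t -> sqint m f -> sqint m (kop t f).
Proof.
by move=> t0 fi; apply: cbm_sqint; apply: ccontinuous_cbm => //; exact: kop_continuous.
Qed.

Lemma kernel_row_integral_le1 t x : 0 < t -> \int[m]_y k t x y <= 1.
Proof.
move=> t0; rewrite /Rintegral -(sk_density sk)//.
have := @sprobability_setT _ _ _ (p t x).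
by rewrite -{1}(fineK (fin_num_measure (p t x) setT measurableT)) lee_fin.
Qed.

(** Jensen's inequality for the subprobability measure with density k t x. *)
Lemma kop_jensen t f x : 0 < t -> sqint m f ->
  normc (kop t f x) ^+ 2 <= \int[m]_y (k t x y * normc (f y) ^+ 2).
Proof.
move=> t0 fi; have [mf fi2] := fi.
have [M M0 HM] := kernel_abs_bounded t0.
have kf2 : rintegrable m (fun y : BE => k t x y * normc (f y) ^+ 2).
  apply: (rintegrable_le _ (rintegrableZ M fi2)).
  - by apply: measurable_funM; [exact: kernel_row_measurable|exact: measurable_normc2].
  - by move=> y; rewrite normrM ler_pM// ger0_norm ?sqr_ge0.
have ki : rintegrable m (fun y : BE => k t x y).
  exact: (rintegrable_bounded m (kernel_row_measurable x t0) (HM x)).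
rewrite -[leRHS]mul1r; apply: quadratic_bound.
- exact: normc_ge0.
- exact: ler01.
- by apply: Rintegral_nneg => y; rewrite mulr_ge0 ?sqr_ge0// (sk_ge0 sk).
move=> c c0; have kfi := kop_integrable x t0 fi.
apply: (@le_trans _ _ (2 * \int[m]_y normc ((k t x y)%:C%C * f y))).
  by rewrite ler_pM2l// normc_cintm.
apply: (@le_trans _ _ (c * \int[m]_y k t x y
    + c^-1 * \int[m]_y (k t x y * normc (f y) ^+ 2))); last first.
  by rewrite lerD2r ler_pM2l// kernel_row_integral_le1.
have nki := cintegrable_normc kfi.
rewrite -!RintegralZl// -RintegralD//; try exact: rintegrableZ.
apply: Rintegral_le.
- exact: rintegrableZ.
- by apply: rintegrableD; exact: rintegrableZ.
move=> y; rewrite normc_mul normc_real ger0_norm ?(sk_ge0 sk)// -subr_ge0.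
rewrite (_ : _ - _ = c * k t x y * (1 - c^-1 * normc (f y)) ^+ 2).
  by rewrite mulr_ge0 ?sqr_ge0// mulr_ge0 ?(sk_ge0 sk)// ltW.
by field; lra.
Qed.

(** Jensen's inequality is integrated in x; the columns of the kernel, which
    are its rows by symmetry, have mass at most one. *)
Lemma kop_contraction t f : 0 < t -> sqint m f -> sqn m (kop t f) <= sqn m f.
Proof.
move=> t0 fi; have [mf fi2] := fi.
have Pfi := kop_sqint t0 fi; have [mPf Pfi2] := Pfi.
have [M M0 HM] := kernel_abs_bounded t0.
pose F (z : BE * BE) := (k t z.1 z.2 * normc (f z.2) ^+ 2)%:E.
have mF : measurable_fun setT F.
  apply/measurable_EFinP; apply: measurable_funM; first exact: (sk_measurable sk).
  by apply: (measurableT_comp (measurable_normc2 mf)); exact: measurable_snd.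
have F0 z : (0 <= F z)%E by rewrite lee_fin mulr_ge0 ?sqr_ge0// (sk_ge0 sk).
have kf2 x : rintegrable m (fun y : BE => k t x y * normc (f y) ^+ 2).
  apply: (rintegrable_le _ (rintegrableZ M fi2)).
  - by apply: measurable_funM; [exact: kernel_row_measurable|exact: measurable_normc2].
  - by move=> y; rewrite normrM ler_pM// ger0_norm ?sqr_ge0.
rewrite -lee_fin -(RintegralE Pfi2) -(RintegralE fi2).
apply: (@le_trans _ _ (\int[m]_x \int[m]_y F (x, y))%E).
  apply: ge0_le_integral => //.
  - by move=> x _; rewrite lee_fin sqr_ge0.
  - by apply/measurable_EFinP; exact: measurable_normc2.
  - exact: (@measurable_fun_fubini_tonelli_F _ _ BE BE R m F mF F0).
  - by move=> x _; rewrite /F /= RintegralE// lee_fin; exact: kop_jensen.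
rewrite (@fubini_tonelli _ _ BE BE R m m F mF F0).
apply: ge0_le_integral => //.
- by move=> y _; apply: integral_ge0 => x _.
- exact: (@measurable_fun_fubini_tonelli_G _ _ BE BE R m F mF F0).
- by apply/measurable_EFinP; exact: measurable_normc2.
move=> y _; rewrite /F /=.
rewrite (_ : (fun x => _) = (fun x => ((normc (f y) ^+ 2) * k t y x)%:E)); last first.
  by apply/funext => x; rewrite mulrC (sk_sym sk)//.
have ki : rintegrable m (fun x : BE => k t y x).
  exact: (rintegrable_bounded m (kernel_row_measurable y t0) (HM y)).
rewrite RintegralE; last exact: rintegrableZ.
rewrite lee_fin RintegralZl// ler_piMr ?sqr_ge0//.
exact: kernel_row_integral_le1.
Qed.

(** If the integral of g vanishes then so does T t g for t > 0, and T t g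
    converges to g as t tends to 0. Thus m charges every nonempty open set. *)
Lemma continuous_integral0 (g : E -> R) : continuous g -> (forall x, 0 <= g x) ->
  \int[m]_x g x = 0 -> forall x, g x = 0.
Proof.
move=> cg g0 Ig x.
have cgC : ccontinuous (fun x => (g x)%:C%C) by exact: ccontinuous_real.
have [G gG] := continuous_bounded compactE cg.
have gi : rintegrable m (g : BE -> R).
  exact: (rintegrable_bounded m (continuous_borel cg) gG).
have T0 t : 0 < t -> T t (fun x => (g x)%:C%C) = (fun=> 0).
  move=> t0; rewrite -kop_continuous_eq//; apply/funext => y.
  have [M M0 HM] := kernel_abs_bounded t0.
  apply: normc_eq0P; apply/eqP; rewrite eq_le normc_ge0 andbT.
  rewrite -(mulr0 M) -Ig -RintegralZl//.
  have kgi := kop_integrable y t0 (cbm_sqint m (ccontinuous_cbm compactE cgC)).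
  rewrite (le_trans (normc_cintm kgi))//; apply: Rintegral_le.
  - exact: cintegrable_normc.
  - exact: rintegrableZ.
  - move=> z; rewrite normc_mul !normc_real (ger0_norm (g0 z)).
    by rewrite ler_wpM2r.
have /cvgrPdist_le H := feller_continuous fellerT (ccontinuous_C0 cgC).
apply: (@eq0_le_eps _ _ 1) => // e e0; rewrite mul1r.
have [d /= d0 Hd] := H e e0.
have d2 : 0 < d / 2 by rewrite divr_gt0.
have := Hd (d / 2); rewrite /= sub0r normrN ger0_norm ?(ltW d2)//.
rewrite ltr_pdivrMr// mulr2n mulrDr mulr1 ltrDl d0 => /(_ isT d2).
rewrite (T0 _ d2) sub0r normrN => h; apply: le_trans h.
apply: le_trans (ler_norm _); apply: sup_upper_bound; last first.
  by exists x => //; rewrite sub0r normc_opp normc_real ger0_norm.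
split; first by exists (normc (0 - (g x)%:C%C)), x.
exists G => _ [y _ <-]; rewrite sub0r normc_opp normc_real.
exact: gG.
Qed.

Lemma continuous_ae_eq (f g : E -> R[i]) : ccontinuous f -> ccontinuous g ->
  ae_eq m setT f g -> f = g.
Proof.
move=> cf cg fg; apply/funext => x.
have cfg : ccontinuous (fun x => f x - g x) by exact: ccontinuousB.
have cn : continuous (fun x => normc (f x - g x)).
  by move=> y; apply: ccvg_normc; exact: cfg.
apply/eqP; rewrite -subr_eq0; apply/eqP/normc_eq0P.
apply: (continuous_integral0 cn); first by move=> y; exact: normc_ge0.
transitivity (\int[m]_x (cst 0 x : R)); last by rewrite Rintegral_cst// mul0r.
apply: ae_eq_Rintegral => //.
- by apply: measurable_normc; exact: ccontinuous_borel.
- by apply: filterS fg => y h yT; rewrite h// subrr normc0E.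
Qed.

Lemma strong_feller_kernel : strong_feller T p.
Proof.
split => // t f t0 [mf bf].
have fb : cbm (f : BE -> R[i]) by [].
have -> : (fun x => cintm (p t x) f) = kop t f.
  by apply/funext => x; rewrite kernel_integral_bounded.
have ck : ccontinuous (kop t f) by apply: kop_continuous => //; exact: cbm_sqint.
by split => //; exact: ccontinuous_cbounded.
Qed.

Section L2_extension.
Variable T2 : R -> (E -> R[i]) -> (E -> R[i]).
Hypothesis semigroupT2 : L2_semigroup m T2.
Hypothesis extT2 : forall (t : R) f, 0 <= t -> C0 f -> ae_eq m setT (T2 t f) (T t f).

Lemma T2_sqint t f : 0 <= t -> sqint m f -> sqint m (T2 t f).
Proof. by move=> t0 /L2P fi; apply/L2P; exact: (L2_semigroup_L2 semigroupT2). Qed.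

Lemma T2_bounded t : 0 <= t -> exists M : R, forall f, sqint m f ->
  sqn m (T2 t f) <= M ^+ 2 * sqn m f.
Proof.
move=> t0; have [M HM] := L2_semigroup_bounded semigroupT2 t0.
exists M => f fi; have T2i := T2_sqint t0 fi.
rewrite -!L2norm_sqr// -exprMn.
have h := HM f ((L2P m f).2 fi); have := L2norm_ge0 m (T2 t f).
move: h; move: (L2norm m (T2 t f)) (M * _) => a b ab a0; nra.
Qed.

(** Both operators are bounded on L^2 and agree on the continuous functions,
    which are dense. *)
Lemma T2_kop t f : 0 < t -> sqint m f -> ae_eq m setT (T2 t f) (kop t f).
Proof.
move=> t0 fi; have T2f := T2_sqint (ltW t0) fi; have kf := kop_sqint t0 fi.
have [M HM] := T2_bounded (ltW t0).
suff : sqn m (fun x => T2 t f x - kop t f x) = 0.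
  move=> /(sqn_eq0_ae (sqintB T2f kf)); apply: filterS => x h xT.
  by apply/eqP; rewrite -subr_eq0; apply/eqP; exact: h.
apply: (@eq0_le_eps _ _ (2 * M ^+ 2 + 2)); first exact: sqn_ge0.
move=> e e0; have [g cg fg] := L2approx_sqint compactE fi e0.
have gi : sqint m (g : BE -> R[i]) by apply: cbm_sqint; exact: ccontinuous_cbm.
have fgi := sqintB fi gi; have gfi := sqintB gi fi.
have T2fg := T2_sqint (ltW t0) fgi; have kgf := kop_sqint t0 gfi.
have T2g := T2_sqint (ltW t0) gi.
have Tlin := L2_semigroup_linear semigroupT2 (-1) (ltW t0)
  ((L2P m g).2 gi) ((L2P m f).2 fi).
have Text := extT2 (ltW t0) (ccontinuous_C0 cg).
have -> : sqn m (fun x => T2 t f x - kop t f x) =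
    sqn m (fun x => T2 t (fun x => f x - g x) x + kop t (fun x => g x - f x) x).
  apply: ae_eq_sqn.
  - by case: (sqintB T2f kf).
  - by case: (sqintD T2fg kgf).
  move: Tlin; rewrite (_ : (fun x => -1 * g x + f x) = (fun x => f x - g x)); last first.
    by apply/funext => x; ring.
  move=> Tlin; apply: filterS2 Tlin Text => x h1 h2 xT.
  rewrite h1// kopB//= h2// (kop_continuous_eq t0 cg); ring.
rewrite (le_trans (sqnD2 T2fg kgf))// [leRHS]mulrDl lerD//.
  by rewrite -mulrA ler_pM2l// (le_trans (HM _ fgi))// ler_wpM2l ?sqr_ge0.
rewrite ler_pM2l//; apply: le_trans (kop_contraction t0 gfi) _.
by rewrite sqn_distC.
Qed.

Lemma kopD s t f : 0 < s -> 0 < t -> sqint m f ->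
  kop (s + t) f = kop s (kop t f).
Proof.
move=> s0 t0 fi; have st0 : 0 < s + t by rewrite addr_gt0.
have kf := kop_sqint t0 fi.
apply: continuous_ae_eq; [exact: kop_continuous|exact: kop_continuous|].
have h1 := T2_kop st0 fi; have h2 := T2_kop s0 kf.
have h3 := L2_semigroupD semigroupT2 (ltW s0) (ltW t0) ((L2P m f).2 fi).
have h4 := L2_semigroup_ae semigroupT2 (ltW s0)
  ((L2P m _).2 (T2_sqint (ltW t0) fi)) ((L2P m _).2 kf) (T2_kop t0 fi).
apply: filterS2 (filterI h1 h2) (filterI h3 h4) => x [e1 e2] [e3 e4] xT.
by rewrite -e1// e3// e4// e2.
Qed.

Lemma expRN_quadratic (x : R) : 0 <= x -> `|expR (- x) - 1 + x| <= x ^+ 2.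
Proof.
move=> x0; have h1 := expR_ge1Dx (- x); have h2 := expR_ge1Dx x.
have e0 := expR_gt0 (- x).
have : expR (- x) * expR x = 1 by rewrite expRN mulVf// gt_eqF// expR_gt0.
move: (expR (- x)) (expR x) h1 h2 e0 => a b h1 h2 a0 ab.
rewrite ler_norml; apply/andP; split; nra.
Qed.

(** The error of each step of length h is carried over by the contraction kop
    h or by the factor exp (- l h), so n steps make at most n times the error
    of one step, and n ^ 2 times in squared norm. *)
Lemma kop_power_error (w : BE -> R[i]) (h l : R) n : 0 < h -> 0 <= l -> sqint m w ->
  sqn m (fun x => kop (n.+1%:R * h) w x - (expR (- l * (n.+1%:R * h)))%:C%C * w x)
  <= n.+1%:R ^+ 2 * sqn m (fun x => kop h w x - (expR (- l * h))%:C%C * w x).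
Proof.
move=> h0 l0 wi; set r := sqn m (fun x => kop h w x - _).
elim: n => [|n IH]; first by rewrite !mul1r expr1n mul1r.
have nh0 : 0 < n.+1%:R * h by rewrite mulr_gt0.
have ki := kop_sqint nh0 wi; have kh := kop_sqint h0 wi.
set a := (expR (- l * (n.+1%:R * h)))%:C%C.
have d1 : sqint m (fun x => kop (n.+1%:R * h) w x - a * w x).
  by apply: sqintB => //; exact: sqintZ.
have d2 : sqint m (fun x => kop h w x - (expR (- l * h))%:C%C * w x).
  by apply: sqintB => //; exact: sqintZ.
have -> : (fun x => kop (n.+2%:R * h) w x - (expR (- l * (n.+2%:R * h)))%:C%C * w x) =
  (fun x => a * (kop h w x - (expR (- l * h))%:C%C * w x) +
    kop h (fun x => kop (n.+1%:R * h) w x - a * w x) x).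
  have -> : n.+2%:R * h = h + n.+1%:R * h by rewrite -natr1; ring.
  rewrite kopD// mulrDr expRD real_complexM -/a.
  rewrite (_ : (fun x => kop (n.+1%:R * h) w x - a * w x) =
    (fun x => - a * w x + kop (n.+1%:R * h) w x)); last first.
    by apply/funext => x; ring.
  by rewrite kop_lin//; apply/funext => x; ring.
have n1 : 0 < n.+1%:R :> R by [].
(* with N = n + 1 as weight, (1 + N) r + (1 + 1 / N) N ^ 2 r = (N + 1) ^ 2 r *)
apply: (le_trans (sqnD n1 (sqintZ a d2) (kop_sqint h0 d1))).
rewrite sqnZ// -/r.
have a1 : normc a ^+ 2 <= 1.
  rewrite /a normc_real ger0_norm ?expR_ge0// exprn_ile1 ?expR_ge0//.
  by rewrite expR_le1 mulNr oppr_le0 mulr_ge0// ltW.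
have r0 : 0 <= r by exact: sqn_ge0.
have h1 : normc a ^+ 2 * r <= r by rewrite ler_piMl.
have h2 : sqn m (kop h (fun x => kop (n.+1%:R * h) w x - a * w x))
    <= n.+1%:R ^+ 2 * r by rewrite (le_trans (kop_contraction h0 d1)).
rewrite -(natr1 n.+1).
move: (sqn m (kop h _)) (normc a ^+ 2 * r) h1 h2 => u v h1 h2.
move: (n.+1%:R : R) n1 h2 => N N0 h2.
apply: (@le_trans _ _ ((1 + N) * r + (1 + N^-1) * (N ^+ 2 * r))).
  rewrite lerD// ler_wpM2l//; first by rewrite addr_ge0// ltW.
  by rewrite addr_ge0// invr_ge0 ltW.
rewrite le_eqVlt; apply/orP; left; apply/eqP; field; lra.
Qed.

(** Divide [0, t] into steps of length h. The difference quotients converge to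
    the generator and exp (- l h) = 1 - l h + O (h ^ 2), so one step makes an
    error o (h), and by kop_power_error the t / h steps make an error o (1). *)
Lemma generator_eigenfunction (w : E -> R[i]) (l t : R) : 0 <= l -> 0 < t ->
  L2_generator m T2 w (fun x => - (l%:C%C * w x)) ->
  ae_eq m setT (kop t w) (fun x => (expR (- l * t))%:C%C * w x).
Proof.
move=> l0 t0 [/L2P wi _ /cvgrPdist_lt gen].
have kt := kop_sqint t0 wi.
have di : sqint m (fun x => kop t w x - (expR (- l * t))%:C%C * w x).
  by apply: sqintB => //; exact: sqintZ.
suff : sqn m (fun x => kop t w x - (expR (- l * t))%:C%C * w x) = 0.
  move=> /(sqn_eq0_ae di); apply: filterS => x h xT.
  by apply/eqP; rewrite -subr_eq0; apply/eqP; exact: h.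
apply: (@eq0_le_eps _ _ (t ^+ 2 * (2 + 2 * l ^+ 4 * sqn m w))); first exact: sqn_ge0.
move=> e' e'0; pose e := Num.min 1 e'.
have e0 : 0 < e by rewrite lt_min ltr01.
have e1 : e <= 1 by rewrite ge_min lexx.
have ee : e <= e' by rewrite ge_min lexx orbT.
have e2 : e ^+ 2 <= e by rewrite expr2 ler_piMl// ltW.
have C0 : 0 <= t ^+ 2 * (2 + 2 * l ^+ 4 * sqn m w).
  by rewrite mulr_ge0 ?sqr_ge0// addr_ge0// !mulr_ge0// ?exprn_ge0// sqn_ge0.
apply: (@le_trans _ _ (t ^+ 2 * (2 + 2 * l ^+ 4 * sqn m w) * e)); last first.
  by rewrite ler_wpM2l.
have [d /= d0 Hd] := gen e e0.
(* h < d serves the difference quotient, h < e the remainder of exp (- l h) *)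
pose M := Num.min d e; have M0 : 0 < M by rewrite lt_min d0.
have [n _ /(_ n (leqnn _)) Hn] := near_infty_natSinv_lt (PosNum (divr_gt0 M0 t0)).
pose h := t / n.+1%:R; have h0 : 0 < h by rewrite divr_gt0.
have hM : h < M.
  by move: Hn => /=; rewrite ltr_pdivlMr// mulrC.
have [hd he] : h < d /\ h < e by move: hM; rewrite lt_min => /andP.
have nh : t = n.+1%:R * h by rewrite mulrC divfK// pnatr_eq0.
rewrite {1 2}nh (le_trans (kop_power_error n h0 l0 wi))//.
have T2w := T2_sqint (ltW h0) wi; have kh := kop_sqint h0 wi.
(* the error of one step is h (A - b w), with A the error of the difference
   quotient and b the second-order remainder of the exponential over h *)
pose A x := (h^-1)%:C%C * (T2 h w x - w x) - - (l%:C%C * w x).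
pose b := (expR (- (l * h)) - 1 + l * h) / h.
have Ai : sqint m A.
  by apply: sqintB; [apply/sqintZ/sqintB|under eq_fun do rewrite -mulNr; exact: sqintZ].
have An : sqn m A <= e ^+ 2.
  have := Hd h; rewrite /= sub0r normrN ger0_norm ?(ltW h0)// => /(_ hd h0).
  rewrite sub0r normrN ger0_norm ?L2norm_ge0// => /ltW h1.
  by rewrite -L2norm_sqr// lerXn2r// nnegrE ?L2norm_ge0// ltW.
have bn : b ^+ 2 <= l ^+ 4 * e ^+ 2.
  have lh0 : 0 <= l * h by rewrite mulr_ge0// ltW.
  have bh : `|b| <= l ^+ 2 * h.
    rewrite /b normrM normfV (ger0_norm (ltW h0)) ler_pdivrMr//.
    by rewrite -mulrA -expr2 -exprMn expRN_quadratic.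
  rewrite -real_normK ?num_real// (_ : l ^+ 4 * e ^+ 2 = (l ^+ 2 * e) ^+ 2); last by ring.
  rewrite lerXn2r// ?nnegrE// ?mulr_ge0 ?sqr_ge0// ?(ltW e0)//.
  by rewrite (le_trans bh)// ler_wpM2l ?sqr_ge0// ltW.
have -> : sqn m (fun x => kop h w x - (expR (- l * h))%:C%C * w x) =
    sqn m (fun x => h%:C%C * (A x + - b%:C%C * w x)).
  apply: ae_eq_sqn.
  - by apply: cmeasurableB; [case: kh|apply: cmeasurableZ; case: wi].
  - by apply/cmeasurableZ/cmeasurableD; [case: Ai|apply: cmeasurableZ; case: wi].
  apply: filterS (T2_kop h0 wi) => x Hx xT; rewrite /A Hx// mulNr.
  have hh : h%:C%C * (h^-1)%:C%C = 1 :> R[i] by rewrite -real_complexM divff// gt_eqF.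
  have bE : h%:C%C * b%:C%C = (expR (- (l * h)))%:C%C - 1 + l%:C%C * h%:C%C :> R[i].
    rewrite -real_complexM /b mulrC divfK ?gt_eqF// !real_complexD real_complexM.
    by congr (_ + _ + _); apply: complex_eq; rewrite /= ?oppr0.
  rewrite opprK mulrDr mulrDr mulrA hh mul1r.
  rewrite (_ : h%:C%C * (- b%:C%C * w x) = - (h%:C%C * b%:C%C) * w x); last by ring.
  by rewrite bE; ring.
have bi : sqint m (fun x => - b%:C%C * w x) by exact: sqintZ.
rewrite sqnZ; last exact: sqintD.
have := sqnD2 Ai bi; rewrite sqnZ// normc_opp normc_real real_normK ?num_real//.
set S := sqn m (fun x => _ + _) => hS.
rewrite normc_real ger0_norm ?(ltW h0)// mulrA -exprMn -nh -[leRHS]mulrA ler_wpM2l ?sqr_ge0//.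
rewrite (le_trans hS)// [leRHS]mulrDl lerD//.
  by rewrite ler_pM2l// (le_trans An).
rewrite [leRHS](_ : _ = 2 * (l ^+ 4 * e * sqn m w)); last by ring.
rewrite ler_pM2l//.
rewrite ler_wpM2r ?sqn_ge0// (le_trans bn)// ler_wpM2l//.
by rewrite exprn_ge0.
Qed.

End L2_extension.

End kernel_operator.

(** * Normally convergent series *)

Section dominated_series.
Context {R : realType}.
Implicit Types (u : nat -> R[i]) (b : nat -> R).

Definition csum u : R[i] :=
  lim ((fun n => \sum_(0 <= j < n) u j : (R[i])^o) @ \oo).

(** A convergent series of nonnegative terms, through its bounded partial
    sums. *)
Definition majorant b :=
  (forall j, 0 <= b j) /\ exists B : R, forall n, \sum_(0 <= j < n) b j <= B.

Lemma majorant_tail b : majorant b -> forall e : R, 0 < e ->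
  exists N, forall n n', (N <= n)%N -> (n <= n')%N -> \sum_(n <= j < n') b j <= e.
Proof.
move=> [b0 [B HB]] e e0.
pose S n := \sum_(0 <= j < n) b j.
have Snd : nondecreasing_seq S.
  by apply/nondecreasing_seqP => n; rewrite /S big_nat_recr//= lerDl.
have Scvg : S @ \oo --> sup (range S).
  by apply: nondecreasing_cvgn => //; exists B => _ [n _ <-]; exact: HB.
have [N _ HN] := (cvgrPdist_lt _ _).1 Scvg e e0.
have Sle n : S n <= sup (range S).
  by apply: sup_upper_bound; [split; [by exists (S 0%N), 0%N|exists B => _ [k _ <-]; exact: HB]
    |exists n].
exists N => n n' Nn nn'.
have -> : \sum_(n <= j < n') b j = S n' - S n.
  by rewrite /S [in RHS](big_cat_nat _ nn')//= addrAC subrr add0r.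
have := HN N (leqnn N); rewrite /= ger0_norm ?subr_ge0//.
have := Sle n'; have := Snd _ _ Nn; lra.
Qed.

Lemma majorantZ (c : R) b : 0 <= c -> majorant b -> majorant (fun j => c * b j).
Proof.
move=> c0 [b0 [B HB]]; split; first by move=> j; rewrite mulr_ge0.
by exists (c * B) => n; rewrite -mulr_sumr ler_wpM2l.
Qed.

Lemma csum_cvg u b : majorant b -> (forall j, normc (u j) <= b j) ->
  ((fun n => \sum_(0 <= j < n) u j) : nat -> (R[i])^o) @ \oo
    --> (csum u : (R[i])^o).
Proof.
move=> mb ub.
have [l Hl] : exists l, ((fun n => \sum_(0 <= j < n) u j) : nat -> (R[i])^o) @ \oo
    --> (l : (R[i])^o).
  apply: ccauchy_cvg => e e0.
  have e2 : 0 < e / 2 by rewrite divr_gt0.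
  have [N HN] := majorant_tail mb e2.
  have H i j : (N <= i)%N -> (i <= j)%N ->
      normc (\sum_(0 <= k < j) u k - \sum_(0 <= k < i) u k) < e.
    move=> Ni ij; rewrite (big_cat_nat _ ij)//= addrAC subrr add0r.
    rewrite (le_lt_trans (normc_sum _ _ _))//.
    apply: (@le_lt_trans _ _ (\sum_(i <= k < j) b k)); first exact: ler_sum.
    by rewrite (le_lt_trans (HN _ _ Ni ij))// ltr_pdivrMr// ltr_pMr// ltr1n.
  exists N => i j Ni Nj; case: (leqP i j) => ij; last by apply: H => //; exact: ltnW.
  by rewrite normc_distC; exact: H.
by rewrite /csum (ccvg_lim Hl).
Qed.

Lemma csum_unique u (l : R[i]) :
  ((fun n => \sum_(0 <= j < n) u j) : nat -> (R[i])^o) @ \oo --> (l : (R[i])^o) ->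
  csum u = l.
Proof. by move=> h; rewrite /csum (ccvg_lim h). Qed.

(** The rank N depends on the majorant only: convergence is uniform over all
    the series that it dominates. *)
Lemma csum_tail b : majorant b -> forall e : R, 0 < e ->
  exists N, forall n, (N <= n)%N -> forall u, (forall j, normc (u j) <= b j) ->
    normc (csum u - \sum_(0 <= j < n) u j) <= e.
Proof.
move=> mb e e0; have [N HN] := majorant_tail mb e0.
exists N => n Nn u ub.
have h : normc (\sum_(0 <= j < n') u j - \sum_(0 <= j < n) u j) @[n' --> \oo]
    --> normc (csum u - \sum_(0 <= j < n) u j).
  by apply: ccvg_normc; apply: ccvgB; [exact: (csum_cvg mb ub)|exact: ccvg_cst].
apply: (ler_cvg_to h (cvg_cst e)); near=> n'.
have nn' : (n <= n')%N by near: n'; exact: nbhs_infty_ge.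
rewrite (big_cat_nat _ nn')//= addrAC subrr add0r.
rewrite (le_trans (normc_sum _ _ _))// (le_trans _ (HN n n' Nn nn'))//.
exact: ler_sum.
Unshelve. all: by end_near. Qed.

Lemma csum_normc_le u b (B : R) : majorant b -> (forall j, normc (u j) <= b j) ->
  (forall n, \sum_(0 <= j < n) b j <= B) -> normc (csum u) <= B.
Proof.
move=> mb ub HB.
apply: (ler_cvg_to (ccvg_normc (csum_cvg mb ub)) (cvg_cst B)).
apply: nearW => n; rewrite (le_trans (normc_sum _ _ _))// (le_trans _ (HB n))//.
exact: ler_sum.
Qed.

Lemma cvg_series_normc u b : majorant b -> (forall j, normc (u j) <= b j) ->
  cvgn (series (fun j => normc (u j))).
Proof.
move=> [b0 [B HB]] ub; apply: nondecreasing_is_cvgn.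
  by apply/nondecreasing_seqP => n; rewrite /series /= big_nat_recr//= lerDl normc_ge0.
exists B => _ [n _ <-]; rewrite /series /= (le_trans _ (HB n))//.
exact: ler_sum.
Qed.

Lemma csumJ u b : majorant b -> (forall j, normc (u j) <= b j) ->
  csum (fun j => ((u j)^*)%C) = ((csum u)^*)%C.
Proof.
move=> mb ub; apply: csum_unique.
under eq_fun do rewrite -conjc_sum.
by apply: ccvg_conj; exact: csum_cvg ub.
Qed.

Lemma csum_single u k : (forall j, j != k -> u j = 0) -> csum u = u k.
Proof.
move=> h; apply: csum_unique; apply: cvg_near_cst; near=> n.
rewrite (bigD1_seq k) ?mem_index_iota ?iota_uniq//=; last first.
  by near: n; exact: nbhs_infty_gt.
by rewrite big1 ?addr0.
Unshelve. all: by end_near. Qed.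

Lemma csum_ccontinuous (E : pmetricType R) (u : nat -> E -> R[i]) b : majorant b ->
  (forall j, ccontinuous (u j)) -> (forall j x, normc (u j x) <= b j) ->
  ccontinuous (fun x => csum (fun j => u j x)).
Proof.
move=> mb uc ub; apply: ccontinuous_uniform_limit => e e0.
have [N HN] := csum_tail mb e0.
exists (fun x => \sum_(0 <= j < N) u j x).
  by apply: ccontinuous_sum => j; exact: uc.
by move=> x; apply: HN.
Qed.

Lemma csum_cbm d (T : measurableType d) (u : nat -> T -> R[i]) b : majorant b ->
  (forall j, cbm (u j)) -> (forall j x, normc (u j x) <= b j) ->
  cbm (fun x => csum (fun j => u j x)).
Proof.
move=> mb uc ub; split.
- apply: (@cmeasurable_lim _ _ _ (fun n x => \sum_(0 <= j < n) u j x)).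
  + by move=> n; apply: cmeasurable_sum => j; have [] := uc j.
  + by move=> x; apply: (csum_cvg mb).
- have [b0 [B HB]] := mb; exists B => x.
  exact: (csum_normc_le mb (fun j => ub j x) HB).
Qed.

(** A bounded functional commutes with uniform limits. *)
Lemma bfunctional_csum d (T : measurableType d) (F : (T -> R[i]) -> R[i])
    (u : nat -> T -> R[i]) b : bfunctional F -> majorant b ->
  (forall j, cbm (u j)) -> (forall j x, normc (u j x) <= b j) ->
  F (fun x => csum (fun j => u j x)) = csum (fun j => F (u j)).
Proof.
move=> hF mb uc ub; apply/esym/csum_unique.
have [C HC] := bfunctional_bounded hF.
apply/ccvg_normcP/cvgrPdist_le => e e0.
pose D := `|C| + 1; have D0 : 0 < D by rewrite ltr_wpDl.
have CD : C <= D by rewrite (le_trans (ler_norm _))// lerDl.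
have eD : 0 < e / D by rewrite divr_gt0.
have [N HN] := csum_tail mb eD; exists N => //= n /= Nn.
rewrite sub0r normrN ger0_norm ?normc_ge0//.
have cs := csum_cbm mb uc ub.
have cn : cbm (fun x => \sum_(0 <= j < n) u j x) by exact: cbm_sum.
have -> : \sum_(0 <= j < n) F (u j) = F (fun x => \sum_(0 <= j < n) u j x).
  have := bfunctional_sum hF (index_iota 0 n) (fun=> 1) uc.
  under [X in F X]eq_fun do under eq_bigr do rewrite mul1r.
  by move=> ->; apply: eq_bigr => i _; rewrite mul1r.
rewrite normc_distC -bfunctionalB//.
apply: (@le_trans _ _ (C * (e / D))).
  by apply: HC; [exact: cbmB|move=> x; exact: HN].
apply: (@le_trans _ _ (D * (e / D))); first by rewrite ler_pM2r.
by rewrite mulrC divfK// gt_eqF.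
Qed.

End dominated_series.

(** * Eigenfunction expansion *)

(** Bounds the terms of an eigenfunction expansion: of the factor exp (-
    lambda t), one half is used up by the eigenfunction b, and the other half
    remains to ensure convergence. *)
Lemma weighted_amgm (R : realFieldType) (e a b c K S : R) : 0 <= e -> e <= 1 ->
  0 < c -> a ^+ 2 * c <= S -> e * b ^+ 2 * c <= K ->
  e * e * c * a * b <= (K + S) * e.
Proof.
move=> e0 e1 c0 cs h.
have ab : 2 * (a * b) <= a ^+ 2 + b ^+ 2.
  by rewrite -subr_ge0 (_ : _ - _ = (a - b) ^+ 2) ?sqr_ge0//; ring.
have h2 : e * (a ^+ 2 * c) <= S.
  by apply: le_trans cs; rewrite ler_piMl// mulr_ge0 ?sqr_ge0// ltW.
rewrite (_ : _ * _ * _ * _ * _ = (e * c * (a * b)) * e); last by ring.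
rewrite ler_wpM2r//.
have ec : 0 <= e * c by rewrite mulr_ge0// ltW.
have := ler_wpM2l ec ab.
have : 0 <= e * b ^+ 2 * c.
  by apply: mulr_ge0; [apply: mulr_ge0 => //; exact: sqr_ge0|exact: ltW].
have : 0 <= e * (a ^+ 2 * c).
  by apply: mulr_ge0 => //; apply: mulr_ge0; [exact: sqr_ge0|exact: ltW].
lra.
Qed.

Section trace_formula.
Context {R : realType} {E : pmetricType R}.
Hypothesis compactE : compact [set: E].
Local Notation BE := (borel E).
Variable T : R -> (E -> R[i]) -> (E -> R[i]).
Variable p : R -> E -> subprobability BE R.
Hypothesis fellerT : feller_semigroup T.
Hypothesis kernelT : transition_kernel T p.
Variable m : {finite_measure set BE -> \bar R}.
Variable k : R -> E -> E -> R.
Hypothesis sk : symmetric_kernel m p k.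
Local Notation kop := (kop m k).
Local Notation row t x := (fun y : BE => (k t x y)%:C%C).

Lemma row_inner (t : R) x (f : BE -> R[i]) : 0 < t -> sqint m f ->
  L2inner m (row t x) f = ((kop t f x)^*)%C.
Proof.
move=> t0 fi; rewrite L2innerE kopE -cintmJ; last exact: (kop_integrable sk x t0 fi).
by congr cintm; apply/funext => y; rewrite conjc_mul conjc_real.
Qed.

(** Parseval's identity for each row of the kernel, integrated over the rows:
    the coefficients of the row at x are the conjugates of the kop t (omega j)
    x, and kop t (omega j) has squared norm exp (- 2 lambda_j t). *)
Lemma hilbert_schmidt_trace (lambda : nat -> R) (omega : nat -> E -> R[i]) (t : R) :
  0 < t -> orthonormal_basis m omega ->
  (forall j, ae_eq m setT (kop t (omega j))
     (fun x => (expR (- lambda j * t))%:C%C * omega j x)) ->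
  \sum_(0 <= j < n) expR (- lambda j * (t + t)) @[n --> \oo]
    --> \int[m]_x sqn m (row t x).
Proof.
move=> t0 [orth nrm1 compl] eig.
have oi j : sqint m (omega j) by apply/L2P; have [] := orth.
have on j : sqn m (omega j) = 1 by rewrite -L2norm_sqr// nrm1 expr1n.
have ri x : sqint m (row t x) by exact: (kernel_row_sqint sk x t0).
have [K K0 HK] := kernel_row_sqn sk t0.
have kc j : ccontinuous (kop t (omega j)).
  exact: (kop_continuous compactE fellerT kernelT sk).
pose g n x := \sum_(0 <= j < n) normc (kop t (omega j) x) ^+ 2.
have gE n x : g n x = sqn m (row t x) - sqn m (fourier_residual m omega (row t x) n).
  rewrite fourier_residual_sqn// opprB addrCA subrr addr0.
  apply: eq_bigr => j _; rewrite on divr1 row_inner//.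
  by rewrite normc_conj.
have kn j : measurable_fun setT (fun x : BE => normc (kop t (omega j) x) ^+ 2).
  by apply: measurable_normc2; exact: ccontinuous_borel.
have mg n : measurable_fun setT (g n : BE -> R).
  rewrite /g; elim: n => [|n IH].
    by under eq_fun do rewrite big_nil; exact: measurable_cst.
  by under eq_fun do rewrite big_nat_recr//=; apply: measurable_funD; [exact: IH|exact: kn].
have gb n x : `|g n x| <= K.
  rewrite ger0_norm ?sumr_ge0// => [|j _]; last exact: sqr_ge0.
  by rewrite gE (le_trans _ (HK x))// gerBl sqn_ge0.
have gcv x : g n x @[n --> \oo] --> sqn m (row t x).
  suff h0 : sqn m (fourier_residual m omega (row t x) n) @[n --> \oo] --> (0 : R).
    rewrite (_ : (fun n => g n x) = (fun n => sqn m (row t x) -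
      sqn m (fourier_residual m omega (row t x) n))); last by apply/funext => n; exact: gE.
    by rewrite -[X in _ --> X]subr0; apply: cvgB => //; exact: cvg_cst.
  have h : L2norm m (fourier_residual m omega (row t x) n) @[n --> \oo] --> (0 : R).
    have := compl _ ((L2P _ _).2 (ri x)).
    rewrite (_ : (fun n => _) = (fun n => L2norm m (fourier_residual m omega (row t x) n)))//.
    apply/funext => n; congr L2norm; apply/funext => y; rewrite /fourier_residual.
    congr (_ - _); apply: eq_bigr => j _.
    by rewrite /fourier_coef on invr1 mul1r.
  rewrite (_ : (fun n => _) = (fun n => L2norm m (fourier_residual m omega (row t x) n)
    * L2norm m (fourier_residual m omega (row t x) n))).
    by rewrite -[X in _ --> X](mulr0 (0 : R)); exact: cvgM.
  apply/funext => n; rewrite -expr2 L2norm_sqr//.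
  exact: fourier_residual_sqint.
have := @Rintegral_bounded_cvg _ _ _ m g (fun x => sqn m (row t x)) K mg gb gcv.
rewrite (_ : (fun n => _) = (fun n => \sum_(0 <= j < n) expR (- lambda j * (t + t))))//.
apply/funext => n; rewrite /g Rintegral_sum.
  apply: eq_bigr => j _; rewrite -/(sqn m (kop t (omega j))).
  rewrite (ae_eq_sqn _ _ (eig j)); last 2 first.
  - exact: ccontinuous_borel.
  - by apply: cmeasurableZ; case: (oi j).
  rewrite sqnZ// on mulr1 normc_real ger0_norm ?expR_ge0//.
  by rewrite mulrDr expRD expr2.
move=> j; have [] // : sqint m (kop t (omega j)).
exact: (kop_sqint compactE fellerT kernelT sk).
Qed.

End trace_formula.

Section spectral_expansion.
Context {R : realType} {E : pmetricType R}.
Hypothesis compactE : compact [set: E].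
Local Notation BE := (borel E).
Variable T : R -> (E -> R[i]) -> (E -> R[i]).
Variable p : R -> E -> subprobability BE R.
Hypothesis fellerT : feller_semigroup T.
Hypothesis kernelT : transition_kernel T p.
Variable m : {finite_measure set BE -> \bar R}.
Variable k : R -> E -> E -> R.
Hypothesis sk : symmetric_kernel m p k.
Local Notation kop := (kop m k).
Local Notation row t x := (fun y : BE => (k t x y)%:C%C).
Variables (lambda : nat -> R) (phi : nat -> E -> R[i]).
Hypothesis lambda0 : forall j, 0 <= lambda j.
Hypothesis phi_cont : forall j, ccontinuous (phi j).
Hypothesis phi_orth : orthogonal_family m phi.
Hypothesis phi_bdd : exists S : R, forall j, sqn m (phi j) <= S.
Hypothesis phi_eigen : forall (t : R) j, 0 < t ->
  kop t (phi j) = (fun x => (expR (- lambda j * t))%:C%C * phi j x).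
Hypothesis trace : forall t : R, 0 < t ->
  \sum_(0 <= j < n) expR (- lambda j * (t + t)) @[n --> \oo]
    --> \int[m]_x sqn m (row t x).
Local Notation s j := (sqn m (phi j)).
Local Notation ex t j := (expR (- lambda j * t)).

Let phi_sqint j : sqint m (phi j).
Proof. by apply/L2P; have [] := phi_orth. Qed.

Let s_gt0 j : 0 < s j.
Proof. exact: orthogonal_sqn_gt0. Qed.

Lemma ex_ge0 (t : R) j : 0 <= ex t j. Proof. exact: expR_ge0. Qed.

Lemma exD (t u : R) j : ex (t + u) j = ex t j * ex u j.
Proof. by rewrite mulrDr expRD. Qed.

(** The trace formula at time t / 2 sums the exponentials. *)
Lemma ex_majorant (t : R) : 0 < t -> majorant (fun j => ex t j).
Proof.
move=> t0; split; first by move=> j; exact: ex_ge0.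
have t2 : 0 < t / 2 by rewrite divr_gt0.
have := trace t2; rewrite -splitr => h.
exists (\int[m]_x sqn m (row (t / 2) x)) => n.
have nd : nondecreasing_seq (fun n => \sum_(0 <= j < n) ex t j).
  by apply/nondecreasing_seqP => i; rewrite big_nat_recr//= lerDl ex_ge0.
rewrite -(cvg_lim (@norm_hausdorff _ R^o) h).
by apply: nondecreasing_cvgn_le => //; apply/cvg_ex; eexists; exact: h.
Qed.

(** Bessel's inequality for the row at x, whose coefficients are the
    conjugates of the kop t (phi j) x. *)
Lemma bessel_row (t : R) x n : 0 < t ->
  \sum_(0 <= j < n) ex (t + t) j * normc (phi j x) ^+ 2 / s j <= sqn m (row t x).
Proof.
move=> t0; have ri := kernel_row_sqint sk x t0.
apply: le_trans (bessel phi_orth ri n); apply: ler_sum => j _.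
rewrite (row_inner sk x t0 (phi_sqint j)) phi_eigen// normc_conj normc_mul.
rewrite normc_real ger0_norm ?ex_ge0// exprMn exD -expr2.
exact: lexx.
Qed.

Lemma phi_ratio_bound (t : R) : 0 < t -> exists2 K : R, 0 <= K &
  forall j x, ex t j * normc (phi j x) ^+ 2 / s j <= K.
Proof.
move=> t0; have t2 : 0 < t / 2 by rewrite divr_gt0.
have [K K0 HK] := kernel_row_sqn sk t2; exists K => // j x.
apply: le_trans (HK x); apply: le_trans (bessel_row x j.+1 t2).
rewrite big_nat_recr//= -splitr lerDr; apply: sumr_ge0 => i _.
apply: divr_ge0; last exact: sqn_ge0.
by apply: mulr_ge0; [exact: ex_ge0|exact: sqr_ge0].
Qed.

(** The bound on the norms of the phi j replaces the ratio of phi_ratio_bound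
    by the modulus of the eigenfunction itself. *)
Lemma phi_sup_bound (t : R) : 0 < t -> exists2 K : R, 0 <= K &
  forall j x, ex t j * normc (phi j x) <= K.
Proof.
move=> t0; have tt0 : 0 < t + t by rewrite addr_gt0.
have [K K0 HK] := phi_ratio_bound tt0; have [S HS] := phi_bdd.
have S0 : 0 <= S by rewrite (le_trans (sqn_ge0 m (phi 0%N)))//.
exists (K * S + 1); first by rewrite addr_ge0// mulr_ge0.
move=> j x; have := HK j x; rewrite ler_pdivrMr// exD => h.
have h2 : (ex t j * normc (phi j x)) ^+ 2 <= K * S.
  by rewrite exprMn expr2 (le_trans h)// ler_wpM2l.
have : 0 <= ex t j * normc (phi j x) by rewrite mulr_ge0 ?ex_ge0 ?normc_ge0.
by move: (_ * _) h2 => a; nra.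
Qed.

Lemma phi_pair_bound (t : R) : 0 < t -> exists2 K : R, 0 <= K &
  forall j x y, ex t j * (normc (phi j x) * normc (phi j y)) / s j <= K.
Proof.
move=> t0; have [K K0 HK] := phi_ratio_bound t0; exists K => // j x y.
have := HK j x; have := HK j y; rewrite !ler_pdivrMr//.
have := ex_ge0 t j; move: (ex t j) => e e0 h1 h2.
have : 2 * (normc (phi j x) * normc (phi j y)) <=
    normc (phi j x) ^+ 2 + normc (phi j y) ^+ 2.
  by rewrite -subr_ge0 (_ : _ - _ = (normc (phi j x) - normc (phi j y)) ^+ 2) ?sqr_ge0//; ring.
move/(ler_wpM2l e0); lra.
Qed.

Definition weight (t : R) j : R[i] := ((s j)^-1 * ex t j)%:C%C.

Lemma weightE (t : R) j : weight t j = ((s j)^-1 * ex t j)%:C%C.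
Proof. by []. Qed.

Lemma normc_weight (t : R) j : normc (weight t j) = ex t j / s j.
Proof.
by rewrite /weight normc_real ger0_norm 1?mulrC// mulr_ge0 ?ex_ge0 ?invr_ge0 ?sqn_ge0.
Qed.

Lemma weight_conj (t : R) j : ((weight t j)^*)%C = weight t j.
Proof. exact: conjc_real. Qed.

(** The heat kernel as an eigenfunction series, which converges at every pair
    of points. *)
Definition heat (t : R) (x y : E) : R[i] :=
  csum (fun j => weight t j * phi j x * ((phi j y)^*)%C).

Lemma heat_majorant (t : R) : 0 < t -> exists2 b : nat -> R, majorant b &
  forall j x y, normc (weight t j * phi j x * ((phi j y)^*)%C) <= b j.
Proof.
move=> t0; have t2 : 0 < t / 2 by rewrite divr_gt0.
have [K K0 HK] := phi_pair_bound t2.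
exists (fun j => K * ex (t / 2) j); first by apply: majorantZ => //; exact: ex_majorant.
move=> j x y; rewrite !normc_mul normc_conj normc_weight.
rewrite [in X in X <= _](_ : ex t j = ex (t / 2) j * ex (t / 2) j); last by rewrite -exD -splitr.
have := ler_wpM2r (ex_ge0 (t / 2) j) (HK j x y).
by apply: le_trans; rewrite le_eqVlt; apply/orP; left; apply/eqP; ring.
Qed.

(** The exponential is split into three factors: the first is used up by two
    of the eigenfunctions, the second by the remaining one, and the third is
    summable. *)
Lemma triple_majorant (t : R) : 0 < t -> exists2 b : nat -> R, majorant b &
  forall j x y z, normc (phi j x) * normc (phi j y) * normc (phi j z)
    * (ex t j / s j) <= b j.
Proof.
move=> t0; have t3 : 0 < t / 3 by rewrite divr_gt0.
have [K K0 HK] := phi_pair_bound t3; have [L L0 HL] := phi_sup_bound t3.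
exists (fun j => (K * L) * ex (t / 3) j).
  by apply: majorantZ; [rewrite mulr_ge0|exact: ex_majorant].
move=> j x y z.
have -> : ex t j = ex (t / 3) j * ex (t / 3) j * ex (t / 3) j.
  by rewrite -!exD; congr (expR (_ * _)); field.
have h0 : 0 <= ex (t / 3) j * (normc (phi j x) * normc (phi j y)) / s j.
  by rewrite divr_ge0 ?mulr_ge0 ?ex_ge0 ?normc_ge0 ?sqn_ge0.
have h1 : 0 <= ex (t / 3) j * normc (phi j z) by rewrite mulr_ge0 ?ex_ge0 ?normc_ge0.
have := ler_wpM2r (ex_ge0 (t / 3) j) (ler_pM h0 h1 (HK j x y) (HL j z)).
by apply: le_trans; rewrite le_eqVlt; apply/orP; left; apply/eqP; ring.
Qed.

Lemma expansion_majorant (t : R) f : 0 < t -> sqint m f ->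
  exists2 b : nat -> R, majorant b &
  forall j x, normc (weight t j * L2inner m f (phi j) * phi j x) <= b j.
Proof.
move=> t0 fi; have t2 : 0 < t / 2 by rewrite divr_gt0.
have [K K0 HK] := phi_ratio_bound t2.
exists (fun j => (K + sqn m f) * ex (t / 2) j).
  by apply: majorantZ; [rewrite addr_ge0 ?sqn_ge0|exact: ex_majorant].
move=> j x; rewrite !normc_mul normc_weight.
have tE : ex t j = ex (t / 2) j * ex (t / 2) j by rewrite -exD -splitr.
have ex1 : ex (t / 2) j <= 1.
  by rewrite expR_le1 mulNr oppr_le0 mulr_ge0// ltW.
have cs : normc (L2inner m f (phi j)) ^+ 2 / s j <= sqn m f.
  rewrite ler_pdivrMr//; have := cauchy_schwarz fi (sqintJ (phi_sqint j)).
  by rewrite sqnJ.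
have e0 : 0 <= ex (t / 2) j by exact: ex_ge0.
rewrite tE; apply: (@weighted_amgm R (ex (t / 2) j) (normc (L2inner m f (phi j)))
  (normc (phi j x)) (s j)^-1 K (sqn m f)) => //.
by rewrite invr_gt0.
Qed.

Lemma residual_row_sqn (t : R) x n : 0 < t ->
  sqn m (fourier_residual m phi (row t x) n) =
  sqn m (row t x) - \sum_(0 <= j < n) ex (t + t) j / s j * normc (phi j x) ^+ 2.
Proof.
move=> t0; have ri := kernel_row_sqint sk x t0.
rewrite fourier_residual_sqn//; congr (_ - _); apply: eq_bigr => j _.
rewrite (row_inner sk x t0 (phi_sqint j)) phi_eigen// normc_conj normc_mul.
by rewrite normc_real ger0_norm ?ex_ge0// exprMn exD; ring.
Qed.

Lemma row_sqn_rintegrable (t : R) : 0 < t -> rintegrable m (fun x => sqn m (row t x)).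
Proof.
move=> t0; have [K K0 HK] := kernel_row_sqn sk t0.
suff mrow : measurable_fun setT (fun x : BE => sqn m (row t x)).
  by apply: (rintegrable_bounded m mrow (M := K)) => x; rewrite ger0_norm ?sqn_ge0.
pose F (z : BE * BE) := (k t z.1 z.2 ^+ 2)%:E.
have mF : measurable_fun setT F.
  by apply/measurable_EFinP; apply: measurable_funX; exact: (sk_measurable sk).
have F0 z : (0 <= F z)%E by rewrite lee_fin sqr_ge0.
have mh := @measurable_fun_fubini_tonelli_F _ _ BE BE R m F mF F0.
rewrite (_ : (fun x => _) = fine \o fubini_F m F).
  by apply: measurableT_comp => //; exact: mh.
apply/funext => x; rewrite /= /fubini_F /sqn /Rintegral; congr fine.
by apply: eq_integral => y _; rewrite normc_real real_normK ?num_real.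
Qed.

Lemma residual_row_rintegrable (t : R) n : 0 < t ->
  rintegrable m (fun x => sqn m (fourier_residual m phi (row t x) n)).
Proof.
move=> t0; under eq_fun do rewrite residual_row_sqn//.
apply: rintegrableB; first exact: row_sqn_rintegrable.
by apply: rintegrable_sum => j; apply: rintegrableZ; case: (phi_sqint j).
Qed.

(** Integrated over the rows, the Bessel sums for phi are the partial sums of
    the trace, which exhaust the integral of the squared norms of the rows.
    Hence Bessel's inequality for phi is an equality for almost every row:
    this is what makes the family phi complete. *)
Lemma bessel_defect_cvg0 (t : R) : 0 < t ->
  \int[m]_x sqn m (fourier_residual m phi (row t x) n) @[n --> \oo] --> (0 : R).
Proof.
move=> t0; have rowi := row_sqn_rintegrable t0.
have phi2 j : rintegrable m (fun x => ex (t + t) j / s j * normc (phi j x) ^+ 2).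
  by apply: rintegrableZ; case: (phi_sqint j).
have -> : (fun n => \int[m]_x sqn m (fourier_residual m phi (row t x) n)) =
    (fun n => \int[m]_x sqn m (row t x) - \sum_(0 <= j < n) ex (t + t) j).
  apply/funext => n; under eq_Rintegral do rewrite residual_row_sqn//.
  rewrite RintegralB//; last exact: rintegrable_sum.
  congr (_ - _); rewrite Rintegral_sum//; apply: eq_bigr => j _.
  rewrite RintegralZl//; last by case: (phi_sqint j).
  by rewrite -/(sqn m (phi j)) divfK// gt_eqF.
rewrite [X in _ --> X](_ : 0 = \int[m]_x sqn m (row t x) - \int[m]_x sqn m (row t x)).
  by apply: cvgB; [exact: cvg_cst|exact: trace].
by rewrite subrr.
Qed.

(** By Cauchy-Schwarz, the squared remainder at x of the partial sums is at
    most the squared norm of f times the Bessel defect of the row at x, which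
    tends to 0 in the mean. The two sides thus agree almost everywhere, and
    everywhere because they are continuous and m has full support. *)
Lemma spectral_expansion (t : R) f x : 0 < t -> sqint m f ->
  kop t f x = csum (fun j => weight t j * L2inner m f (phi j) * phi j x).
Proof.
move=> t0 fi; have [b mb Hb] := expansion_majorant t0 fi.
pose u j x := weight t j * L2inner m f (phi j) * phi j x.
have uc j : ccontinuous (u j) by apply: ccontinuousZ; exact: phi_cont.
have Uc : ccontinuous (fun x => csum (fun j => u j x)).
  exact: (csum_ccontinuous mb uc Hb).
have kc : ccontinuous (kop t f) by exact: (kop_continuous compactE fellerT kernelT sk).
have [K K0 HK] := kernel_row_sqn sk t0.
have ri y : sqint m (row t y) by exact: (kernel_row_sqint sk y t0).
(* D is the sum of Dn n, small in the mean, and of V below, uniformly small *)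
pose D x := kop t f x - csum (fun j => u j x).
have Dc : ccontinuous D by exact: ccontinuousB.
pose Dn n x := kop t f x - \sum_(0 <= j < n) u j x.
have Dnc n : ccontinuous (Dn n).
  by apply: ccontinuousB; [exact: kc|apply: ccontinuous_sum => j; exact: uc].
have Dn_le n y : normc (Dn n y) ^+ 2 <=
    sqn m f * sqn m (fourier_residual m phi (row t y) n).
  have resi := fourier_residual_sqint phi_orth (ri y) n.
  have -> : Dn n y = cintm m (fun z => ((fourier_residual m phi (row t y) n z)^*)%C * f z).
    rewrite /Dn kopE.
    have -> : (fun z => ((fourier_residual m phi (row t y) n z)^*)%C * f z) =
        (fun z => (k t y z)%:C%C * f z -
          \sum_(0 <= j < n) (weight t j * phi j y) * (f z * ((phi j z)^*)%C)).
      apply/funext => z; rewrite /fourier_residual.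
      rewrite (_ : (_ - _)^*%C = (k t y z)%:C%C -
          \sum_(0 <= j < n) (weight t j * phi j y) * ((phi j z)^*)%C); last first.
        rewrite -[in LHS]mulN1r conjc_add conjc_mul conjc_real conjc_sum.
        rewrite (_ : ((-1 : R[i])^*)%C = -1); last by apply: complex_eq; rewrite /= ?oppr0.
        rewrite mulN1r; congr (_ - _); apply: eq_bigr => j _.
        rewrite /fourier_coef (row_inner sk y t0 (phi_sqint j)) phi_eigen//.
        by rewrite !conjc_mul !conjc_invol !conjc_real /weight real_complexM; ring.
      by rewrite mulrBl mulr_suml; congr (_ - _); apply: eq_bigr => j _; ring.
    have fpi j : cintegrable m (fun z => f z * ((phi j z)^*)%C).
      exact: (cintegrable_mul fi (sqintJ (phi_sqint j))).
    rewrite cintmB; last 2 first.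
    - exact: (kop_integrable sk y t0 fi).
    - by apply: cintegrable_sum => j; exact: cintegrableZ.
    congr (_ - _); rewrite cintm_sum; last by move=> j; exact: cintegrableZ.
    apply: eq_bigr => j _; rewrite cintmZ// /u L2innerE; ring.
  have := cauchy_schwarz (sqintJ resi) fi.
  by rewrite sqnJ mulrC.
have Dni n : sqint m (Dn n).
  by apply: cbm_sqint; exact: (ccontinuous_cbm compactE (Dnc n)).
have Di : sqint m D by apply: cbm_sqint; exact: (ccontinuous_cbm compactE Dc).
have Dn_le2 n : sqn m (Dn n) <=
    sqn m f * \int[m]_x sqn m (fourier_residual m phi (row t x) n).
  have ri2 := residual_row_rintegrable n t0.
  rewrite -RintegralZl//; apply: Rintegral_le.
  - by case: (Dni n).
  - exact: rintegrableZ.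
  - by move=> y; exact: Dn_le.
suff D0 : sqn m D = 0.
  apply/eqP; rewrite -subr_eq0; apply/eqP.
  have := sqn_eq0_ae Di D0.
  move=> aeD; have := continuous_ae_eq compactE fellerT kernelT sk Dc (@ccontinuous_cst _ E 0) aeD.
  by move=> /(congr1 (fun h => h x)).
have M0 : 0 <= fine (m setT) by apply: fine_ge0.
apply: (@eq0_le_eps _ _ (2 + 2 * fine (m setT))); first exact: sqn_ge0.
move=> e' e'0; pose e := Num.min 1 e'.
have e0 : 0 < e by rewrite lt_min ltr01.
have e1 : e <= 1 by rewrite ge_min lexx.
apply: (@le_trans _ _ ((2 + 2 * fine (m setT)) * e)); last first.
  rewrite ler_wpM2l//; first by rewrite addr_ge0// mulr_ge0.
  by rewrite ge_min lexx orbT.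
have S1 : 0 < sqn m f + 1 by rewrite ltr_wpDl ?sqn_ge0.
have [N1 _ HN1] := (cvgrPdist_le _ _).1 (bessel_defect_cvg0 t0) _ (divr_gt0 e0 S1).
have [N2 HN2] := csum_tail mb e0.
pose n := maxn N1 N2.
have h1 : sqn m (Dn n) <= e.
  have := HN1 n (leq_maxl _ _); rewrite /= sub0r normrN ger0_norm; last first.
    by apply: Rintegral_nneg => y; exact: sqn_ge0.
  move=> h; rewrite (le_trans (Dn_le2 n))// (le_trans (ler_wpM2l (sqn_ge0 _ _) h))//.
  by rewrite mulrCA ler_piMr ?(ltW e0)// ler_pdivrMr// mul1r lerDl.
pose V x := \sum_(0 <= j < n) u j x - csum (fun j => u j x).
have Vc : ccontinuous V.
  by apply: ccontinuousB; [apply: ccontinuous_sum => j; exact: uc|exact: Uc].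
have Vi : sqint m V by apply: cbm_sqint; exact: (ccontinuous_cbm compactE Vc).
have Vn : sqn m V <= e ^+ 2 * fine (m setT).
  apply: sqn_bounded; first by case: Vi.
  move=> y; rewrite /V normc_distC; apply: HN2; first exact: leq_maxr.
  by move=> j; exact: Hb.
rewrite (_ : D = (fun x => Dn n x + V x)); last first.
  by apply/funext => y; rewrite /D /Dn /V; ring.
rewrite (le_trans (sqnD2 (Dni n) Vi))// [leRHS]mulrDl lerD ?ler_pM2l//.
rewrite -mulrA ler_pM2l// (le_trans Vn)// mulrC ler_wpM2l//.
by rewrite expr2 ler_piMl// ltW.
Qed.

(** The integral against f is taken term by term in the heat series, which
    gives the spectral expansion of kop t f. *)
Lemma heat_kernel (t : R) f x : 0 < t -> cbm f ->
  kop t f x = cintm m (fun y => heat t x y * f y).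
Proof.
move=> t0 bf; have fi := cbm_sqint m bf.
have [b mb Hb] := heat_majorant t0.
rewrite spectral_expansion//.
have hF := cintm_mul_bfunctional m bf.
have phb j : @cbm _ BE R (phi j) by exact: ccontinuous_cbm.
rewrite (@bfunctional_csum _ _ _ _
  (fun (j : nat) (y : BE) => weight t j * phi j x * ((phi j y)^*)%C) b hF mb)//; last first.
  by move=> j; apply: cbmZ; exact: cbmJ.
congr csum; apply/funext => j; rewrite L2innerE.
rewrite (_ : (fun y => _ * _ * _ * f y) =
    (fun y => (weight t j * phi j x) * (f y * ((phi j y)^*)%C))); last first.
  by apply/funext => y; ring.
rewrite cintmZ; first by ring.
by apply/cbm_cintegrable/cbmM => //; exact: cbmJ.
Qed.

Lemma heat_ccontinuous (t : R) x : 0 < t -> ccontinuous (heat t x).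
Proof.
move=> t0; have [b mb Hb] := heat_majorant t0.
apply: (csum_ccontinuous mb _ (fun j y => Hb j x y)) => j.
by apply: ccontinuousZ; apply: ccontinuousJ; exact: phi_cont.
Qed.

(** Testing a real function against its own negative part reduces the claim to
    continuous_integral0; it is applied to the real part and to plus and minus
    the imaginary part. *)
Lemma continuous_ge0_of_integrals (h : E -> R[i]) : ccontinuous h ->
  (forall f : E -> R, continuous f -> (forall x, 0 <= f x) ->
    0 <= cintm m (fun y => h y * (f y)%:C%C)) -> forall x, 0 <= h x.
Proof.
move=> ch H; have [cr ci] := (ccontinuousP h).1 ch.
have int0 (f : E -> R) : continuous f -> (forall x, 0 <= f x) ->
    \int[m]_y f y = 0 -> forall x, f x = 0.
  exact: (continuous_integral0 compactE fellerT kernelT sk).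
have key (g : E -> R) : continuous g ->
    (forall f : E -> R, continuous f -> (forall x, 0 <= f x) ->
      0 <= \int[m]_y (g y * f y)) -> forall x, 0 <= g x.
  move=> cg Hg x.
  (* the negative part of g, for which g * f = - f ^ 2 *)
  pose f y := Num.max 0 (- g y).
  have cf : continuous f.
    move=> y; apply: (@continuous_max R E (fun=> 0) (fun y => - g y)); first exact: cvg_cst.
    by apply: cvgN; exact: cg.
  have f0 y : 0 <= f y by rewrite le_max lexx.
  have fg y : g y * f y = - (f y * f y).
    rewrite /f; case: (leP 0 (- g y)) => h1; by ring.
  have cff : continuous (fun y => f y * f y) by move=> y; apply: cvgM; exact: cf.
  have [M HM] := continuous_bounded compactE cff.
  have ffi : rintegrable m (fun y : BE => f y * f y).
    exact: (rintegrable_bounded m (continuous_borel cff) HM).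
  have I0 : \int[m]_y (f y * f y) = 0.
    apply/eqP; rewrite eq_le; apply/andP; split.
      have := Hg f cf f0; under eq_Rintegral do rewrite fg -mulN1r.
      by rewrite RintegralZl// mulN1r oppr_ge0.
    by apply: Rintegral_nneg => y; rewrite mulr_ge0.
  have ff0 y : 0 <= f y * f y by rewrite mulr_ge0.
  have /eqP := int0 _ cff ff0 I0 x.
  rewrite mulf_eq0 orbb => /eqP fx0.
  rewrite -oppr_le0; have := fx0; rewrite /f => <-.
  by rewrite le_max lexx orbT.
have ReIm (f : E -> R) : (0 <= cintm m (fun y => h y * (f y)%:C%C)) =
    (\int[m]_y (complex.Im (h y) * f y) == 0) && (0 <= \int[m]_y (complex.Re (h y) * f y)).
  rewrite complex_ge0E.
  have -> : complex.Im (cintm m (fun y => h y * (f y)%:C%C)) =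
      \int[m]_y (complex.Im (h y) * f y).
    by apply: eq_Rintegral => y _; rewrite imM /= mulr0 add0r.
  have -> // : complex.Re (cintm m (fun y => h y * (f y)%:C%C)) =
      \int[m]_y (complex.Re (h y) * f y).
  by apply: eq_Rintegral => y _; rewrite reM /= mulr0 subr0.
move=> x; rewrite complex_ge0E; apply/andP; split; last first.
  apply: (key (fun y => complex.Re (h y)) cr) => f cf f0.
  by have := H f cf f0; rewrite ReIm => /andP[].
rewrite eq_le; apply/andP; split; last first.
  apply: (key (fun y => complex.Im (h y)) ci) => f cf f0.
  have := H f cf f0; rewrite ReIm => /andP[/eqP -> _].
  exact: lexx.
rewrite -oppr_ge0; apply: (key (fun y => - complex.Im (h y))).
  by move=> y; apply: cvgN; exact: ci.
move=> f cf f0; have := H f cf f0; rewrite ReIm => /andP[/eqP I0 _].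
have cif : continuous (fun y => complex.Im (h y) * f y).
  by move=> y; apply: cvgM; [exact: ci|exact: cf].
have [M HM] := continuous_bounded compactE cif.
under eq_Rintegral do rewrite mulNr -mulN1r.
rewrite RintegralZl ?I0 ?mulr0//.
exact: (rintegrable_bounded m (continuous_borel cif) HM).
Qed.

(** The semigroup preserves nonnegative functions, and the heat kernel is
    continuous. *)
Lemma heat_ge0 (t : R) x y : 0 < t -> 0 <= heat t x y.
Proof.
move=> t0; apply: continuous_ge0_of_integrals; first exact: heat_ccontinuous.
move=> f cf f0; have cfC : ccontinuous (fun x => (f x)%:C%C) by exact: ccontinuous_real.
rewrite -heat_kernel//; last exact: ccontinuous_cbm.
rewrite (kop_continuous_eq compactE kernelT sk)//.
apply: (feller_positive fellerT (ltW t0) (ccontinuous_C0 compactE cfC)) => z.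
by rewrite lecR.
Qed.

(** f is uniformly close to T t f for small t, whose eigenfunction expansion
    converges uniformly. *)
Lemma phi_span_dense (f : E -> R[i]) (e : R) : ccontinuous f -> 0 < e ->
  exists (n : nat) (c : nat -> R[i]),
    forall x, normc (f x - \sum_(0 <= j < n) c j * phi j x) <= e.
Proof.
move=> cf e0; have e2 : 0 < e / 2 by rewrite divr_gt0.
have fi : sqint m (f : BE -> R[i]) by apply: cbm_sqint; exact: ccontinuous_cbm.
have /cvgrPdist_le H := feller_continuous fellerT (ccontinuous_C0 compactE cf).
have [d /= d0 Hd] := H _ e2; pose t := d / 2.
have t0 : 0 < t by rewrite divr_gt0.
have td : t < d by rewrite ltr_pdivrMr// ltr_pMr// ltr1n.
have := Hd t; rewrite /= sub0r normrN ger0_norm ?(ltW t0)// => /(_ td t0).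
rewrite sub0r normrN -(kop_continuous_eq compactE kernelT sk t0 cf) => Ht.
have kc : ccontinuous (kop t f) by exact: (kop_continuous compactE fellerT kernelT sk).
have h1 x : normc (f x - kop t f x) <= e / 2.
  apply: le_trans Ht; apply: le_trans (ler_norm _); apply: sup_upper_bound.
    have [M HM] := ccontinuous_cbounded compactE (ccontinuousB kc cf).
    split; first by exists (normc (kop t f x - f x)), x.
    by exists M => _ [y _ <-].
  by exists x => //; rewrite normc_distC.
have [b mb Hb] := expansion_majorant t0 fi.
have [N HN] := csum_tail mb e2.
exists N, (fun j => weight t j * L2inner m f (phi j)) => x.
rewrite (_ : f x - _ = (f x - kop t f x) + (kop t f x -
    \sum_(0 <= j < N) weight t j * L2inner m f (phi j) * phi j x)); last by ring.
rewrite (le_trans (normc_triangle _ _))// [leRHS]splitr lerD//.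
by rewrite spectral_expansion//; apply: HN.
Qed.

End spectral_expansion.

(** * The product formula *)

Section positive_functionals.
Context {R : realType} {E : pmetricType R}.
Hypothesis compactE : compact [set: E].
Local Notation BE := (borel E).
Variable phi : nat -> E -> R[i].
Hypothesis phi_cont : forall j, ccontinuous (phi j).
Hypothesis phi_one : phi 0%N = (fun=> 1).
Hypothesis phi_dense : forall (f : E -> R[i]) (e : R), ccontinuous f -> 0 < e ->
  exists (n : nat) (c : nat -> R[i]),
    forall x, normc (f x - \sum_(0 <= j < n) c j * phi j x) <= e.

(** The F n are contractions, so convergence on the phi j extends to C(E) by
    density. The limit is a positive functional that maps the constant 1 to 1,
    and the Riesz theorem represents it. *)
Lemma positive_functionals_limit (F : nat -> (BE -> R[i]) -> R[i]) (a : nat -> R[i]) :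
  (forall n, bfunctional (F n)) ->
  (forall n (f : E -> R), continuous f -> (forall x, 0 <= f x) ->
     0 <= F n (fun x => (f x)%:C%C)) ->
  (forall n f (M : R), ccontinuous f -> (forall x, normc (f x) <= M) ->
     normc (F n f) <= M) ->
  (forall j, ((fun n => F n (phi j)) : nat -> (R[i])^o) @ \oo --> (a j : (R[i])^o)) ->
  a 0%N = 1 ->
  exists P : probability BE R, forall j, a j = cintm P (phi j).
Proof.
move=> hF Fpos FM Fa a0.
have cb (f : E -> R[i]) : ccontinuous f -> @cbm _ BE R f by exact: ccontinuous_cbm.
have Fcvg (f : E -> R[i]) : ccontinuous f ->
    exists l, ((fun n => F n f) : nat -> (R[i])^o) @ \oo --> (l : (R[i])^o).
  move=> cf; apply: ccauchy_cvg => e e0.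
  have e4 : 0 < e / 4 by rewrite divr_gt0.
  have [n [c Hc]] := phi_dense cf e4.
  pose g x := \sum_(0 <= j < n) c j * phi j x.
  have cg : ccontinuous g.
    by apply: ccontinuous_sum => j; apply: ccontinuousZ; exact: phi_cont.
  have Fg : ((fun i => F i g) : nat -> (R[i])^o) @ \oo -->
      (\sum_(0 <= j < n) c j * a j : (R[i])^o).
    rewrite (_ : (fun i => F i g) = (fun i => \sum_(0 <= j < n) c j * F i (phi j))).
      by apply: ccvg_sum => j; apply: ccvgM; [exact: ccvg_cst|exact: Fa].
    apply/funext => i; rewrite /g (bfunctional_sum (hF i))// => j.
    exact/cb/phi_cont.
  move/ccvg_normcP : Fg => /cvgrPdist_lt/(_ _ e4)[N _ HN].
  exists N => i j Ni Nj.
  have cfg : ccontinuous (fun x => f x - g x) by exact: ccontinuousB.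
  have H k : (N <= k)%N -> normc (F k f - \sum_(0 <= j < n) c j * a j) < e / 2.
    move=> Nk; rewrite (_ : F k f - _ = F k (fun x => f x - g x) +
        (F k g - \sum_(0 <= j < n) c j * a j)); last first.
      by rewrite (bfunctionalB (hF k) (cb _ cf) (cb _ cg)); ring.
    rewrite (le_lt_trans (normc_triangle _ _))// (_ : e / 2 = e / 4 + e / 4); last by field.
    apply: ler_ltD; first exact: FM.
    by have := HN k Nk; rewrite /= sub0r normrN ger0_norm ?normc_ge0.
  rewrite (_ : F i f - _ = (F i f - \sum_(0 <= j < n) c j * a j) -
    (F j f - \sum_(0 <= j < n) c j * a j)); last by ring.
  rewrite (le_lt_trans (normc_triangle _ _))// normc_opp [ltRHS]splitr.
  by apply: ltrD; exact: H.
pose L (f : E -> R[i]) : R[i] := lim ((fun n => F n f : (R[i])^o) @ \oo).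
have Lc (f : E -> R[i]) : ccontinuous f ->
    ((fun n => F n f) : nat -> (R[i])^o) @ \oo --> (L f : (R[i])^o).
  by move=> /Fcvg[l Hl]; rewrite /L (ccvg_lim Hl).
have Llin c (f g : E -> R[i]) : ccontinuous f -> ccontinuous g ->
    L (fun x => c * f x + g x) = c * L f + L g.
  move=> cf cg; apply: ccvg_lim.
  rewrite (_ : (fun n => _) = (fun n => c * F n f + F n g)).
    apply: ccvgD; last exact: Lc.
    by apply: ccvgM; [exact: ccvg_cst|exact: Lc].
  by apply/funext => n; rewrite (bfunctional_lin (hF n) c (cb _ cf) (cb _ cg)).
have Lphi j : L (phi j) = a j by apply: ccvg_lim; exact: Fa.
have Lpos (f : E -> R) : continuous f -> (forall x, 0 <= f x) ->
    0 <= L (fun x => (f x)%:C%C).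
  move=> cf f0; have cfC := ccontinuous_real cf.
  have /ccvgP[re im] := Lc _ cfC.
  have Fp n := Fpos n f cf f0.
  rewrite complex_ge0E; apply/andP; split.
    rewrite (_ : (fun n => complex.Im _) = (fun=> 0)) in im.
      by rewrite (cvg_unique _ im (cvg_cst 0)).
    by apply/funext => n; have := Fp n; rewrite complex_ge0E => /andP[/eqP].
  apply: (ler_cvg_to (cvg_cst 0) re); apply: nearW => n.
  by have := Fp n; rewrite complex_ge0E => /andP[].
pose l (f : E -> R) := complex.Re (L (fun x => (f x)%:C%C)).
have llin c (f g : E -> R) : continuous f -> continuous g ->
    l (fun x => c * f x + g x) = c * l f + l g.
  move=> cf cg; have cfC := ccontinuous_real cf; have cgC := ccontinuous_real cg.
  rewrite /l (_ : (fun x => _) = (fun x => c%:C%C * (f x)%:C%C + (g x)%:C%C)).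
    by rewrite Llin// reD reM /= mul0r subr0.
  by apply/funext => x; rewrite real_complexD real_complexM.
have lpos (f : E -> R) : continuous f -> (forall x, 0 <= f x) -> 0 <= l f.
  by move=> cf f0; have := Lpos f cf f0; rewrite complex_ge0E => /andP[].
have l1 : l (fun=> 1) = 1.
  by rewrite /l (_ : (fun=> _) = phi 0%N) ?Lphi ?a0// phi_one.
(* M + f is nonnegative for large M, so L f is real *)
have lE (f : E -> R) : continuous f -> L (fun x => (f x)%:C%C) = (l f)%:C%C.
  move=> cf; have [M HM] := continuous_bounded compactE cf.
  have cfM : continuous (fun x => M + f x) by move=> x; apply: cvgD; [exact: cvg_cst|exact: cf].
  have fM0 x : 0 <= M + f x.
    by have := HM x; rewrite ler_norml => /andP[h _]; rewrite -lerBlDl sub0r.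
  have := Lpos _ cfM fM0; have c1 : continuous (fun _ : E => 1 : R) by move=> x; exact: cvg_cst.
  rewrite (_ : (fun x => _) = (fun x => M%:C%C * (phi 0%N x) + (f x)%:C%C)); last first.
    by apply/funext => x; rewrite real_complexD phi_one mulr1.
  rewrite Llin//; last exact: ccontinuous_real.
  rewrite Lphi a0 mulr1 complex_ge0E imD /= add0r => /andP[/eqP im0 _].
  by apply: complex_eq.
have [P HP] := riesz_representation compactE llin lpos l1.
exists P => j; have /ccontinuousP[cr ci] := @phi_cont j.
rewrite -Lphi (_ : phi j = (fun x => 'i%C * (complex.Im (phi j x))%:C%C +
  (complex.Re (phi j x))%:C%C)); last first.
  by apply/funext => x; apply: complex_eq; rewrite ?reD ?imD ?reM ?imM /=; ring.
rewrite Llin; [|exact: ccontinuous_real|exact: ccontinuous_real].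
rewrite !lE// -!HP//.
apply: complex_eq; rewrite ?reD ?imD ?reM ?imM /=.
- transitivity (\int[P]_x complex.Re (phi j x)); first by ring.
  by apply: eq_Rintegral => x _; ring.
- transitivity (\int[P]_x complex.Im (phi j x)); first by ring.
  by apply: eq_Rintegral => x _; ring.
Qed.

End positive_functionals.

(** What the product formula and the convolution use of the semigroup:
    continuity and orthogonality of the eigenfunctions, normal convergence of
    their series, positivity of the heat kernel and density of the span in
    C(E). *)
Record eigensystem (R : realType) (E : pmetricType R)
    (m : {finite_measure set (borel E) -> \bar R}) (lambda : nat -> R)
    (phi : nat -> E -> R[i]) : Prop := {
  es_continuous : forall j, ccontinuous (phi j) ;
  es_orthogonal : orthogonal_family m phi ;
  es_rate_ge0 : forall j, 0 <= lambda j ;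
  es_one : phi 0%N = (fun=> 1) ;
  es_heat_majorant : forall t : R, 0 < t -> exists2 b : nat -> R, majorant b &
    forall j x y, normc (weight m lambda phi t j * phi j x * ((phi j y)^*)%C) <= b j ;
  es_triple_majorant : forall t : R, 0 < t -> exists2 b : nat -> R, majorant b &
    forall j x y z, normc (phi j x) * normc (phi j y) * normc (phi j z)
      * (expR (- lambda j * t) / sqn m (phi j)) <= b j ;
  es_heat_ge0 : forall (t : R) x y, 0 < t -> 0 <= heat m lambda phi t x y ;
  es_dense : forall (f : E -> R[i]) (e : R), ccontinuous f -> 0 < e ->
    exists (n : nat) (c : nat -> R[i]),
      forall x, normc (f x - \sum_(0 <= j < n) c j * phi j x) <= e }.

Section product_formula.
Context {R : realType} {E : pmetricType R}.
Hypothesis compactE : compact [set: E].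
Local Notation BE := (borel E).
Variable m : {finite_measure set BE -> \bar R}.
Variables (lambda : nat -> R) (phi : nat -> E -> R[i]).
Hypothesis es : eigensystem m lambda phi.
Local Notation s j := (sqn m (phi j)).
Local Notation ex t j := (expR (- lambda j * t)).
Local Notation weight := (weight m lambda phi).
Local Notation heat := (heat m lambda phi).

Let phi_cont := es_continuous es.

Lemma eigenfunction_cbm j : @cbm _ BE R (phi j).
Proof. exact: ccontinuous_cbm. Qed.

Let phi_sqint j : sqint m (phi j).
Proof. by apply/L2P; have [] := es_orthogonal es. Qed.

Lemma eigenfunction_orth j k : cintm m (fun z => phi j z * ((phi k z)^*)%C) =
  if j == k then (s j)%:C%C else 0.
Proof.
rewrite -L2innerE; have [->|jk] := eqVneq; first by rewrite L2inner_self.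
by have [_ _ ->] := es_orthogonal es.
Qed.

Lemma weight_sqn (t : R) j : weight t j * (s j)%:C%C = (ex t j)%:C%C.
Proof.
by rewrite weightE -real_complexM mulrAC mulVf ?mul1r// (orthogonal_sqn_neq0 (es_orthogonal es)).
Qed.

Lemma weightD (t u : R) j : weight t j * weight u j * (s j)%:C%C = weight (t + u) j.
Proof.
by rewrite -mulrA weight_sqn !weightE -real_complexM exD mulrA.
Qed.

(** The series q with its last factor conjugated. As a density with respect to
    m it has the integrals against phi k of a measure representing the product
    at (x, y), up to the factor exp (- lambda_k t). *)
Definition product_kernel (t : R) (x y z : E) : R[i] :=
  csum (fun j => weight t j * phi j x * phi j y * ((phi j z)^*)%C).

Definition triple_series (t : R) (x y z : E) : R[i] :=
  csum (fun j => weight t j * phi j x * phi j y * phi j z).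

(** The heat kernel without its conjugation. *)
Definition heat_pairing (t : R) (x y : E) : R[i] :=
  csum (fun j => weight t j * phi j x * phi j y).

Lemma q_termE (t : R) x y xi :
  q_term m lambda phi t x y xi = (fun j => weight t j * phi j x * phi j y * phi j xi).
Proof.
apply/funext => j; rewrite /q_term L2norm_sqr//.
by rewrite weightE real_complexM.
Qed.

Lemma qE (t : R) x y xi : q m lambda phi t x y xi = triple_series t x y xi.
Proof. by rewrite /q q_termE. Qed.

Lemma triple_term_le (t : R) : 0 < t -> exists2 b : nat -> R, majorant b &
  forall j x y z, normc (weight t j * phi j x * phi j y * phi j z) <= b j.
Proof.
move=> /(es_triple_majorant es)[b mb Hb]; exists b => // j x y z.
rewrite !normc_mul normc_weight; apply: le_trans (Hb j x y z).
by rewrite le_eqVlt; apply/orP; left; apply/eqP; ring.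
Qed.

Lemma q_absolutely_convergent (t : R) x y xi : 0 < t ->
  cvgn (series (fun j => normc (q_term m lambda phi t x y xi j))).
Proof.
move=> /triple_term_le[b mb Hb]; rewrite q_termE.
exact: (cvg_series_normc mb (fun j => Hb j x y xi)).
Qed.

Lemma product_term_le (t : R) : 0 < t -> exists2 b : nat -> R, majorant b &
  forall j x y z, normc (weight t j * phi j x * phi j y * ((phi j z)^*)%C) <= b j.
Proof.
move=> /triple_term_le[b mb Hb]; exists b => // j x y z.
by have := Hb j x y z; rewrite !normc_mul normc_conj.
Qed.

Lemma pairing_term_le (t : R) : 0 < t -> exists2 b : nat -> R, majorant b &
  forall j x y, normc (weight t j * phi j x * phi j y) <= b j.
Proof.
move=> /(es_heat_majorant es)[b mb Hb]; exists b => // j x y.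
by have := Hb j x y; rewrite !normc_mul normc_conj.
Qed.

Lemma product_kernel_cbm (t : R) x y : 0 < t -> @cbm _ BE R (product_kernel t x y).
Proof.
move=> /product_term_le[b mb Hb].
apply: (@csum_cbm _ _ _ (fun (j : nat) (z : BE) =>
  weight t j * phi j x * phi j y * ((phi j z)^*)%C) b mb).
  by move=> j; apply: cbmZ; apply: cbmJ; exact: eigenfunction_cbm.
by move=> j z; exact: Hb.
Qed.

Section representation.
Variable nu : E -> E -> probability BE R.
Hypothesis nuP : forall x y, represents_product phi x y (nu x y).

(** The integral turns each phi j u of the heat series into phi j x * phi j y. *)
Lemma product_kernel_integral (t : R) x y z : 0 < t ->
  product_kernel t x y z = cintm (nu x y) (fun u => heat t u z).
Proof.
move=> /(es_heat_majorant es)[b mb Hb].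
rewrite (@bfunctional_csum _ _ _ _ (fun (j : nat) (u : BE) =>
  weight t j * phi j u * ((phi j z)^*)%C) b (cintm_bfunctional (nu x y)) mb).
- congr csum; apply/funext => j.
  under [X in cintm _ X]eq_fun do rewrite mulrAC.
  rewrite cintmZ; last exact/cbm_cintegrable/eigenfunction_cbm.
  by rewrite -nuP; ring.
- move=> j; under eq_fun do rewrite mulrAC.
  by apply: cbmZ; exact: eigenfunction_cbm.
- by move=> j u; exact: Hb.
Qed.

Lemma product_kernel_ge0_of_representation (t : R) x y z : 0 < t ->
  0 <= product_kernel t x y z.
Proof.
move=> t0; rewrite product_kernel_integral//; apply: cintm_ge0 => u.
exact: (es_heat_ge0 es).
Qed.

(** Evaluation of the heat kernel at a removes one factor, and the integral
    puts two in the place of the other one. *)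
Lemma heat_pairing_integral (t : R) a x y : 0 < t -> (forall j, phi j a = 1) ->
  heat_pairing t x y = cintm (nu x y) (fun u => heat t u a).
Proof.
move=> t0 pa; rewrite -product_kernel_integral//; congr csum; apply/funext => j.
by rewrite pa (conjc_real 1) mulr1.
Qed.

Lemma triple_series_integral (t : R) x y z : 0 < t ->
  triple_series t x y z = cintm (nu x y) (fun u => heat_pairing t u z).
Proof.
move=> /pairing_term_le[b mb Hb].
rewrite (@bfunctional_csum _ _ _ _ (fun (j : nat) (u : BE) =>
  weight t j * phi j u * phi j z) b (cintm_bfunctional (nu x y)) mb).
- congr csum; apply/funext => j.
  under [X in cintm _ X]eq_fun do rewrite mulrAC.
  rewrite cintmZ; last exact/cbm_cintegrable/eigenfunction_cbm.
  by rewrite -nuP; ring.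
- move=> j; under eq_fun do rewrite mulrAC.
  by apply: cbmZ; exact: eigenfunction_cbm.
- by move=> j u; exact: Hb.
Qed.

Lemma triple_series_ge0_of_representation (t : R) a x y z : 0 < t ->
  (forall j, phi j a = 1) -> 0 <= triple_series t x y z.
Proof.
move=> t0 pa; rewrite triple_series_integral//; apply: cintm_ge0 => u.
rewrite (heat_pairing_integral u z t0 pa); apply: cintm_ge0 => v.
exact: (es_heat_ge0 es).
Qed.

End representation.

Lemma real_valued_triple_series (t : R) x y z : real_valued phi ->
  triple_series t x y z = product_kernel t x y z.
Proof.
move=> rphi; congr csum; apply/funext => j; rewrite conjc_fix//.
by have := rphi j z; rewrite complex_realE => /eqP.
Qed.

(** By orthogonality, only products of terms with the same index survive
    integration, and phi j a = 1 removes the extra factor. *)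
Lemma triple_series_convolution (t : R) a x y z : 0 < t -> (forall j, phi j a = 1) ->
  product_kernel (t + t) x y z =
  cintm m (fun u => triple_series t x y u * ((triple_series t u a z)^*)%C).
Proof.
move=> t0 pa; have [b mb Hb] := triple_term_le t0.
pose h (u : BE) : R[i] := ((triple_series t u a z)^*)%C.
have hE : h = (fun u => csum (fun j => weight t j * ((phi j z)^*)%C * ((phi j u)^*)%C)).
  apply/funext => u; rewrite /h -(csumJ mb (fun j => Hb j u a z)).
  by congr csum; apply/funext => j; rewrite pa !conjc_mul weight_conj (conjc_real 1); ring.
have [b2 mb2 Hb2] := pairing_term_le t0.
have hterm j (u : BE) : normc (weight t j * ((phi j z)^*)%C * ((phi j u)^*)%C) <= b2 j.
  by have := Hb2 j z u; rewrite !normc_mul !normc_conj.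
have hterm_cbm j : cbm (fun u : BE => weight t j * ((phi j z)^*)%C * ((phi j u)^*)%C).
  by apply: cbmZ; apply: cbmJ; exact: eigenfunction_cbm.
have bh : cbm h by rewrite hE; exact: (csum_cbm mb2 hterm_cbm hterm).
have coef j : cintm m (fun u => phi j u * h u) = (ex t j)%:C%C * ((phi j z)^*)%C.
  rewrite hE; under [X in cintm _ X]eq_fun do rewrite mulrC.
  rewrite (@bfunctional_csum _ _ _ _ (fun (i : nat) (u : BE) =>
    weight t i * ((phi i z)^*)%C * ((phi i u)^*)%C) b2
    (cintm_mul_bfunctional m (eigenfunction_cbm j)) mb2 hterm_cbm hterm).
  have inner i : cintm m (fun u => weight t i * ((phi i z)^*)%C * ((phi i u)^*)%C * phi j u)
      = weight t i * ((phi i z)^*)%C * (if j == i then (s j)%:C%C else 0).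
    rewrite -eigenfunction_orth -cintmZ; last first.
      by apply/cbm_cintegrable/cbmM; [|apply: cbmJ]; exact: eigenfunction_cbm.
    by congr cintm; apply/funext => u; ring.
  rewrite (csum_single (k := j)) => [|i ij]; last by rewrite inner eq_sym (negbTE ij) mulr0.
  by rewrite inner eqxx mulrAC weight_sqn.
rewrite (@bfunctional_csum _ _ _ _ (fun (j : nat) (u : BE) =>
    weight t j * phi j x * phi j y * phi j u) b (cintm_mul_bfunctional m bh) mb).
- congr csum; apply/funext => j.
  rewrite -[in LHS]weightD (_ : cintm m _ =
      weight t j * phi j x * phi j y * cintm m (fun u => phi j u * h u)).
    by rewrite coef -weight_sqn; ring.
  rewrite -cintmZ; last by apply/cbm_cintegrable/cbmM => //; exact: eigenfunction_cbm.
  by congr cintm; apply/funext => u; ring.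
- by move=> j; apply: cbmZ; exact: eigenfunction_cbm.
- by move=> j u; exact: Hb.
Qed.

Lemma product_kernel_ge0_of_triple_series a : (forall j, phi j a = 1) ->
  (forall (t : R) x y z, 0 < t -> 0 <= triple_series t x y z) ->
  forall (t : R) x y z, 0 < t -> 0 <= product_kernel t x y z.
Proof.
move=> pa H t x y z t0; have t2 : 0 < t / 2 by rewrite divr_gt0.
rewrite (splitr t) (triple_series_convolution x y z t2 pa); apply: cintm_ge0 => u.
have h := H _ u a z t2; rewrite conjc_fix; first by rewrite mulr_ge0// H.
by move: h; rewrite complex_ge0E => /andP[/eqP].
Qed.

Lemma product_kernel_coef (t : R) x y k : 0 < t ->
  cintm m (fun z => phi k z * product_kernel t x y z) = (ex t k)%:C%C * (phi k x * phi k y).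
Proof.
move=> t0; have [b mb Hb] := product_term_le t0.
under [X in cintm _ X]eq_fun do rewrite mulrC.
have inner i : cintm m (fun u => weight t i * phi i x * phi i y * ((phi i u)^*)%C * phi k u)
    = weight t i * phi i x * phi i y * (if k == i then (s k)%:C%C else 0).
  rewrite -eigenfunction_orth -cintmZ; last first.
    by apply/cbm_cintegrable/cbmM; [|apply: cbmJ]; exact: eigenfunction_cbm.
  by congr cintm; apply/funext => u; ring.
rewrite (@bfunctional_csum _ _ _ _ (fun (j : nat) (u : BE) =>
    weight t j * phi j x * phi j y * ((phi j u)^*)%C) b
    (cintm_mul_bfunctional m (eigenfunction_cbm k)) mb).
- rewrite (csum_single (k := k)) => [|i ij]; last by rewrite inner eq_sym (negbTE ij) mulr0.
  by rewrite inner eqxx -weight_sqn; ring.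
- by move=> j; apply: cbmZ; apply: cbmJ; exact: eigenfunction_cbm.
- by move=> j u; exact: Hb.
Qed.

(** As t tends to 0, the measures with density product_kernel t x y have mass
    exp (- lambda_0 t) at most 1, and their integrals against phi k tend to
    phi k x * phi k y: a limit point is the measure sought. *)
Theorem representation_of_product_kernel x y :
  (forall (t : R) z, 0 < t -> 0 <= product_kernel t x y z) ->
  exists nu, represents_product phi x y nu.
Proof.
move=> r0; pose t n : R := n.+1%:R^-1; have t0 n : 0 < t n by rewrite invr_gt0.
pose F n (f : BE -> R[i]) := cintm m (fun z => f z * product_kernel (t n) x y z).
have hF n : bfunctional (F n).
  by apply: cintm_mul_bfunctional; exact: product_kernel_cbm.
have Fphi n j : F n (phi j) = (ex (t n) j)%:C%C * (phi j x * phi j y).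
  exact: product_kernel_coef.
have F1 n : \int[m]_z complex.Re (product_kernel (t n) x y z) <= 1.
  have := Fphi n 0%N; rewrite /F (es_one es) !mulr1 => /(congr1 (@complex.Re R)).
  rewrite /= => h; rewrite (_ : \int[m]_z _ = ex (t n) 0%N).
    by rewrite expR_le1 mulNr oppr_le0 mulr_ge0//; [exact: (es_rate_ge0 es)|exact: ltW].
  by rewrite -h; apply: eq_Rintegral => z _; rewrite mul1r.
apply: (positive_functionals_limit compactE phi_cont (es_one es) (es_dense es)
  (F := F) (a := fun j => phi j x * phi j y)) => //.
- move=> n f cf f0; apply: cintm_ge0 => z; rewrite mulr_ge0 ?r0//.
  by rewrite lecR.
- move=> n f M cf fM; have bf := ccontinuous_cbm compactE cf.
  have rb := product_kernel_cbm x y (t0 n).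
  have M0 : 0 <= M by rewrite (le_trans (normc_ge0 _) (fM point)).
  have fri : cintegrable m (fun z => f z * product_kernel (t n) x y z).
    exact/cbm_cintegrable/cbmM.
  have ri : rintegrable m (fun z => complex.Re (product_kernel (t n) x y z)).
    by have [] := cbm_cintegrable m rb.
  rewrite (le_trans (normc_cintm fri))//.
  rewrite (@le_trans _ _ (\int[m]_z (M * complex.Re (product_kernel (t n) x y z))))//.
    apply: Rintegral_le.
    + exact: cintegrable_normc.
    + exact: rintegrableZ.
    + move=> z; rewrite normc_mul.
      rewrite (normc_ge0E (r0 (t n) z (t0 n))) ler_wpM2r//.
      by have := r0 (t n) z (t0 n); rewrite complex_ge0E => /andP[].
  by rewrite RintegralZl// ler_piMr.
- move=> j; rewrite (_ : (fun n => F n (phi j)) =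
    (fun n => (ex (t n) j)%:C%C * (phi j x * phi j y))); last by apply/funext.
  rewrite -[phi j x * _ in X in _ --> X]mul1r.
  apply: ccvgM; last exact: ccvg_cst.
  apply: cvg_real_complex; rewrite -[X in _ --> X]expR0.
  apply: continuous_cvg; first exact: continuous_expR.
  rewrite -[X in _ --> X](mulr0 (- lambda j)); apply: cvgM; first exact: cvg_cst.
  exact: cvg_harmonic.
- by rewrite (es_one es) mulr1.
Qed.

Theorem nonnegative_iff_representable :
  (real_valued phi \/ exists a, forall j, phi j a = 1) ->
  (forall (t : R) x y xi, 0 < t -> 0 <= q m lambda phi t x y xi) <->
  (forall x y, exists nu, represents_product phi x y nu).
Proof.
move=> hyp; split=> [H x y|H1].
  apply: representation_of_product_kernel => t z t0.
  case: hyp => [rphi|[a pa]].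
    by rewrite -real_valued_triple_series// -qE H.
  by apply: (product_kernel_ge0_of_triple_series pa) => // u ? ? ? u0; rewrite -qE H.
have [nu nuP] : {nu & forall x y, represents_product phi x y (nu x y)}.
  pose nu x := projT1 (boolp.choice (H1 x)).
  by exists nu => x y; exact: (projT2 (boolp.choice (H1 x))).
move=> t x y xi t0; rewrite qE; case: hyp => [rphi|[a pa]].
  rewrite real_valued_triple_series//.
  exact: (product_kernel_ge0_of_representation nuP).
exact: (triple_series_ge0_of_representation nuP _ _ _ t0 pa).
Qed.

End product_formula.

(** * The convolution *)

Section functional_measure.
Context d (T : measurableType d) {R : realType}.
Variable F : (T -> R[i]) -> R[i].
Hypotheses (hF : bfunctional F) (cF : bounded_cvg_continuous F).

Definition functional_set_fun (A : set T) : R[i] :=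
  if `[< measurable A >] then F (cind A) else 0.

Lemma functional_set_fun_cmeasure : functional_set_fun \in @cmeasure_pred _ T R.
Proof.
apply/cmeasure_predP; rewrite /functional_set_fun; split=> [A mA||A mA tA].
- by rewrite asboolF.
- rewrite asboolT// (_ : cind set0 = (fun=> 0)) ?(bfunctional0 hF)//.
  by apply/funext => x; rewrite cind_notin.
- rewrite asboolT; last exact: bigcupT_measurable.
  have bA i : @cbm _ T R (cind (A i)) by exact: cbm_cind.
  rewrite (_ : (fun n => _) = (fun n => F (fun x => \sum_(0 <= i < n) cind (A i) x))).
    apply: (cF (M := 1)) => [n|n x|x]; [|exact: normc_sum_cind|exact: cvg_sum_cind].
    by apply: cmeasurable_sum => i; have [] := bA i.
  apply/funext => n.
  transitivity (F (fun x => \sum_(0 <= i < n) 1 * cind (A i) x)).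
    rewrite (bfunctional_sum hF)//; apply: eq_bigr => i _.
    by rewrite mul1r asboolT.
  by congr F; apply/funext => x; apply: eq_bigr => i _; rewrite mul1r.
Qed.

(** The complex measure that represents the functional F. *)
Definition functional_cmeasure : cmeasure T R := CMeasure functional_set_fun_cmeasure.

Lemma functional_cmeasureE A : measurable A -> functional_cmeasure A = F (cind A).
Proof. by move=> mA; rewrite /= /functional_set_fun asboolT. Qed.

Lemma cint_functional_cmeasure f : cbm f -> cint functional_cmeasure f = F f.
Proof.
apply: bfunctional_ext => [|//|A mA]; first exact: cint_bfunctional.
by rewrite cint_cind// functional_cmeasureE.
Qed.

End functional_measure.

Section nonnegative_cmeasure.
Context d (T : measurableType d) {R : realType}.
Variable mu : cmeasure T R.
Hypothesis mu_ge0 : forall A, measurable A -> 0 <= mu A.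
Hypothesis mu_setT : mu setT = 1.

Definition nonneg_measure (A : set T) : \bar R := (complex.Re (mu A))%:E.

Let nonneg_measure0 : nonneg_measure set0 = 0%E.
Proof. by rewrite /nonneg_measure cmeasure_set0. Qed.

Let nonneg_measure_ge0 A : (0 <= nonneg_measure A)%E.
Proof.
rewrite /nonneg_measure lee_fin; have [mA|mA] := pselect (measurable A).
  by have := mu_ge0 mA; rewrite complex_ge0E => /andP[].
by have [h _ _] := cmeasureP mu; rewrite (h A mA).
Qed.

Let nonneg_measure_sigma_additive : semi_sigma_additive nonneg_measure.
Proof.
move=> F mF tF mUF; have [_ _ /(_ F mF tF) h] := cmeasureP mu.
have /ccvgP[re _] := h.
under eq_fun do rewrite sumEFin.
apply/cvg_EFin; first exact: nearW.
apply: cvg_trans re; apply: near_eq_cvg; apply: nearW => n /=.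
by rewrite re_sum.
Qed.

HB.instance Definition _ := isMeasure.Build _ T R nonneg_measure
  nonneg_measure0 nonneg_measure_ge0 nonneg_measure_sigma_additive.

Let nonneg_measureT : nonneg_measure setT = 1%E.
Proof. by rewrite /nonneg_measure mu_setT. Qed.

HB.instance Definition _ := Measure_isProbability.Build _ T R nonneg_measure
  nonneg_measureT.

Lemma cmeasure_probability : exists P : probability T R, mu = of_measure P.
Proof.
exists nonneg_measure; apply: cmeasure_ext => A mA.
rewrite /of_measure /= /of_measure_fun asboolT//= /nonneg_measure /=.
have := mu_ge0 mA; rewrite complex_ge0E => /andP[/eqP im0 _].
by apply: complex_eq.
Qed.

End nonnegative_cmeasure.

Section iterated_integral.
Context d1 d2 (T1 : measurableType d1) (T2 : measurableType d2) {R : realType}.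

Lemma cbm_section (G : T1 * T2 -> R[i]) y : cbm G -> cbm (fun x => G (x, y)).
Proof.
move=> [[mr mi] [M GM]]; split; last by exists M => x.
by split; [apply: (measurableT_comp mr)|apply: (measurableT_comp mi)];
  exact: measurable_pair2.
Qed.

(** Adding the constant M makes the integrand nonnegative, as Tonelli's
    theorem requires. *)
Lemma Rintegral_section_measurable (mu : {finite_measure set T1 -> \bar R})
    (h : T1 * T2 -> R) (M : R) : measurable_fun setT h -> (forall z, `|h z| <= M) ->
  measurable_fun setT (fun y => \int[mu]_x h (x, y)).
Proof.
move=> mh hM; pose G (z : T1 * T2) := (h z + M)%:E.
have mG : measurable_fun setT G.
  by apply/measurable_EFinP; apply: measurable_funD => //; exact: measurable_cst.
have G0 z : (0 <= G z)%E.
  by have := hM z; rewrite lee_fin ler_norml => /andP[h1 _]; rewrite -lerBlDr sub0r.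
have mF := @measurable_fun_fubini_tonelli_G _ _ T1 T2 R mu G mG G0.
have hy y : measurable_fun setT (fun x => h (x, y)).
  by apply: (measurableT_comp mh); exact: measurable_pair2.
rewrite (_ : (fun y => _) = (fun y => fine (fubini_G mu G y) - M * fine (mu setT))).
  apply: measurable_funB; last exact: measurable_cst.
  by apply: measurableT_comp => //; exact: mF.
apply/funext => y.
have hi : rintegrable mu (fun x => h (x, y)) by exact: (rintegrable_bounded mu (hy y) (fun x => hM (x, y))).
rewrite /fubini_G -/(Rintegral mu setT (fun x => h (x, y) + M)).
rewrite RintegralD//; last exact: rintegrable_cst.
by rewrite Rintegral_cst// addrK.
Qed.

Lemma cintm_section_cbm (mu : {finite_measure set T1 -> \bar R}) (G : T1 * T2 -> R[i]) :
  cbm G -> cbm (fun y => cintm mu (fun x => G (x, y))).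
Proof.
move=> bG; have [[mr mi] [M GM]] := bG; split; last first.
  exists (M * fine (mu setT)) => y; apply: normc_cintm_bounded => //.
  exact: cbm_section.
split.
- apply: (@Rintegral_section_measurable mu (fun z => complex.Re (G z)) M) => // z.
  exact: le_trans (abs_Re_le _) (GM z).
- apply: (@Rintegral_section_measurable mu (fun z => complex.Im (G z)) M) => // z.
  exact: le_trans (abs_Im_le _) (GM z).
Qed.

Lemma cint_section_cbm (mu : cmeasure T1 R) (G : T1 * T2 -> R[i]) :
  cbm G -> cbm (fun y => cint mu (fun x => G (x, y))).
Proof.
move=> bG; have [m1 [m2 [m3 [m4 [H _]]]]] := cint_decomposition mu.
under eq_fun do rewrite H.
have b := cintm_section_cbm _ bG.
by apply: cbmD; [|apply: cbmZ]; apply: cbmD => //; exact: cbmZ.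
Qed.

End iterated_integral.

Section convolution.
Context {R : realType} {E : pmetricType R}.
Hypothesis compactE : compact [set: E].
Local Notation BE := (borel E).
Variable m : {finite_measure set BE -> \bar R}.
Variables (lambda : nat -> R) (phi : nat -> E -> R[i]).
Hypothesis es : eigensystem m lambda phi.
Variable nu : E -> E -> probability BE R.
Hypothesis nuP : forall x y, represents_product phi x y (nu x y).
Variable a : E.
Hypothesis phi_a : forall j, phi j a = 1.
Local Notation M := (cmeasure BE R).
Local Notation tv := (@Defs.total_variation _ BE R).

Let phi_cbm j : @cbm _ BE R (phi j) := eigenfunction_cbm compactE es j.
Let cb (f : E -> R[i]) (cf : ccontinuous f) : @cbm _ BE R f := ccontinuous_cbm compactE cf.

(** For fixed y, the generalized translate of f by y, as a function of both
    variables. *)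
Definition translation (f : BE -> R[i]) (z : BE * BE) : R[i] := cintm (nu z.1 z.2) f.

Lemma normc_translation f (M : R) z : cbm f -> (forall x, normc (f x) <= M) ->
  normc (translation f z) <= M.
Proof.
move=> bf fM; rewrite (le_trans (normc_cintm_bounded (nu z.1 z.2) bf fM))//.
rewrite [X in fine X](_ : _ = 1%E) ?mulr1//; exact: probability_setT.
Qed.

Lemma translation_sum (n : nat) (c : nat -> R[i]) x y :
  translation (fun u => \sum_(0 <= j < n) c j * phi j u) (x, y) =
  \sum_(0 <= j < n) c j * (phi j x * phi j y).
Proof.
rewrite /translation (bfunctional_sum (cintm_bfunctional (nu x y)))//.
by apply: eq_bigr => j _; rewrite nuP.
Qed.

Lemma translation_approximation (f : E -> R[i]) (e : R) : ccontinuous f -> 0 < e ->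
  exists (n : nat) (c : nat -> R[i]),
    (forall x, normc (f x - \sum_(0 <= j < n) c j * phi j x) <= e) /\
    forall x y, normc (translation f (x, y) - \sum_(0 <= j < n) c j * (phi j x * phi j y)) <= e.
Proof.
move=> cf e0; have [n [c Hc]] := es_dense es cf e0.
exists n, c; split=> // x y; have bf := cb cf.
have bg : @cbm _ BE R (fun u => \sum_(0 <= j < n) c j * phi j u).
  by apply: cbm_sum => j; exact: cbmZ.
rewrite -translation_sum /translation -(bfunctionalB (cintm_bfunctional (nu x y)) bf bg).
by apply: (@normc_translation _ e (x, y)) => //; exact: cbmB.
Qed.

(** For continuous f the translate is a uniform limit of combinations of the
    products phi j x * phi j y; bounded Borel functions follow by
    cbm_induction. *)
Lemma translation_cbm f : cbm f -> cbm (translation f).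
Proof.
move=> bf; split; last by have [_ [N fN]] := bf; exists N => z; exact: normc_translation.
move: f bf; apply: cbm_induction => [f cf|c f g bf bg mf mg|u f N bu bf uN uf mu].
- have H (n : nat) : exists g : BE * BE -> R[i], cmeasurable g /\
      forall z, normc (translation f z - g z) <= n.+1%:R^-1.
    have [//|k [c [_ Hc]]] := @translation_approximation f n.+1%:R^-1 cf.
    exists (fun z => \sum_(0 <= j < k) c j * (phi j z.1 * phi j z.2)); split; last by case.
    apply: cmeasurable_sum => j; apply: cmeasurableZ; have [[mr mi] _] := phi_cbm j.
    apply: cmeasurableM; split.
    + by apply: (measurableT_comp mr); exact: measurable_fst.
    + by apply: (measurableT_comp mi); exact: measurable_fst.
    + by apply: (measurableT_comp mr); exact: measurable_snd.
    + by apply: (measurableT_comp mi); exact: measurable_snd.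
  have [u Hu] := boolp.choice H.
  apply: (@cmeasurable_lim _ _ _ u) => [n|z]; first by have [] := Hu n.
  apply/ccvg_normcP; apply: (@squeeze_cvgr _ _ _ _ (fun=> 0) (fun n => n.+1%:R^-1)).
  + apply: nearW => n; rewrite normc_ge0/= normc_distC.
    by have [_] := Hu n; apply.
  + exact: cvg_cst.
  + exact: cvg_harmonic.
- rewrite (_ : translation _ = (fun z => c * translation f z + translation g z)).
    by apply: cmeasurableD => //; exact: cmeasurableZ.
  by apply/funext => z; exact: (bfunctional_lin (cintm_bfunctional _)).
- apply: (cmeasurable_lim mu) => z.
  by apply: (cintm_bounded_cvg_continuous (mu := nu z.1 z.2) (M := N)) => // n; have [] := bu n.
Qed.

Lemma representing_measures_measurable (A : set BE) : measurable A ->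
  measurable_fun setT ((fun z => nu z.1 z.2 A) : BE * BE -> \bar R).
Proof.
move=> mA; have [[mr _] _] := translation_cbm (@cbm_cind _ _ R _ mA).
rewrite (_ : (fun z => _) = (fun z => (complex.Re (translation (cind A) z))%:E)).
  exact/measurable_EFinP.
apply/funext => z; rewrite /translation cintm_cind//= fineK//.
by rewrite fin_num_measure.
Qed.

Definition convolution_functional (mu mu' : M) (f : BE -> R[i]) : R[i] :=
  cint mu' (fun y => cint mu (fun x => translation f (x, y))).

Lemma normc_inner_le (mu : M) f (N : R) y : cbm f -> (forall x, normc (f x) <= N) ->
  normc (cint mu (fun x => translation f (x, y))) <= tv mu * N.
Proof.
move=> bf fN; apply: normc_cint_le; first exact/cbm_section/translation_cbm.
by move=> x; exact: normc_translation.
Qed.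

Lemma normc_convolution_functional_le (mu mu' : M) f (N : R) :
  cbm f -> (forall x, normc (f x) <= N) ->
  normc (convolution_functional mu mu' f) <= tv mu * tv mu' * N.
Proof.
move=> bf fN; rewrite mulrAC mulrC; apply: normc_cint_le.
  exact/cint_section_cbm/translation_cbm.
by move=> y; exact: normc_inner_le.
Qed.

Lemma convolution_functional_bfunctional mu mu' : bfunctional (convolution_functional mu mu').
Proof.
split=> [c f g bf bg|]; last by exists (tv mu * tv mu') => f N; exact: normc_convolution_functional_le.
rewrite /convolution_functional.
rewrite -(bfunctional_lin (cint_bfunctional mu')); last 2 first.
- exact/cint_section_cbm/translation_cbm.
- exact/cint_section_cbm/translation_cbm.
congr cint; apply/funext => y.
rewrite -(bfunctional_lin (cint_bfunctional mu)); last 2 first.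
- exact/cbm_section/translation_cbm.
- exact/cbm_section/translation_cbm.
congr cint; apply/funext => x.
exact: (bfunctional_lin (cintm_bfunctional _)).
Qed.

Lemma convolution_functional_bounded_cvg mu mu' :
  bounded_cvg_continuous (convolution_functional mu mu').
Proof.
move=> u f N mu_ uN uf.
have bu n : cbm (u n) by split; [exact: mu_|exists N].
have bf : cbm f.
  split; first exact: (cmeasurable_lim mu_ uf).
  exists N => x; apply: (ler_cvg_to (ccvg_normc (uf x)) (cvg_cst N)).
  by apply: nearW => n.
apply: (@cint_bounded_cvg _ _ _ mu' _ _ (tv mu * N)) => [n|n y|y].
- by have [] := cint_section_cbm mu (translation_cbm (bu n)).
- exact: normc_inner_le.
apply: (@cint_bounded_cvg _ _ _ mu _ _ N) => [n|n x|x].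
- by have [] := cbm_section y (translation_cbm (bu n)).
- exact: normc_translation.
- exact: (cintm_bounded_cvg_continuous mu_ uN uf).
Qed.

Definition convolution (mu mu' : M) : M :=
  functional_cmeasure (convolution_functional_bfunctional mu mu')
    (@convolution_functional_bounded_cvg mu mu').

Lemma cint_convolution mu mu' f : cbm f ->
  cint (convolution mu mu') f = cint mu' (fun y => cint mu (fun x => translation f (x, y))).
Proof. exact: cint_functional_cmeasure. Qed.

Lemma convolutionE mu mu' (A : set BE) : measurable A ->
  convolution mu mu' A = cint mu' (fun y => cint mu (fun x => (fine (nu x y A))%:C%C)).
Proof.
move=> mA; transitivity (convolution_functional mu mu' (cind A)).
  exact: functional_cmeasureE.
congr cint; apply/funext => y; congr cint; apply/funext => x.
exact: cintm_cind.
Qed.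

Lemma transform_convolution mu mu' j :
  cint (convolution mu mu') (phi j) = cint mu (phi j) * cint mu' (phi j).
Proof.
rewrite cint_convolution// (_ : (fun y => _) = (fun y => cint mu (phi j) * phi j y)).
  by rewrite (bfunctionalZ (cint_bfunctional mu')).
apply/funext => y; rewrite mulrC -(bfunctionalZ (cint_bfunctional mu))//.
by congr cint; apply/funext => x; rewrite /translation -nuP mulrC.
Qed.

(** The phi j span a dense subspace of C(E), and the integrals of continuous
    functions determine a measure. *)
Lemma transform_injective (mu mu' : M) :
  (forall j, cint mu (phi j) = cint mu' (phi j)) -> mu = mu'.
Proof.
move=> H; apply: cmeasure_ext => A mA; rewrite -!(cint_cind _ mA).
apply: (@borel_functional_ext R E (cint mu) (cint mu')); last exact: cbm_cind.
- exact: cint_bfunctional.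
- exact: cint_bfunctional.
- exact: cint_bounded_cvg.
- exact: cint_bounded_cvg.
move=> f cf; apply/eqP; rewrite -subr_eq0; apply/eqP; apply: normc_eq0P.
apply: (@eq0_le_eps _ _ (tv mu + tv mu')); first exact: normc_ge0.
move=> e e0; have [n [c Hc]] := es_dense es cf e0.
pose g u := \sum_(0 <= j < n) c j * phi j u.
have bf := cb cf; have bg : @cbm _ BE R g by apply: cbm_sum => j; exact: cbmZ.
have bfg := cbmB bf bg.
have gE : cint mu g = cint mu' g.
  rewrite (bfunctional_sum (cint_bfunctional mu))// (bfunctional_sum (cint_bfunctional mu'))//.
  by apply: eq_bigr => j _; rewrite H.
rewrite (_ : cint mu f - cint mu' f = cint mu (fun u => f u - g u) - cint mu' (fun u => f u - g u)).
  rewrite (le_trans (normc_triangle _ _))// normc_opp mulrDl lerD//.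
    exact: normc_cint_le.
  exact: normc_cint_le.
by rewrite (bfunctionalB (cint_bfunctional mu))// (bfunctionalB (cint_bfunctional mu'))// gE; ring.
Qed.

Lemma variation_convolution_le mu mu' : tv (convolution mu mu') <= tv mu * tv mu'.
Proof.
apply: (variation_le_functional (convolution_functional_bfunctional mu mu')).
  by move=> A mA; apply/esym; exact: functional_cmeasureE.
by move=> f N; exact: normc_convolution_functional_le.
Qed.

Lemma convolution_trivializing (mu mu1 mu2 : M) : mu = convolution mu1 mu2 <->
  forall th, range phi th -> cint mu th = cint mu1 th * cint mu2 th.
Proof.
split=> [-> _ [j _ <-]|H]; first exact: transform_convolution.
by apply: transform_injective => j; rewrite transform_convolution H.
Qed.

Lemma convolutionC mu mu' : convolution mu mu' = convolution mu' mu.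
Proof. by apply: transform_injective => j; rewrite !transform_convolution mulrC. Qed.

Lemma convolution_probabilities mu mu' : @probabilities R E mu -> @probabilities R E mu' ->
  @probabilities R E (convolution mu mu').
Proof.
move=> [P ->] [Q ->]; apply: cmeasure_probability => [A mA|].
  rewrite convolutionE// cint_of_measure; last first.
    rewrite (_ : (fun y => _) = (fun y => cint (of_measure P) (fun x => translation (cind A) (x, y)))).
      by apply/cint_section_cbm/translation_cbm/cbm_cind.
    by apply/funext => y; congr cint; apply/funext => x; rewrite /translation cintm_cind.
  apply: cintm_ge0 => y; rewrite cint_of_measure; last first.
    rewrite (_ : (fun x => _) = (fun x => translation (cind A) (x, y))).
      by apply/cbm_section/translation_cbm/cbm_cind.
    by apply/funext => x; rewrite /translation cintm_cind.
  by apply: cintm_ge0 => x; rewrite lecR fine_ge0.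
have one (P' : probability BE R) : cint (of_measure P') (fun=> 1) = 1.
  rewrite cint_of_measure; last exact: cbm_cst.
  rewrite (cintm_real P' (fun=> 1)) Rintegral_cst// [X in fine X](_ : _ = 1%E) ?mulr1//.
  exact: probability_setT.
rewrite convolutionE//.
under [X in cint _ X]eq_fun do under [X in cint _ X]eq_fun do rewrite probability_setT/=.
under [X in cint _ X]eq_fun do rewrite one.
exact: one.
Qed.

Lemma cint_cdirac (x : E) (f : BE -> R[i]) : cbm f -> cint (cdirac x : M) f = f x.
Proof.
move=> bf; have [[mr mi] _] := bf; rewrite cint_of_measure//.
have key (g : BE -> R) : measurable_fun setT g -> \int[@dirac _ BE x R]_u g u = g x.
  move=> mg; rewrite /Rintegral integral_dirac//; last exact/measurable_EFinP.
  by rewrite diracT mul1e.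
by apply: complex_eq; exact: key.
Qed.

(** By transform_injective, identities between convolutions reduce to
    identities between products of complex numbers. *)
Lemma convolution_banach : comm_banach_algebra tv convolution (cdirac a).
Proof.
split.
- exact: variation_eq0.
- exact: variation_triangle.
- exact: variationZ.
- exact: variation_complete.
- move=> c x y z; apply: transform_injective => j.
  by rewrite cint_linear// !transform_convolution cint_linear// mulrDl mulrA.
- exact: convolutionC.
- by move=> x y z; apply: transform_injective => j; rewrite !transform_convolution mulrA.
- by move=> x; apply: transform_injective => j; rewrite transform_convolution cint_cdirac// phi_a mul1r.
- apply/eqP; rewrite eq_le; apply/andP; split.
    apply: (variation_le_functional (cint_bfunctional (cdirac a))).
      by move=> A mA; rewrite cint_cind.
    by move=> f N bf fN; rewrite cint_cdirac// mul1r.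
  have := @normc_cmeasure_le _ _ _ (cdirac a) setT measurableT.
  by rewrite -cint_cind// cint_cdirac; [rewrite cind_in// normc1E|exact: cbm_cind].
- exact: variation_convolution_le.
Qed.

End convolution.

(** * Weak continuity of the convolution *)

Lemma initial_topology_cvg (S : choiceType) (T : topologicalType) (f : S -> T)
    (F : set_system S) (s : S) : Filter F ->
  F --> (s : initial_topology f) <-> f @ F --> f s.
Proof.
move=> FF; split=> [Fs A /initial_continuous|fFs A /= [_ [[B Bop <-] Bfs sBfA]]].
  exact: Fs.
by apply: filterS sBfA _; apply: fFs; exact: open_nbhs_nbhs.
Qed.

Lemma weak_cvgP {R : realType} {E : pmetricType R} {I : Type} (F : set_system I)
    {FF : Filter F} (u : I -> weak_cmeasure E) (mu : weak_cmeasure E) :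
  u @ F --> mu <->
  forall f, Cb f ->
    ((fun i => cint (u i) f) : I -> (R[i])^o) @ F --> (cint mu f : (R[i])^o).
Proof.
split.
  move=> /(initial_topology_cvg _ _ _).1 /cvg_sup h f bf.
  have /initial_topology_cvg := h (exist _ f bf).
  exact.
move=> H; apply/initial_topology_cvg/cvg_sup => -[f bf].
by apply/initial_topology_cvg; exact: H.
Qed.

Section dual_norm.
Context {R : realType} {E : pmetricType R}.
Local Notation BE := (borel E).

Definition unit_ball : set (E -> R[i]) :=
  [set g | ccontinuous g /\ forall x, normc (g x) <= 1].

(** Weak convergence controls functionals on continuous functions only, hence
    the restriction of the supremum to them. *)
Definition dual_norm (F : (BE -> R[i]) -> R[i]) : R :=
  sup [set normc (F g) | g in unit_ball].

Variable F : (BE -> R[i]) -> R[i].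
Hypothesis cb : forall f : E -> R[i], ccontinuous f -> @cbm _ BE R f.
Hypothesis hF : bfunctional F.

Lemma dual_norm_has_sup : has_sup [set normc (F g) | g in unit_ball].
Proof.
split.
  exists (normc (F (fun=> 0))), (fun=> 0) => //; split; first exact: ccontinuous_cst.
  by move=> x; rewrite normc0E.
have [C HC] := bfunctional_bounded hF.
by exists (C * 1) => _ [g [cg g1] <-]; apply: HC => //; exact: cb.
Qed.

Lemma dual_norm_ge g : unit_ball g -> normc (F g) <= dual_norm F.
Proof.
by move=> bg; apply: sup_upper_bound; [exact: dual_norm_has_sup|exists g].
Qed.

Lemma dual_norm_le f (M : R) : ccontinuous f -> (forall x, normc (f x) <= M) ->
  normc (F f) <= dual_norm F * M.
Proof.
move=> cf fM; have M0 : 0 <= M by rewrite (le_trans (normc_ge0 _) (fM point)).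
have [M00|M1] := eqVneq M 0.
  rewrite (_ : f = (fun=> 0)) ?(bfunctional0 hF) ?normc0E ?M00 ?mulr0//.
  apply/funext => x; apply: normc_eq0P; apply/eqP; rewrite eq_le normc_ge0 andbT.
  by rewrite -M00.
have Mp : 0 < M by rewrite lt_neqAle eq_sym M1.
have nM : normc (M^-1%:C%C : R[i]) = M^-1.
  by rewrite normc_real ger0_norm// invr_ge0.
have bg : unit_ball (fun x => M^-1%:C%C * f x).
  split; first by apply: ccontinuousZ; exact: cf.
  by move=> x; rewrite normc_mul nM mulrC ler_pdivrMr// mul1r.
have := dual_norm_ge bg; rewrite (bfunctionalZ hF); last exact: cb.
by rewrite normc_mul nM mulrC ler_pdivrMr.
Qed.

Lemma dual_norm_attained : 0 < dual_norm F ->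
  exists2 g, unit_ball g & 3 / 4 * dual_norm F <= normc (F g).
Proof.
move=> d0; have lt : 3 / 4 * dual_norm F < dual_norm F by lra.
have [_ [g bg <-] h] := sup_gt dual_norm_has_sup.1 lt.
by exists g => //; exact: ltW.
Qed.

End dual_norm.

Section gliding_perturbation.
Context {R : realType} {E : pmetricType R}.
Local Notation BE := (borel E).
Variable F : nat -> (BE -> R[i]) -> R[i].
Hypothesis cb : forall f : E -> R[i], ccontinuous f -> @cbm _ BE R f.
Hypothesis hF : forall n, bfunctional (F n).
Hypothesis F_bounded : forall f : E -> R[i], ccontinuous f ->
  exists B : R, forall n, normc (F n f) <= B.

(* The gliding perturbations: at step k the functional N k of norm at least
   4 ^ k.+1 is made large by adding or subtracting 3 ^- k.+1 * g k. *)
Variables (N : nat -> nat) (g : nat -> E -> R[i]).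
Hypothesis N_large : forall k, 4 ^+ k.+1 <= dual_norm (F (N k)).
Hypothesis g_ball : forall k, unit_ball (g k).
Hypothesis g_large : forall k, 3 / 4 * dual_norm (F (N k)) <= normc (F (N k) (g k)).

Let rad k : R := 3^-1 ^+ k.

Fixpoint glide k : E -> R[i] :=
  if k is k'.+1 then
    let p := fun x => glide k' x + (rad k)%:C%C * g k' x in
    let q := fun x => glide k' x - (rad k)%:C%C * g k' x in
    if normc (F (N k') q) <= normc (F (N k') p) then p else q
  else fun=> 0.

Let rad_gt0 k : 0 < rad k. Proof. by rewrite exprn_gt0. Qed.

Let radS k : rad k = 3 * rad k.+1.
Proof. by rewrite /rad exprS mulrA divff ?mul1r. Qed.

Let normc_rad k : normc ((rad k)%:C%C : R[i]) = rad k.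
Proof. by rewrite normc_real ger0_norm// ltW. Qed.

Let pert_cont k : ccontinuous (fun x => (rad k.+1)%:C%C * g k x).
Proof. by apply: ccontinuousZ; have [] := g_ball k. Qed.

Let glide_cont k : ccontinuous (glide k).
Proof.
elim: k => [|k IH]; first exact: ccontinuous_cst.
rewrite /=; case: ifP => _.
  by apply: ccontinuousD; [exact: IH|exact: pert_cont].
by apply: ccontinuousB; [exact: IH|exact: pert_cont].
Qed.

Let glide_step k x : normc (glide k.+1 x - glide k x) <= rad k.+1.
Proof.
have h : normc ((rad k.+1)%:C%C * g k x) <= rad k.+1.
  rewrite normc_mul normc_rad ler_piMr//; first by rewrite ltW.
  by have [_ h] := g_ball k; exact: h.
rewrite /=; case: ifP => _; first by rewrite addrAC subrr add0r.
by rewrite addrAC subrr add0r normc_opp.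
Qed.

Let glide_large k : 3 / 4 * rad k.+1 * dual_norm (F (N k)) <= normc (F (N k) (glide k.+1)).
Proof.
set p := fun x => glide k x + (rad k.+1)%:C%C * g k x.
set q := fun x => glide k x - (rad k.+1)%:C%C * g k x.
have bp := cb (@pert_cont k); have bk := cb (@glide_cont k).
have Fp : F (N k) p = F (N k) (glide k) + (rad k.+1)%:C%C * F (N k) (g k).
  rewrite (bfunctionalD (hF _) bk bp) (bfunctionalZ (hF _))//.
  by apply: cb; have [] := g_ball k.
have Fq : F (N k) q = F (N k) (glide k) - (rad k.+1)%:C%C * F (N k) (g k).
  rewrite (bfunctionalB (hF _) bk bp) (bfunctionalZ (hF _))//.
  by apply: cb; have [] := g_ball k.
have h : 2 * (rad k.+1 * normc (F (N k) (g k))) <= normc (F (N k) p) + normc (F (N k) q).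
  rewrite -(normc_opp (F (N k) q)); apply: le_trans (normc_triangle _ _).
  rewrite Fp Fq (_ : _ + _ = 2%:R%:C%C * ((rad k.+1)%:C%C * F (N k) (g k))); last first.
    by rewrite -[2%:R]/(1 + 1) real_complexD; ring.
  by rewrite !normc_mul normc_rad normc_real ger0_norm.
have h2 := ler_wpM2l (ltW (rad_gt0 k.+1)) (g_large k).
rewrite /= -/p -/q; case: (leP (normc (F (N k) q)) (normc (F (N k) p))) => qp.
  lra.
lra.
Qed.

Let glide_tail k d x : normc (glide (k + d) x - glide k x) <= 2^-1 * (rad k - rad (k + d)).
Proof.
elim: d => [|d IH]; first by rewrite addn0 !subrr normc0E mulr0.
rewrite addnS (_ : _ - glide k x = (glide (k + d).+1 x - glide (k + d) x) +
  (glide (k + d) x - glide k x)); last by ring.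
rewrite (le_trans (normc_triangle _ _))//.
have := lerD (glide_step (k + d) x) IH; have := radS (k + d); lra.
Qed.

Let glide_dist k l x : (k <= l)%N -> normc (glide l x - glide k x) <= 2^-1 * rad k.
Proof.
move=> kl; have := glide_tail k (l - k) x; rewrite subnKC//.
have := rad_gt0 l; lra.
Qed.

Let rad_cvg0 : rad k @[k --> \oo] --> (0 : R).
Proof. by apply: cvg_expr; rewrite ger0_norm// invf_lt1// ltr1n. Qed.

(** Sokal's argument for the uniform boundedness principle. The radii are
    geometric, so the steps converge uniformly to a continuous X within rad
    k.+1 / 2 of step k.+1. The value of F (N k) is at least 3 / 4 * rad k.+1 *
    dual_norm at that step, hence at least a third of this at X, and this
    grows like (4 / 3) ^ k. *)
Lemma gliding_contradiction : False.
Proof.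
have C x : exists l, ((fun k => glide k x) : nat -> (R[i])^o) @ \oo --> (l : (R[i])^o).
  apply: ccauchy_cvg => e e0.
  have /cvgrPdist_lt/(_ e e0)[n _ Hn] := rad_cvg0.
  exists n => i j ni nj; have := Hn n (leqnn n).
  rewrite /= sub0r normrN ger0_norm ?(ltW (rad_gt0 n))//; apply: le_lt_trans.
  rewrite (_ : _ - _ = (glide i x - glide n x) - (glide j x - glide n x)); last by ring.
  rewrite (le_trans (normc_triangle _ _))// normc_opp.
  have := lerD (glide_dist x ni) (glide_dist x nj); lra.
have [X HX] := boolp.choice C.
have XD k x : normc (X x - glide k x) <= 2^-1 * rad k.
  have h : ((fun l => glide l x - glide k x) : nat -> (R[i])^o) @ \oo -->
      (X x - glide k x : (R[i])^o) by apply: ccvgB; [exact: HX|exact: ccvg_cst].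
  apply: (ler_cvg_to (ccvg_normc h) (cvg_cst (2^-1 * rad k))).
  by near=> l; apply: glide_dist; near: l; exact: nbhs_infty_ge.
have cX : ccontinuous X.
  apply: ccontinuous_uniform_limit => e e0.
  have /cvgrPdist_lt/(_ e e0)[n _ Hn] := rad_cvg0.
  exists (glide n); first exact: glide_cont.
  move=> x; rewrite (le_trans (XD n x))//; have := Hn n (leqnn n).
  rewrite /= sub0r normrN ger0_norm ?(ltW (rad_gt0 n))//.
  have := rad_gt0 n; lra.
have [B HB] := F_bounded cX.
have key k : 4^-1 * (4 / 3) ^+ k.+1 <= B.
  have bX := cb cX; have bk := cb (@glide_cont k.+1).
  apply: le_trans (HB (N k)).
  have h1 := glide_large k.
  have h2 : normc (F (N k) (fun x => X x - glide k.+1 x)) <=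
      dual_norm (F (N k)) * (2^-1 * rad k.+1).
    exact: (dual_norm_le cb (hF _) (ccontinuousB cX (@glide_cont k.+1)) (XD k.+1)).
  have h3 : normc (F (N k) (glide k.+1)) <=
      normc (F (N k) X) + normc (F (N k) (fun x => X x - glide k.+1 x)).
    rewrite (bfunctionalB (hF _) bX bk) -(normc_opp (F (N k) X - _)).
    apply: le_trans (normc_triangle _ _).
    by rewrite opprB addrCA subrr addr0.
  have h4 : 4^-1 * (4 / 3) ^+ k.+1 <= 4^-1 * (rad k.+1 * dual_norm (F (N k))).
    rewrite ler_pM2l ?invr_gt0// exprMn mulrC -/(rad k.+1).
    by rewrite ler_wpM2l// ltW.
  lra.
(* Bernoulli's inequality contradicts key for k > 12 B *)
have bern k : 1 + k%:R / 3 <= (4 / 3 : R) ^+ k.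
  elim: k => [|k IH]; first by rewrite mul0r addr0 expr0.
  rewrite exprS -natr1.
  have k0 : 0 <= k%:R :> R by rewrite ler0n.
  have : (4 / 3) * (1 + k%:R / 3) <= (4 / 3) * (4 / 3 : R) ^+ k by rewrite ler_pM2l.
  lra.
pose k := Num.truncn (12 * `|B|).
have : 12 * `|B| < k.+1%:R by apply: truncnS_gt.
have := key k; have := bern k.+1; have := ler_norm B; lra.
Unshelve. all: by end_near. Qed.

End gliding_perturbation.

Theorem uniform_boundedness {R : realType} {E : pmetricType R} (compactE : compact [set: E])
    (F : nat -> (borel E -> R[i]) -> R[i]) : (forall n, bfunctional (F n)) ->
  (forall f : E -> R[i], ccontinuous f -> exists B : R, forall n, normc (F n f) <= B) ->
  exists2 B : R, 0 <= B & forall n f (M : R), ccontinuous f ->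
    (forall x, normc (f x) <= M) -> normc (F n f) <= B * M.
Proof.
move=> hF Fb.
have cb (f : E -> R[i]) (cf : ccontinuous f) : @cbm _ (borel E) R f := ccontinuous_cbm compactE cf.
have [[k Hk]|H] := pselect (exists k, forall n, dual_norm (F n) <= 4 ^+ k.+1).
  exists (4 ^+ k.+1) => [|n f M cf fM]; first by rewrite exprn_ge0.
  rewrite (le_trans (dual_norm_le cb (hF n) cf fM))// ler_wpM2r//.
  by rewrite (le_trans (normc_ge0 _) (fM point)).
exfalso.
have HN k : exists n, 4 ^+ k.+1 <= dual_norm (F n).
  apply: contrapT => h; apply: H; exists k => n; rewrite leNgt; apply/negP => lt.
  by apply: h; exists n; exact: ltW.
have [N HN'] := boolp.choice HN.
have Hg k : exists g : E -> R[i], unit_ball g /\ 3 / 4 * dual_norm (F (N k)) <= normc (F (N k) g).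
  have d0 : 0 < dual_norm (F (N k)) by rewrite (lt_le_trans _ (HN' k))// exprn_gt0.
  by have [g bg hg] := dual_norm_attained cb (hF _) d0; exists g.
have [g Hg'] := boolp.choice Hg.
apply: (@gliding_contradiction R E F cb hF Fb N g HN').
- by move=> k; have [] := Hg' k.
- by move=> k; have [] := Hg' k.
Qed.

Lemma normc_decomposition {R : realType} (h h' g g' : R[i]) (e : R) : 0 <= e ->
  normc h <= e / 4 -> normc h' <= e / 4 -> normc (g - g') <= e / 4 ->
  normc (h + g - (h' + g')) <= e.
Proof.
move=> e0 H H' G; rewrite (_ : h + g - (h' + g') = (h - h') + (g - g')); last by ring.
have := normc_triangle (h - h') (g - g'); have := normc_triangle h (- h').
rewrite normc_opp; lra.
Qed.

Section weak_continuity.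
Context {R : realType} {E : pmetricType R}.
Hypothesis compactE : compact [set: E].
Local Notation BE := (borel E).
Variable m : {finite_measure set BE -> \bar R}.
Variables (lambda : nat -> R) (phi : nat -> E -> R[i]).
Hypothesis es : eigensystem m lambda phi.
Variable nu : E -> E -> probability BE R.
Hypothesis nuP : forall x y, represents_product phi x y (nu x y).
Local Notation M := (cmeasure BE R).
Local Notation tv := (@Defs.total_variation _ BE R).
Local Notation translation := (translation nu).
Local Notation conv := (convolution compactE es nuP).

Let phi_cont j : ccontinuous (phi j). Proof. exact: (es_continuous es). Qed.
Let phi_cbm j : @cbm _ BE R (phi j) := eigenfunction_cbm compactE es j.
Let cb (f : E -> R[i]) (cf : ccontinuous f) : @cbm _ BE R f := ccontinuous_cbm compactE cf.

(** A bound B for the norm of mu as a functional on continuous functions. *)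
Definition cnorm_le (mu : M) (B : R) := forall (f : E -> R[i]) (N : R),
  ccontinuous f -> (forall x, normc (f x) <= N) -> normc (cint mu f) <= B * N.

Lemma cnorm_le_variation mu : cnorm_le mu (tv mu).
Proof. by move=> f N cf fN; apply: normc_cint_le => //; exact: cb. Qed.

Lemma cnorm_leW mu (B C : R) : B <= C -> cnorm_le mu B -> cnorm_le mu C.
Proof.
move=> BC h f N cf fN; rewrite (le_trans (h f N cf fN))// ler_wpM2r//.
by rewrite (le_trans (normc_ge0 _) (fN point)).
Qed.

Lemma translation_continuous (f : E -> R[i]) (y : E) : ccontinuous f -> ccontinuous (fun x : E => translation f (x, y)).
Proof.
move=> cf; apply: ccontinuous_uniform_limit => e e0.
have [n [c [_ Hc]]] := translation_approximation compactE es nuP cf e0.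
exists (fun x => \sum_(0 <= j < n) c j * (phi j x * phi j y)); last by move=> x; exact: Hc.
apply: ccontinuous_sum => j; apply: ccontinuousZ; apply: ccontinuousM.
  exact: phi_cont.
exact: ccontinuous_cst.
Qed.

(** Uniform limit of linear combinations of the phi j. *)
Lemma inner_continuous (mu : M) (f : E -> R[i]) : ccontinuous f ->
  ccontinuous (fun y : E => cint mu (fun x => translation f (x, y))).
Proof.
move=> cf; apply: ccontinuous_uniform_limit => e e0.
have T0 : 0 < tv mu + 1 by rewrite ltr_wpDl// variation_nneg.
have e1 : 0 < e / (tv mu + 1) by rewrite divr_gt0.
have [n [c [_ Hc]]] := translation_approximation compactE es nuP cf e1.
exists (fun y => \sum_(0 <= j < n) c j * (cint mu (phi j) * phi j y)).
  apply: ccontinuous_sum => j; apply: ccontinuousZ; apply: ccontinuousZ; exact: phi_cont.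
move=> y; pose g (x : BE) := \sum_(0 <= j < n) (c j * phi j y) * phi j x.
have bg : cbm g by apply: cbm_sum => j; exact: cbmZ.
have bs : @cbm _ BE R (fun x => translation f (x, y)) 
  by apply: cb; exact: translation_continuous.
rewrite (_ : _ - _ = cint mu (fun x => translation f (x, y) - g x)); last first.
  rewrite (bfunctionalB (cint_bfunctional mu) bs bg); congr (_ - _).
  rewrite (bfunctional_sum (cint_bfunctional mu))//; apply: eq_bigr => j _; ring.
apply: (@le_trans _ _ (tv mu * (e / (tv mu + 1)))).
  apply: normc_cint_le; first exact: cbmB.
  move=> x; have := Hc x y.
  rewrite (_ : \sum_(0 <= j < n) c j * (phi j x * phi j y) = g x)//.
  by apply: eq_bigr => j _; ring.
rewrite mulrCA ler_piMr ?(ltW e0)// ler_pdivrMr// mul1r lerDl.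
exact: ler01.
Qed.

Lemma cnorm_le_convolution mu mu' (B B' : R) : cnorm_le mu B -> cnorm_le mu' B' ->
  cnorm_le (conv mu mu') (B' * B).
Proof.
move=> h h' f N cf fN; rewrite cint_convolution; last exact: cb.
rewrite -mulrA; apply: h'; first exact: inner_continuous.
move=> y; apply: h; first exact: translation_continuous.
by move=> x; apply: normc_translation => //; exact: cb.
Qed.

(** Up to an error controlled by B, f is a combination of the phi j, on which
    the convolution acts through products of transforms. *)
Lemma convolution_weak_cvg {I : Type} (F : set_system I) {FF : Filter F}
    (u v : I -> M) (mu mu' : M) (B : R) : 0 <= B ->
  (\forall i \near F, cnorm_le (u i) B /\ cnorm_le (v i) B) ->
  cnorm_le mu B -> cnorm_le mu' B ->
  (forall f : E -> R[i], ccontinuous f ->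
    ((fun i => cint (u i) f) : I -> (R[i])^o) @ F --> (cint mu f : (R[i])^o)) ->
  (forall f : E -> R[i], ccontinuous f ->
    ((fun i => cint (v i) f) : I -> (R[i])^o) @ F --> (cint mu' f : (R[i])^o)) ->
  forall f : E -> R[i], ccontinuous f ->
    ((fun i => cint (conv (u i) (v i)) f) : I -> (R[i])^o) @ F
      --> (cint (conv mu mu') f : (R[i])^o).
Proof.
move=> B0 uvB muB mu'B umu vmu' f cf; apply/ccvg_normcP/cvgrPdist_le => e e0.
have BB0 : 0 <= B * B by rewrite mulr_ge0.
have C0 : 0 < 4 * (B * B + 1) by rewrite mulr_gt0// ltr_wpDl.
have e1 : 0 < e / (4 * (B * B + 1)) by rewrite divr_gt0.
have [n [c Hc]] := es_dense es cf e1.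
pose g u := \sum_(0 <= j < n) c j * phi j u.
have cg : ccontinuous g.
  by apply: ccontinuous_sum => j; apply: ccontinuousZ; exact: phi_cont.
have chh : ccontinuous (fun x => f x - g x) by exact: ccontinuousB.
have split_fg (w : M) : cint w f = cint w (fun x => f x - g x) + cint w g.
  by rewrite (bfunctionalB (cint_bfunctional w) (cb cf) (cb cg)) subrK.
have gE (w w' : M) : cint (conv w w') g =
    \sum_(0 <= j < n) c j * (cint w (phi j) * cint w' (phi j)).
  rewrite (bfunctional_sum (cint_bfunctional _))//; apply: eq_bigr => j _.
  by rewrite transform_convolution.
have small (w w' : M) : cnorm_le w B -> cnorm_le w' B ->
    normc (cint (conv w w') (fun x => f x - g x)) <= e / 4.
  move=> hw hw'; rewrite (le_trans (cnorm_le_convolution hw hw' chh Hc))//.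
  rewrite (_ : B * B * _ = (e / 4) * (B * B / (B * B + 1))); last first.
    by field; rewrite gt_eqF// ltr_wpDl.
  rewrite ler_piMr ?divr_ge0 ?(ltW e0)//.
  by rewrite ler_pdivrMr ?mul1r ?lerDl ?ler01// ltr_wpDl.
have gcv : ((fun i => cint (conv (u i) (v i)) g) : I -> (R[i])^o) @ F -->
    (cint (conv mu mu') g : (R[i])^o).
  rewrite (_ : (fun i => cint (conv (u i) (v i)) g) = (fun i =>
    \sum_(0 <= j < n) c j * (cint (u i) (phi j) * cint (v i) (phi j)))); last first.
    by apply/funext => i; exact: gE.
  rewrite gE; apply: ccvg_sum => j; apply: ccvgM; first exact: ccvg_cst.
  by apply: ccvgM; [exact/umu/phi_cont|exact/vmu'/phi_cont].
have e4 : 0 < e / 4 by rewrite divr_gt0.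
move/ccvg_normcP : gcv => /cvgrPdist_le/(_ _ e4) near_g.
apply: filterS2 uvB near_g => i [ui vi].
rewrite !sub0r !normrN !ger0_norm ?normc_ge0// => hg.
rewrite split_fg (split_fg (conv mu mu')).
by apply: normc_decomposition hg; [exact: ltW|exact: small|exact: small].
Qed.

(** Integrating f against conv mu mu' amounts to integrating against mu' a
    continuous function that depends on mu and f only. *)
Lemma convolution_continuous_r mu : continuous (conv mu : weak_cmeasure E -> weak_cmeasure E).
Proof.
move=> mu'; apply/(@weak_cvgP R E _ _ (nbhs_filter (mu' : weak_cmeasure E))) => f [cf _].
rewrite (_ : (fun w : weak_cmeasure E => cint (conv mu w) f) =
  (fun w : weak_cmeasure E => cint w (fun y => cint mu (fun x => translation f (x, y))))); last first.
  by apply/funext => w; rewrite cint_convolution//; exact: cb.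
rewrite cint_convolution; last exact: cb.
have ci := @inner_continuous mu f cf.
have /(@weak_cvgP R E _ _ (nbhs_filter (mu' : weak_cmeasure E))) :=
  @cvg_id _ (nbhs (mu' : weak_cmeasure E)).
by apply; split=> //; exact: (ccontinuous_cbounded compactE ci).
Qed.

(** Weakly convergent sequences are norm-bounded on C(E) by
    uniform_boundedness, so that convolution_weak_cvg applies to them as it
    does on sets bounded in variation. *)
Lemma convolution_weakly_continuous : weakly_continuous conv.
Proof.
have Cbc (f : E -> R[i]) : ccontinuous f -> Cb f.
  by move=> cf; split=> //; exact: (ccontinuous_cbounded compactE cf).
have UB (u : nat -> weak_cmeasure E) (mu : weak_cmeasure E) : u @ \oo --> mu ->
    exists2 B : R, 0 <= B & forall n, cnorm_le (u n) B.
  move=> /weak_cvgP h.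
  have hF n : bfunctional (cint (u n)) by exact: cint_bfunctional.
  have [f cf|B B0 HB] := uniform_boundedness compactE hF.
    have hc : cvgn (fun n => normc (cint (u n) f)).
      by apply/cvg_ex; exists (normc (cint mu f)); apply: ccvg_normc; exact/h/Cbc.
    have [N [_ HN]] := cvg_seq_bounded hc.
    exists (N + 1) => n; have := HN (N + 1); rewrite ltrDl => /(_ ltr01 n I).
    by rewrite /= ger0_norm ?normc_ge0.
  by exists B => // n f N cf fN; exact: HB.
split.
- move=> u v mu mu' umu vmu'.
  have [B1 B10 H1] := UB u mu umu; have [B2 B20 H2] := UB v mu' vmu'.
  apply/weak_cvgP => f [cf _].
  have t1 := variation_nneg mu; have t2 := variation_nneg mu'.
  apply: (@convolution_weak_cvg _ _ _ u v mu mu' (B1 + B2 + tv mu + tv mu')) => //.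
  + by rewrite !addr_ge0.
  + apply: nearW => n; split.
      by apply: (cnorm_leW _ (H1 n)); lra.
    by apply: (cnorm_leW _ (H2 n)); lra.
  + by apply: (cnorm_leW _ (cnorm_le_variation mu)); lra.
  + by apply: (cnorm_leW _ (cnorm_le_variation mu')); lra.
  + by move=> g cg; move/weak_cvgP : umu; apply; exact: Cbc.
  + by move=> g cg; move/weak_cvgP : vmu'; apply; exact: Cbc.
- move=> mu'; rewrite (_ : conv ^~ mu' = conv mu'); first exact: convolution_continuous_r.
  by apply/funext => mu; exact: convolutionC.
- exact: convolution_continuous_r.
- move=> r; apply/subspace_continuousP => -[mu mu'] /= [tmu tmu'].
  apply/weak_cvgP => f [cf _].
  have r0 : 0 <= r by rewrite (le_trans (variation_nneg mu) tmu).
  set F := within _ _.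
  have Fid : F --> nbhs ((mu, mu') : weak_cmeasure E * weak_cmeasure E) by exact: cvg_within.
  have F1 : (fst : weak_cmeasure E * weak_cmeasure E -> weak_cmeasure E) @ F --> mu.
    by apply: cvg_trans (cvg_app _ Fid) _; exact: cvg_fst.
  have F2 : (snd : weak_cmeasure E * weak_cmeasure E -> weak_cmeasure E) @ F --> mu'.
    by apply: cvg_trans (cvg_app _ Fid) _; exact: cvg_snd.
  apply: (@convolution_weak_cvg _ F _ fst snd mu mu' r) => //.
  + apply: filterS (withinT _ _) => -[w w'] /= [h h'].
    by split; [apply: (cnorm_leW h)|apply: (cnorm_leW h')]; exact: cnorm_le_variation.
  + exact: (cnorm_leW tmu (cnorm_le_variation mu)).
  + exact: (cnorm_leW tmu' (cnorm_le_variation mu')).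
  + by move=> g cg; move/weak_cvgP : F1; apply; exact: Cbc.
  + by move=> g cg; move/weak_cvgP : F2; apply; exact: Cbc.
Qed.

End weak_continuity.

(** * The eigenfunctions of the semigroup *)

Section eigensystem_of_semigroup.
Context {R : realType} {E : pmetricType R}.
Hypothesis compactE : compact [set: E].
Local Notation BE := (borel E).
Variable T : R -> (E -> R[i]) -> (E -> R[i]).
Variable p : R -> E -> subprobability BE R.
Hypothesis fellerT : feller_semigroup T.
Hypothesis kernelT : transition_kernel T p.
Variable m : {finite_measure set BE -> \bar R}.
Variable k : R -> E -> E -> R.
Hypothesis sk : symmetric_kernel m p k.
Local Notation kop := (kop m k).
Variable T2 : R -> (E -> R[i]) -> (E -> R[i]).
Hypothesis semigroupT2 : L2_semigroup m T2.
Hypothesis extT2 : forall (t : R) f, 0 <= t -> C0 f -> ae_eq m setT (T2 t f) (T t f).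
Variable lambda : nat -> R.
Hypothesis eigenT2 : eigenvalue_listing m T2 lambda.
Variable phi : nat -> E -> R[i].
Hypothesis orthogonal_phi : orthogonal_family m phi.
Hypothesis T2phi : forall (t : R) j, 0 <= t ->
  ae_eq m setT (T2 t (phi j)) (fun x => (expR (- lambda j * t))%:C%C * phi j x).
Hypothesis phi0 : ae_eq m setT (phi 0%N) (fun=> 1).
Hypothesis phi_bounded : exists M : R, forall j, L2norm m (phi j) <= M.

Let lambda0 j : 0 <= lambda j.
Proof. by have [l0 lnd _] := eigenT2; rewrite (le_trans l0)// lnd. Qed.

Let phi_sqint j : sqint m (phi j).
Proof. by apply/L2P; have [] := orthogonal_phi. Qed.

Lemma kop_eigenfunction (t : R) j : 0 < t ->
  ae_eq m setT (kop t (phi j)) (fun x => (expR (- lambda j * t))%:C%C * phi j x).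
Proof.
move=> t0; have h1 := T2_kop compactE fellerT kernelT sk semigroupT2 extT2 t0 (phi_sqint j).
exact: ae_eq_trans (ae_eq_sym h1) (T2phi j (ltW t0)).
Qed.

(** Since kop 1 maps L^2 into C(E), exp (lambda_j) * kop 1 (phi j) is a
    continuous version of phi j. *)
Lemma continuous_eigenfunction j :
  exists f : E -> R[i], ccontinuous f /\ ae_eq m setT f (phi j).
Proof.
exists (fun x => (expR (lambda j))%:C%C * kop 1 (phi j) x); split.
  apply: ccontinuousZ.
  exact: (kop_continuous compactE fellerT kernelT sk ltr01 (phi_sqint j)).
have := @kop_eigenfunction 1 j ltr01; apply: filterS => x /= h /h ->.
by rewrite mulr1 mulrA -real_complexM -expRD subrr expR0 mul1r.
Qed.

Section representatives.
Variable phic : nat -> E -> R[i].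
Hypothesis phicP : continuous_representatives m phi phic.

Let phic_cont j : ccontinuous (phic j). Proof. by have [] := phicP j. Qed.
Let phic_ae j : ae_eq m setT (phic j) (phi j). Proof. by have [] := phicP j. Qed.
Let phic_meas j : @cmeasurable _ BE R (phic j).
Proof. exact: ccontinuous_borel. Qed.
Let phi_meas j : @cmeasurable _ BE R (phi j).
Proof. by case: (phi_sqint j). Qed.

Let phic_sqn j : sqn m (phic j) = sqn m (phi j).
Proof. exact: ae_eq_sqn. Qed.

Let phic_sqint j : sqint m (phic j).
Proof. exact: (cbm_sqint m (ccontinuous_cbm compactE (@phic_cont j))). Qed.

Lemma representative_orthogonal : orthogonal_family m phic.
Proof.
have [_ nrm orth] := orthogonal_phi; split=> [j|j|j k' jk].
- exact/L2P.
- by rewrite -sqrf_eq0 L2norm_sqr// phic_sqn -L2norm_sqr// sqrf_eq0.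
rewrite -(orth j k' jk) !L2innerE; apply: ae_eq_cintm.
- by apply: cmeasurableM => //; exact: cmeasurableJ.
- by apply: cmeasurableM => //; exact: cmeasurableJ.
have h1 := @phic_ae j; have h2 := @phic_ae k'.
by apply: filterS2 h1 h2 => x /= e1 e2 Dx; rewrite e1// e2.
Qed.

Lemma representative_bounded : exists S : R, forall j, sqn m (phic j) <= S.
Proof.
have [M HM] := phi_bounded; exists (M ^+ 2) => j.
rewrite phic_sqn -L2norm_sqr//; have := L2norm_ge0 m (phi j); have := HM j.
by move: (L2norm _ _) => x xM x0; nra.
Qed.

Lemma representative_eigen (t : R) j : 0 < t ->
  kop t (phic j) = (fun x => (expR (- lambda j * t))%:C%C * phic j x).
Proof.
move=> t0; apply: (continuous_ae_eq compactE fellerT kernelT sk).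
- exact: (kop_continuous compactE fellerT kernelT sk).
- by apply: ccontinuousZ; exact: phic_cont.
rewrite (ae_eq_kop sk t0 (@phic_meas j) (@phi_meas j) (@phic_ae j)).
apply: ae_eq_trans (kop_eigenfunction j t0) _.
by have := @phic_ae j; apply: filterS => x /= h /h ->.
Qed.

Lemma representative_one : phic 0%N = (fun=> 1).
Proof.
apply: (continuous_ae_eq compactE fellerT kernelT sk).
- exact: phic_cont.
- exact: ccontinuous_cst.
exact: ae_eq_trans (@phic_ae 0%N) phi0.
Qed.

Lemma representative_eigensystem : eigensystem m lambda phic.
Proof.
have trace (t : R) : 0 < t -> \sum_(0 <= j < n) expR (- lambda j * (t + t)) @[n --> \oo]
    --> \int[m]_x sqn m (fun y : BE => (k t x y)%:C%C).
  move=> t0; have [_ _ [omega ob eig]] := eigenT2.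
  apply: (hilbert_schmidt_trace compactE fellerT kernelT sk t0 ob) => j.
  exact: (generator_eigenfunction compactE fellerT kernelT sk semigroupT2 extT2).
have orth := representative_orthogonal; have bdd := representative_bounded.
split.
- exact: phic_cont.
- exact: orth.
- exact: lambda0.
- exact: representative_one.
- by move=> t t0; exact: (heat_majorant sk orth representative_eigen trace t0).
- by move=> t t0; exact: (triple_majorant sk orth bdd representative_eigen trace t0).
- move=> t x y t0.
  exact: (heat_ge0 compactE fellerT kernelT sk lambda0 phic_cont orth representative_eigen trace).
- move=> f e cf e0.
  exact: (phi_span_dense compactE fellerT kernelT sk lambda0 phic_cont orth representative_eigen trace).
Qed.

(** For t > 0 this is the eigenvalue equation of the kernel operator; at t = 0
    the transition measures act on continuous functions as the identity. *)
Lemma transition_eigenfunction (t : R) x j : 0 <= t ->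
  cintm (p t x) (phic j) = (expR (- lambda j * t))%:C%C * phic j x.
Proof.
have bj := ccontinuous_cbm compactE (@phic_cont j).
rewrite le_eqVlt => /predU1P[<-|t0].
  have c0 := ccontinuous_C0 compactE (@phic_cont j).
  by rewrite -(kernelT _ (lexx 0) c0) (feller0 fellerT c0) mulr0 expR0 mul1r.
by rewrite (kernel_integral_bounded sk x t0 bj) representative_eigen.
Qed.

End representatives.

End eigensystem_of_semigroup.

Section trivializable.
Context {R : realType} {E : pmetricType R}.
Hypothesis compactE : compact [set: E].
Local Notation BE := (borel E).
Variable m : {finite_measure set BE -> \bar R}.
Variables (lambda : nat -> R) (phi : nat -> E -> R[i]).
Hypothesis es : eigensystem m lambda phi.
Variable nu : E -> E -> probability BE R.
Hypothesis nuP : forall x y, represents_product phi x y (nu x y).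
Variable a : E.
Hypothesis phi_a : forall j, phi j a = 1.
Variable T : R -> (E -> R[i]) -> (E -> R[i]).
Variable p : R -> E -> subprobability BE R.
Hypothesis sfT : strong_feller T p.
Hypothesis p_phi : forall (t : R) x j, 0 <= t ->
  cintm (p t x) (phi j) = (expR (- lambda j * t))%:C%C * phi j x.

Lemma convolution_trivializable (G : set (cmeasure BE R)) :
  (forall t : R, 0 <= t -> G (of_measure (p t a))) ->
  trivializable_convolution G T p (convolution compactE es nuP) (range phi).
Proof.
move=> GP; have bphi j := eigenfunction_cbm compactE es j.
have p_cint (t : R) x j : 0 <= t -> cint (of_measure (p t x)) (phi j) =
    (expR (- lambda j * t))%:C%C * phi j x.
  by move=> t0; rewrite cint_of_measure// p_phi.
split.
- exact: sfT.
- by exists a; exact: convolution_banach.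
- exact: convolution_weakly_continuous.
- exact: convolution_probabilities.
- move=> _ [j _ <-]; split; first by have [mf bf] := bphi j.
  by move=> /(congr1 (fun f => f a)) /eqP; rewrite phi_a oner_eq0.
- exact: convolution_trivializing.
- (* the transition measures from the unit point a are the semigroup *)
  exists (fun t => of_measure (p t a)); split=> [t|s t s0 t0|t x t0]; first exact: GP.
  + apply: (transform_injective compactE es) => j.
    rewrite transform_convolution !p_cint ?addr_ge0// phi_a !mulr1 -real_complexM.
    by rewrite mulrDr expRD.
  + apply: (transform_injective compactE es) => j.
    by rewrite transform_convolution !p_cint// cint_cdirac// phi_a mulr1.
Qed.

Lemma convolution_FLTC : conservative p ->
  FLTC T p (convolution compactE es nuP) (range phi).
Proof.
move=> cp; apply: convolution_trivializable => t t0; apply: cmeasure_probability.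
  move=> A mA; rewrite /of_measure /= /of_measure_fun asboolT// lecR.
  by apply: fine_ge0.
rewrite /of_measure /= /of_measure_fun asboolT//.
by rewrite [X in fine X](_ : _ = 1%E)//; exact: cp.
Qed.

End trivializable.

Theorem proposition3p3 (R : realType) (E : pmetricType R)
    (compactE : compact [set: E])
    (T : R -> (E -> R[i]) -> (E -> R[i]))
    (p : R -> E -> subprobability (borel E) R)
    (fellerT : feller_semigroup T)
    (kernelT : transition_kernel T p)
    (m : {finite_measure set (borel E) -> \bar R})
    (dens : R -> E -> E -> R)
    (dens_measurable : forall t : R, 0 < t ->
      measurable_fun setT (fun z : borel E * borel E => dens t z.1 z.2))
    (dens_bounded : forall t : R, 0 < t ->
      exists M : R, forall x y, `|dens t x y| <= M)
    (dens_sym : forall (t : R) x y, 0 < t -> dens t x y = dens t y x)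
    (densE : forall (t : R) x (A : set (borel E)), 0 < t -> measurable A ->
      p t x A = (\int[m]_(y in A) (dens t x y)%:E)%E)
    (T2 : R -> (E -> R[i]) -> (E -> R[i]))
    (semigroupT2 : L2_semigroup m T2)
    (extT2 : forall (t : R) f, 0 <= t -> C0 f -> ae_eq m setT (T2 t f) (T t f))
    (lambda : nat -> R)
    (eigenT2 : eigenvalue_listing m T2 lambda)
    (phi : nat -> E -> R[i])
    (orthogonal_phi : orthogonal_family m phi)
    (T2phi : forall (t : R) j, 0 <= t ->
      ae_eq m setT (T2 t (phi j))
        (fun x => (expR (- lambda j * t))%:C%C * phi j x))
    (phi0 : ae_eq m setT (phi 0%N) (fun=> 1))
    (phi_bounded : exists M : R, forall j, L2norm m (phi j) <= M) :
  (forall j, exists f : E -> R[i],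
     ccontinuous f /\ ae_eq m setT f (phi j)) /\
  forall phic : nat -> E -> R[i], continuous_representatives m phi phic ->
  [/\ forall (t : R) x y xi, 0 < t ->
        cvgn (series (fun j => normc (q_term m lambda phic t x y xi j))),
      (real_valued phic \/ exists a, forall j, phic j a = 1) ->
        (forall (t : R) x y xi, 0 < t -> 0 <= q m lambda phic t x y xi) <->
        (forall x y, exists nu, represents_product phic x y nu)
    & forall nu : E -> E -> probability (borel E) R,
      (forall x y, represents_product phic x y (nu x y)) ->
      (exists a, forall j, phic j a = 1) ->
      (forall A : set (borel E), measurable A ->
         measurable_fun setT ((fun z => nu z.1 z.2 A) : borel E * borel E -> \bar R)) /\
      exists conv : cmeasure (borel E) R -> cmeasure (borel E) R ->
                    cmeasure (borel E) R,
        [/\ forall mu mu' (A : set (borel E)), measurable A ->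
              conv mu mu' A =
              cint mu' (fun y => cint mu (fun x => (fine (nu x y A))%:C%C)),
            trivializable_convolution (@subprobabilities R E) T p conv
              (range phic)
          & conservative p -> FLTC T p conv (range phic)]].
Proof.
have sk := symmetric_kernel_of_density dens_measurable dens_bounded dens_sym densE.
split=> [j|phic phicP].
  exact: (continuous_eigenfunction compactE fellerT kernelT sk semigroupT2 extT2
    orthogonal_phi T2phi).
have es := representative_eigensystem compactE fellerT kernelT sk semigroupT2 extT2
  eigenT2 orthogonal_phi T2phi phi0 phi_bounded phicP.
have p_phi := transition_eigenfunction compactE fellerT kernelT sk semigroupT2 extT2
  orthogonal_phi T2phi phicP.
split=> [t x y xi|hyp|nu nuP [a pa]].
- exact: (q_absolutely_convergent es).
- exact: (nonnegative_iff_representable compactE es hyp).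
split; first exact: (representing_measures_measurable compactE es nuP).
exists (convolution compactE es nuP).
have sf := strong_feller_kernel compactE fellerT kernelT sk.
split.
- exact: convolutionE.
- apply: (convolution_trivializable compactE es nuP pa sf p_phi) => t t0.
  by exists (p t a).
- exact: (convolution_FLTC compactE es nuP pa sf p_phi).
Qed.
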